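(* In the setting described in the context, assume that there exist constants $\omega'\in[0,\omega)$ and $\gamma\in\mathbb{R}$ such that $$b^2 M e^{\omega\bar\tau}\int_0^t |k(s)|\,ds\le \gamma+\omega' t\qquad\text{for all } t\ge 0 .$$ Then there exists $\rho>0$ such that the following holds. If the initial data $\tilde g=(u_0(0),g,\eta_0)\in C([-\bar\tau,0];\mathcal{H})$, with $u_1=g(0)$, satisfy $$\|u_1\|_H^2+(1-\tilde\beta)\|A^{1/2}u_0(0)\|_H^2+\int_{-\bar\tau}^0|k(s)|\,\|B^*g(s)\|_H^2\,ds+\int_0^{+\infty}\beta(s)\|A^{1/2}\eta_0(s)\|_H^2\,ds<\rho^2$$ and $$\max_{s\in[-\bar\tau,0]}\|g(s)\|_H<\rho,$$ then the problem $$u_{tt}(t)+(1-\tilde\beta)Au(t)+\int_0^{+\infty}\beta(s)A\eta^t(s)\,ds+k(t)BB^*u_t(t-\tau(t))=\nabla\psi(u(t)),\quad \eta^t_t(s)=-\eta^t_s(s)+u_t(t)\qquad (t,s>0)$$ with $u(0)=u_0(0)$, $u_t(t)=g(t)$ for $t\in[-\bar\tau,0]$, $\eta^0=\eta_0$, has a unique globally defined solution, and its energy satisfies $$E(t)\le \tilde C e^{-\mu t}\qquad\text{for all } t\ge 0,$$ where $\mu:=\omega-\omega'$ and $\tilde C$ is a constant depending on the initial data.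
   Context: Setting. $H$ is a Hilbert space, $A$ a positive self-adjoint operator on $H$ with dense domain $D(A)$; $B$ is a bounded linear operator from $H$ to itself, $B^*$ its adjoint, $b:=\|B\|_{\mathcal L(H)}=\|B^*\|_{\mathcal L(H)}$. $\bar\tau>0$ is fixed; the time delay $\tau:[0,+\infty)\to[0,+\infty)$ is continuous with $\tau(t)\le\bar\tau$ for all $t\ge0$. The coefficient $k:[-\bar\tau,+\infty)\to\mathbb{R}$ is in $L^1_{loc}([-\bar\tau,+\infty))$ and there is $K>0$ with $\int_{t-\bar\tau}^t|k(s)|ds<K$ for all $t\ge0$. The memory kernel $\beta:[0,+\infty)\to[0,+\infty)$ satisfies: $\beta\in C^1(\mathbb{R}^+)\cap L^1(\mathbb{R}^+)$; $\beta(0)=\beta_0>0$; $\int_0^{+\infty}\beta(t)dt=\tilde\beta<1$; $\beta'(t)\le-\kappa\beta(t)$ for some constant $\kappa>0$. Nonlinearity. $\psi:D(A^{1/2})\to\mathbb{R}$ has a Gâteaux derivative $D\psi(u)$ at every $u\in D(A^{1/2})$ and satisfies: (a) for every $u\in D(A^{1/2})$ there is $c(u)>0$ with $|D\psi(u)(v)|\le c(u)\|v\|_H$ for all $v\in D(A^{1/2})$; hence $D\psi(u)$ extends to $H$ and $\nabla\psi(u)\in H$ denotes the vector with $\langle\nabla\psi(u),v\rangle_H=D\psi(u)(v)$ for all $v\in H$; (b) for every $r>0$ there is $L(r)>0$ with $\|\nabla\psi(u)-\nabla\psi(v)\|_H\le L(r)\|A^{1/2}(u-v)\|_H$ whenever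 $\|A^{1/2}u\|_H\le r$ and $\|A^{1/2}v\|_H\le r$; (c) $\psi(0)=0$, $\nabla\psi(0)=0$ and there is a strictly increasing continuous function $h$ on $[0,+\infty)$ with $\|\nabla\psi(u)\|_H\le h(\|A^{1/2}u\|_H)\|A^{1/2}u\|_H$ for all $u\in D(A^{1/2})$. History variable and data. $u_0(\cdot)$ on $(-\infty,0]$ and $g(\cdot)$ on $[-\bar\tau,0]$ are the initial data of the original problem $u_{tt}(t)+Au(t)-\int_0^{+\infty}\beta(s)Au(t-s)ds+k(t)BB^*u_t(t-\tau(t))=\nabla\psi(u(t))$ for $t>0$, $u=u_0$ on $(-\infty,0]$, $u_t=g$ on $[-\bar\tau,0]$; $u_1:=g(0)$, $\eta^t(s):=u(t)-u(t-s)$, and $\eta_0(s):=u_0(0)-u_0(-s)$ for $s>0$. Abstract form. $L^2_\beta((0,+\infty);D(A^{1/2}))$ is the Hilbert space of $D(A^{1/2})$-valued functions with inner product $\int_0^\infty\beta(s)\langle A^{1/2}\varphi(s),A^{1/2}\phi(s)\rangle_H ds$. $\mathcal{H}=D(A^{1/2})\times H\times L^2_\beta((0,+\infty);D(A^{1/2}))$ is the Hilbert space with inner product $\langle(u,v,w),(\tilde u,\tilde v,\tilde w)\rangle_{\mathcal H}=(1-\tilde\beta)\langle A^{1/2}u,A^{1/2}\tilde u\rangle_H+\langle v,\tilde v\rangle_H+\int_0^\infty\beta(s)\langle A^{1/2}w,A^{1/2}\tilde w\rangle_H ds$. With $U=(u,u_t,\eta^t)$ the problem reads $U'(t)=\mathcal{A}U(t)-k(t)\mathcal{B}U(t-\tau(t))+F(U(t))$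 for $t>0$, $U(s)=\tilde g(s)$ for $s\in[-\bar\tau,0]$, where $\tilde g(s)=(u_0(0),g(s),\eta_0)$, $U_0:=\tilde g(0)$, $\mathcal{A}(u,v,w)=(v,\,-(1-\tilde\beta)Au-\int_0^{+\infty}\beta(s)Aw(s)ds,\,-w_s+v)$ with domain $D(\mathcal A)=\{(u,v,w)\in D(A^{1/2})\times D(A^{1/2})\times L^2_\beta((0,+\infty);D(A^{1/2})):(1-\tilde\beta)u+\int_0^{+\infty}\beta(s)w(s)ds\in D(A),\ w_s\in L^2_\beta((0,+\infty);D(A^{1/2}))\}$, $\mathcal{B}(u,v,w)=(0,BB^*v,0)$ and $F(U)=(0,\nabla\psi(u),0)$. It is a known fact, taken as standing, that $\mathcal{A}$ generates a $C_0$-semigroup $\{S(t)\}_{t\ge0}$ on $\mathcal{H}$ with $\|S(t)\|_{\mathcal L(\mathcal H)}\le Me^{-\omega t}$ for constants $M,\omega>0$; these $M,\omega$ are fixed. Solutions are mild solutions: continuous $\mathcal H$-valued functions, equal to $\tilde g$ on $[-\bar\tau,0]$, with $U(t)=S(t)U_0+\int_0^tS(t-s)[-k(s)\mathcal{B}U(s-\tau(s))+F(U(s))]ds$ for $t\ge0$ in the interval of definition. Energy. $E(t)=\frac12\|u_t(t)\|_H^2+\frac{1-\tilde\beta}{2}\|A^{1/2}u(t)\|_H^2-\psi(u(t))+\frac12\int_0^{+\infty}\beta(s)\|A^{1/2}\eta^t(s)\|_H^2ds+\frac12\int_{t-\bar\tau}^t|k(s)|\,\|B^*u_t(s)\|_H^2ds$,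 where $u_t=g$ on $[-\bar\tau,0]$.
   Formalization: In (c) the function h is also required to satisfy h(0)=0, since a linear ∇ψ(u)=cu with h(r)=c+r can destroy the rate μ; and D(𝒜) includes the boundary condition w(0)=0, without which 𝒜 would generate no stable semigroup. *)

(* Defs.v *)
From HB Require Import structures.
From mathcomp Require Import all_boot all_order all_algebra.
From mathcomp Require Import all_classical all_reals all_analysis.

Set Implicit Arguments.
Unset Strict Implicit.
Unset Printing Implicit Defensive.

Import Order.TTheory GRing.Theory Num.Theory.
Import numFieldNormedType.Exports.

Local Open Scope classical_set_scope.
Local Open Scope ring_scope.

(* Analysis in a seminormed subspace.  [X] is a subspace of [V] and [N] is a
   seminorm on it; two elements of [X] are identified when [N] vanishes on
   their difference.  This is used with
   - [X = D(A^(1/2))] and [N = |A^(1/2) _|], a genuine norm when [A] is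
     positive;
   - the phase space [calH], whose third component is a function representing
     its class in L^2_beta, so that [N (U - V) = 0] is equality in the
     quotient.
   Lebesgue measure is taken on the Borel sets; every class of almost
   everywhere equal strongly measurable functions has a representative that is
   an everywhere limit of Borel simple functions. *)
Section Seminormed.
Context {R : realType} {V : lmodType R} (X : set V) (N : V -> R).
Let mu := @lebesgue_measure R.

Definition seq_complete : Prop :=
  forall x : nat -> V, (forall n, X (x n)) ->
    (forall e : R, 0 < e -> exists n0 : nat, forall m n : nat,
      (n0 <= m)%N -> (n0 <= n)%N -> N (x m - x n) < e) ->
    exists2 y : V, X y & N (x n - y) @[n --> \oo] --> (0 : R).

Definition continuous_into (D : set R) (f : R -> V) : Prop :=
  (forall t : R, D t -> X (f t)) /\
  (forall t : R, D t -> N (f s - f t) @[s --> within D (nbhs t)] --> (0 : R)).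

Definition simple_into (s : R -> V) : Prop :=
  [/\ finite_set (range s), range s `<=` X &
      forall v, measurable (s @^-1` [set v])].

Definition strongly_measurable (D : set R) (f : R -> V) : Prop :=
  (forall t : R, D t -> X (f t)) /\
  exists s : nat -> R -> V, (forall n, simple_into (s n)) /\
    (forall t : R, D t -> N (s n t - f t) @[n --> \oo] --> (0 : R)).

Definition simple_integrable (D : set R) (s : R -> V) : Prop :=
  simple_into s /\
  (forall v, v != 0 -> (mu (D `&` s @^-1` [set v]) < +oo)%E).

Definition simple_integral (D : set R) (s : R -> V) : V :=
  \sum_(v \in range s) fine (mu (D `&` s @^-1` [set v])) *: v.

(* [f] is Bochner integrable on [D], with integral [x] *)
Definition bochner_integral (D : set R) (f : R -> V) (x : V) : Prop :=
  [/\ strongly_measurable D f, X x &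
      exists s : nat -> R -> V,
        [/\ forall n, simple_integrable D (s n),
            (\int[mu]_(t in D) (N (f t - s n t))%:E)%E @[n --> \oo]
              --> (0%:E : \bar R) &
            N (simple_integral D (s n) - x) @[n --> \oo] --> (0 : R)]].

Record C0_semigroup (S : R -> V -> V) : Prop := {
  C0_stable : forall (t : R) x, 0 <= t -> X x -> X (S t x);
  C0_linear : forall (t a : R) x y, 0 <= t -> X x -> X y ->
    N (S t (a *: x + y) - (a *: S t x + S t y)) = 0;
  C0_bounded : forall t : R, 0 <= t ->
    exists C : R, forall x, X x -> N (S t x) <= C * N x;
  C0_zero : forall x, X x -> N (S 0 x - x) = 0;
  C0_add : forall (s t : R) x, 0 <= s -> 0 <= t -> X x ->
    N (S (s + t) x - S s (S t x)) = 0;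
  C0_continuous : forall x, X x -> N (S t x - x) @[t --> 0^'+] --> (0 : R)
}.

(* [G] is the graph of the generator of [S] *)
Definition generator (S : R -> V -> V) (G : V -> V -> Prop) : Prop :=
  forall x y, X x -> X y ->
    (G x y <->
     N (t^-1 *: (S t x - x) - y) @[t --> 0^'+] --> (0 : R)).

End Seminormed.

(* Real Hilbert spaces are represented by a complete normed module [H] together
   with an inner product [ip] such that [ip x x = `|x| ^+ 2]; an unbounded
   operator is a pair (domain, function), the values of the function outside
   the domain being irrelevant. *)
Section Operators.
Context {R : realType} {H : completeNormedModType R}.
Implicit Types (ip : {dot H for idfun}) (D : set H) (A B : H -> H).

Definition hilbert_inner_product ip : Prop := forall x, ip x x = `|x| ^+ 2.

Definition linear_operator D A : Prop :=
  D 0 /\ forall (a : R) x y, D x -> D y ->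
    D (a *: x + y) /\ A (a *: x + y) = a *: A x + A y.

(* the last clause says that [A] and its adjoint have the same graph *)
Definition self_adjoint ip D A : Prop :=
  [/\ linear_operator D A, dense D &
      forall x y, (D x /\ A x = y) <->
                  (forall z, D z -> ip (A z) x = ip z y)].

Definition positive_operator ip D A : Prop :=
  forall x, D x -> x != 0 -> 0 < ip (A x) x.

(* [(Dh, Ah)] is the nonnegative self-adjoint square root of [(D, A)] *)
Definition operator_sqrt ip D A (Dh : set H) (Ah : H -> H) : Prop :=
  [/\ self_adjoint ip Dh Ah,
      forall x, Dh x -> 0 <= ip (Ah x) x,
      forall x, D x <-> Dh x /\ Dh (Ah x) &
      forall x, D x -> A x = Ah (Ah x)].

Definition adjoint_operator ip B (Bs : H -> H) : Prop :=
  forall x y, ip (B x) y = ip x (Bs y).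

Definition operator_norm B : R :=
  sup [set `|B x| | x in [set x : H | `|x| <= 1]].

End Operators.

Section Data.
Context {R : realType} {H : completeNormedModType R}.
Let mu := @lebesgue_measure R.

Definition admissible_delay (taubar : R) (tau : R -> R) : Prop :=
  {within `[0, +oo[, continuous tau} /\
  forall t : R, 0 <= t -> 0 <= tau t <= taubar.

Definition admissible_coefficient (taubar : R) (k : R -> R) : Prop :=
  (forall T : R, mu.-integrable `[- taubar, T] (EFin \o k)) /\
  exists2 K : R, 0 < K &
    forall t : R, 0 <= t -> \int[mu]_(s in `[t - taubar, t]) `|k s| < K.

Definition kernel_mass (beta : R -> R) : R :=
  \int[mu]_(s in `[0, +oo[) beta s.

Definition memory_kernel (beta : R -> R) : Prop :=
  [/\ forall t : R, 0 <= t -> 0 <= beta t,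
      0 < beta 0,
      mu.-integrable `[0, +oo[ (EFin \o beta),
      kernel_mass beta < 1 &
      exists dbeta : R -> R,
        [/\ {within `[0, +oo[, continuous beta},
            {within `[0, +oo[, continuous dbeta},
            forall t : R, 0 < t -> is_derive t (1 : R) beta (dbeta t) &
            exists2 kappa : R, 0 < kappa &
              forall t : R, 0 <= t -> dbeta t <= - kappa * beta t]].

(* [gradpsi u] is the vector representing the Gateaux derivative
   [v |-> 'D_v psi u]; by density of [Dh] it is determined by its products
   with the elements of [Dh].  The condition [h 0 = 0] is needed: without it
   the growth condition allows gradpsi u = c u + o(u), a linear perturbation
   that can destroy the decay rate of the semigroup for arbitrarily small
   data. *)
Record admissible_nonlinearity (ip : {dot H for idfun}) (Dh : set H)
    (Ah : H -> H) (psi : H -> R) (gradpsi : H -> H) : Prop := {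
  psi_gateaux : forall u v, Dh u -> Dh v -> derivable psi u v;
  psi_bounded : forall u, Dh u -> exists2 c : R, 0 < c &
    forall v, Dh v -> `|'D_v psi u| <= c * `|v|;
  psi_gradient : forall u v, Dh u -> Dh v -> ip (gradpsi u) v = 'D_v psi u;
  psi_lipschitz : forall r : R, 0 < r -> exists2 L : R, 0 < L &
    forall u v, Dh u -> Dh v -> `|Ah u| <= r -> `|Ah v| <= r ->
      `|gradpsi u - gradpsi v| <= L * `|Ah (u - v)|;
  psi_zero : psi 0 = 0;
  gradpsi_zero : gradpsi 0 = 0;
  psi_growth : exists h : R -> R,
    [/\ {within `[0, +oo[, continuous h},
        forall x y : R, 0 <= x -> x < y -> h x < h y,
        h 0 = 0 &
        forall u, Dh u -> `|gradpsi u| <= h `|Ah u| * `|Ah u|]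
}.

End Data.

Notation phase R H := (H * H * (R -> H))%type.

Section PhaseSpace.
Context {R : realType} {H : completeNormedModType R}.
Variables (ip : {dot H for idfun}) (D : set H) (A : H -> H).
Variables (Dh : set H) (Ah : H -> H) (beta : R -> R).
Let mu := @lebesgue_measure R.

Definition graph_norm (u : H) : R := `|Ah u|.

Definition L2beta (w : R -> H) : Prop :=
  strongly_measurable Dh graph_norm `]0, +oo[ w /\
  mu.-integrable `]0, +oo[ (fun s => (beta s * `|Ah (w s)| ^+ 2)%:E).

Definition calH : set (phase R H) :=
  [set U | Dh U.1.1 /\ L2beta U.2].

Definition calH_dot (U U' : phase R H) : R :=
  (1 - kernel_mass beta) * ip (Ah U.1.1) (Ah U'.1.1) + ip U.1.2 U'.1.2 +
  \int[mu]_(s in `]0, +oo[) (beta s * ip (Ah (U.2 s)) (Ah (U'.2 s))).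

Definition calH_norm (U : phase R H) : R := Num.sqrt (calH_dot U U).

(* [w] is locally absolutely continuous with derivative [ws] and [w 0 = 0].
   Classes in L^2_beta carry no information where [beta] vanishes. *)
Definition derivative_from_zero (w ws : R -> H) : Prop :=
  {ae mu, forall s : R, 0 < s -> 0 < beta s ->
    bochner_integral Dh graph_norm `]0, s[ ws (w s)}.

(* Graph of calA : (u, v, w) |->
     (v, - A ((1 - kernel_mass beta) u + \int_0^oo beta w), - w_s + v).
   The formal term \int_0^oo beta(s) A w(s) ds only makes sense once A has been
   taken out of the sum.  The boundary condition w(0) = 0, contained in
   [derivative_from_zero], comes from eta^t(0) = u(t) - u(t) = 0; without it
   every l > 0 would be an eigenvalue and calA would generate no semigroup. *)
Definition calA (U V : phase R H) : Prop :=
  exists z ws,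
  [/\ [/\ Dh U.1.1, Dh U.1.2 & L2beta U.2],
      bochner_integral Dh graph_norm `]0, +oo[ (fun s => beta s *: U.2 s) z,
      D ((1 - kernel_mass beta) *: U.1.1 + z),
      L2beta ws /\ derivative_from_zero U.2 ws &
      calH_norm (V - (U.1.2, - A ((1 - kernel_mass beta) *: U.1.1 + z),
                      fun s => - ws s + U.1.2)) = 0].

End PhaseSpace.

Section Problem.
Context {R : realType} {H : completeNormedModType R}.
Variables (ip : {dot H for idfun}) (Dh : set H) (Ah : H -> H).
Variables (B Bs : H -> H) (taubar : R) (tau k beta : R -> R).
Variables (psi : H -> R) (gradpsi : H -> H).
Let mu := @lebesgue_measure R.
Let X := calH Dh Ah beta.
Let N := calH_norm ip Ah beta.

Definition calB (U : phase R H) : phase R H := (0, B (Bs U.1.2), cst 0).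

Definition calF (U : phase R H) : phase R H := (0, gradpsi U.1.1, cst 0).

Definition eta0 (u0 : R -> H) (s : R) : H := u0 0 - u0 (- s).

Definition gtilde (u0 g : R -> H) (s : R) : phase R H :=
  (u0 0, g s, eta0 u0).

Definition mild_solution (S : R -> phase R H -> phase R H)
    (Uini : R -> phase R H) (U : R -> phase R H) : Prop :=
  [/\ continuous_into X N `[- taubar, +oo[ U,
      forall t : R, - taubar <= t <= 0 -> N (U t - Uini t) = 0 &
      forall t : R, 0 <= t ->
        bochner_integral X N `[0, t]
          (fun s => S (t - s)
             (- k s *: calB (U (s - tau s)) + calF (U s)))
          (U t - S t (Uini 0))].

(* for U = (u, u_t, eta) *)
Definition energy (U : R -> phase R H) (t : R) : R :=
  2^-1 * `|(U t).1.2| ^+ 2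
  + (1 - kernel_mass beta) / 2 * `|Ah (U t).1.1| ^+ 2
  - psi (U t).1.1
  + 2^-1 * \int[mu]_(s in `]0, +oo[) (beta s * `|Ah ((U t).2 s)| ^+ 2)
  + 2^-1 * \int[mu]_(s in `[t - taubar, t]) (`|k s| * `|Bs (U s).1.2| ^+ 2).

End Problem.

(* Main.v *)
(* The proof works with the mild formulation alone.  Put b = |B|, let
   a = M (b^2 e^(omega taubar) |k| + delta) and w(t) = exp (\int_0^t a).  On a
   ball where |F(U)| <= delta |U|, the Picard map preserves the bound
   |U(t)| <= C0 e^(- omega t) w(t), because \int_0^t a w = w(t) - 1.  Since
   w(t) <= e^(gamma + (omega' + M delta) t), the choice
   delta = (omega - omega') / (2 M) keeps this bound, for small C0, inside the
   ball for all times, and the Picard map is a contraction on [0, +oo[ for the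
   weight exp (\int_0^t 2 M (b^2 |k| + L)), L being a Lipschitz constant of F
   on the ball; no continuation argument is needed.
   The energy is |U|^2 / 2 - psi(u) plus a delay term, and |U|^2 decays like
   e^(- (omega - omega') t).  To bound psi(u) by |A^(1/2) u|^2 one needs
   |u| <= C |A^(1/2) u|, which holds because completeness of the phase space
   makes A^(1/2) surjective. *)

Require Import Defs.
From mathcomp Require Import all_boot all_order all_algebra.
From mathcomp Require Import all_classical all_reals all_analysis.
From mathcomp Require Import measurable_realfun ring lra.
Import Order.TTheory GRing.Theory Num.Theory.
Import numFieldNormedType.Exports.
Local Open Scope classical_set_scope.
Local Open Scope ring_scope.

Set Implicit Arguments.
Unset Strict Implicit.
Unset Printing Implicit Defensive.

(** * Bochner integrals in seminormed subspaces *)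

(** The laws of the semigroup and the value of an integral are known only modulo vectors of seminorm
    zero, so equations are proved as [N (x - y) = 0] and used through triangle inequalities. The
    space [V] carries no Borel structure. Measurability of the Duhamel integrand comes instead from
    its shape: up to null vectors it is [k s *: b s + d s] with [b] and [d] continuous, a function
    of the two real quantities [k s] and [s], and simple approximants arise by replacing both with
    functions of finitely many values. Invariance and contraction use different weights. For
    invariance the growth of the weight must be paid for by the decay of the semigroup, so its rate
    is the one that the hypothesis on [k] controls. The weight for contraction may grow at any
    speed, because the iterates need only converge locally uniformly in time. Both weights are
    nondecreasing and equal to 1 at negative times, so a delayed argument does no harm to them; the
    delay costs a factor only through [expR (- omega * t)], which decreases. Uniqueness holds among
    all mild solutions, small or not, since on a bounded interval any two of them lie in a common
    ball. *)

Record seminormed {R : realType} {V : lmodType R} (X : set V) (N : V -> R) :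
    Prop := Seminormed {
  sn0 : X 0;
  sn_lin : forall (a : R) x y, X x -> X y -> X (a *: x + y);
  snD : forall x y, X x -> X y -> N (x + y) <= N x + N y;
  snZ : forall (a : R) x, X x -> N (a *: x) = `|a| * N x }.

Section SeminormedTheory.
Context {R : realType} {V : lmodType R} (X : set V) (N : V -> R).
Hypothesis sn : seminormed X N.

Lemma snXD x y : X x -> X y -> X (x + y).
Proof. by move=> Xx Xy; rewrite -(scale1r x); exact: (sn_lin sn). Qed.

Lemma snXZ (a : R) x : X x -> X (a *: x).
Proof. by move=> Xx; rewrite -(addr0 (a *: x)); apply: (sn_lin sn) => //; exact: sn0 sn. Qed.

Lemma snXN x : X x -> X (- x).
Proof. by move=> Xx; rewrite -scaleN1r; exact: snXZ. Qed.

Lemma snXB x y : X x -> X y -> X (x - y).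
Proof. by move=> Xx Xy; apply: snXD => //; exact: snXN. Qed.

Lemma sn_norm0 : N 0 = 0.
Proof. by rewrite -(scale0r (0 : V)) (snZ sn) ?normr0 ?mul0r//; exact: sn0 sn. Qed.

Lemma snN x : X x -> N (- x) = N x.
Proof. by move=> Xx; rewrite -scaleN1r (snZ sn)// normrN1 mul1r. Qed.

Lemma sn_ge0 x : X x -> 0 <= N x.
Proof.
move=> Xx; have := snD sn Xx (snXN Xx).
by rewrite subrr sn_norm0 snN//; lra.
Qed.

Lemma snB x y : X x -> X y -> N (x - y) <= N x + N y.
Proof. by move=> Xx Xy; rewrite -(snN Xy); apply: (snD sn) => //; exact: snXN. Qed.

Lemma sn_distC x y : X x -> X y -> N (x - y) = N (y - x).
Proof. by move=> Xx Xy; rewrite -opprB snN//; exact: snXB. Qed.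

Lemma sn_tri y x z : X x -> X y -> X z -> N (x - z) <= N (x - y) + N (y - z).
Proof.
move=> Xx Xy Xz; rewrite (_ : x - z = (x - y) + (y - z)); last first.
  by rewrite addrA subrK.
by apply: (snD sn); exact: snXB.
Qed.

Lemma sn_le_add x y : X x -> X y -> N x <= N y + N (x - y).
Proof.
move=> Xx Xy; rewrite -{1}(subrKC y x); apply: (snD sn) => //; exact: snXB.
Qed.

Lemma sn_dist_dist x y : X x -> X y -> `|N x - N y| <= N (x - y).
Proof.
move=> Xx Xy; rewrite ler_norml; apply/andP; split.
  by have := sn_le_add Xy Xx; rewrite sn_distC//; lra.
by have := sn_le_add Xx Xy; lra.
Qed.

Lemma sn_sum (I : Type) (r : seq I) (P : pred I) (F : I -> V) :
  (forall i, P i -> X (F i)) ->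
  X (\sum_(i <- r | P i) F i) /\
  N (\sum_(i <- r | P i) F i) <= \sum_(i <- r | P i) N (F i).
Proof.
move=> XF; elim: r => [|i r [IHX IHN]].
  by rewrite !big_nil sn_norm0; split => //; exact: sn0 sn.
rewrite !big_cons; case: ifPn => // Pi; split; first by apply: snXD => //; exact: XF.
by rewrite (le_trans (snD sn (XF _ Pi) IHX))// lerD2l.
Qed.

End SeminormedTheory.

(** * Functions with finitely many values *)

Section FinValued.
Context {R : realType}.
Notation mu := (@lebesgue_measure R).

(** The values lie in an arbitrary type, so that a pair of simple functions is again of this kind;
    two simple functions are compared on the level sets of their pair. *)
Definition fin_valued {T : Type} (p : R -> T) :=
  finite_set (range p) /\ forall q, measurable (p @^-1` [set q]).

(** Each level set of [f \o p] is a finite union of level sets of [p], whatever [f] is. This is how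
    seminorms and vector expressions of simple functions become measurable. *)
Lemma fin_valued_comp {T : choiceType} {U : Type} (p : R -> T) (f : T -> U) :
  fin_valued p -> fin_valued (f \o p).
Proof.
move=> [fp mp]; split.
  by have := finite_image f fp; rewrite image_comp.
move=> v; rewrite (_ : _ @^-1` _ = \bigcup_(q in range p `&` f @^-1` [set v]) p @^-1` [set q]).
  apply: fin_bigcup_measurable => //.
  exact: finite_setIl.
apply/seteqP; split => [x /= fx|x [q [_ fq] /= pq]].
  by exists (p x).
  by rewrite /= pq.
Qed.

Lemma fin_valued_pair {T U : Type} (p : R -> T) (q : R -> U) :
  fin_valued p -> fin_valued q -> fin_valued (fun x => (p x, q x)).
Proof.
move=> [fp mp] [fq mq]; split.
  apply: (@sub_finite_set _ _ (range p `*` range q)); last exact: finite_setX.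
  by move=> _ [x _ <-]; split => /=; exists x.
move=> [u v]; rewrite (_ : _ @^-1` _ = p @^-1` [set u] `&` q @^-1` [set v]).
  exact: measurableI.
by apply/seteqP; split => x /= => [[-> ->]//|[-> ->]].
Qed.

Lemma fin_valued_sum {T : choiceType} {U : zmodType} (p : R -> T) (f : T -> U) t :
  fin_valued p -> f (p t) = \sum_(q \in range p) (if p t == q then f q else 0).
Proof.
move=> [fp _]; rewrite (fsbigD1 (p t))//=; last by exists t.
by rewrite eqxx fsbig1 ?addr0// => q [_ /= /eqP]; rewrite eq_sym => /negbTE ->.
Qed.

Lemma measure_fin_valued_comp {T U : choiceType} (p : R -> T) (f : T -> U) (D : set R) v :
  measurable D -> (mu D < +oo)%E -> fin_valued p ->
  fine (mu (D `&` (f \o p) @^-1` [set v])) =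
  \sum_(q \in range p) (if f q == v then fine (mu (D `&` p @^-1` [set q])) else 0).
Proof.
move=> mD fD [fp mp].
have fin q : mu (D `&` p @^-1` [set q]) \is a fin_num.
  rewrite ge0_fin_numE//; apply: le_lt_trans fD; apply: le_measure => //; rewrite ?inE//.
  by apply: measurableI => //; exact: mp.
have -> : D `&` (f \o p) @^-1` [set v] =
  \big[setU/set0]_(q \in range p `&` f @^-1` [set v]) (D `&` p @^-1` [set q]).
  rewrite fsbig_setU; last exact: finite_setIl.
  apply/seteqP; split => [x [Dx /= fx]|x [q [_ fq]] [Dx /= pq]].
    by exists (p x).
  by split => //=; rewrite pq.
rewrite measure_fsbig; first last.
- by move=> i j _ _ [x [[_ /= <-] [_ /= <-]]].
- by move=> q _; apply: measurableI => //; exact: mp.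
- exact: finite_setIl.
rewrite (eq_fsbigr (fun q => (fine (mu (D `&` p @^-1` [set q])))%:E)); last first.
  by move=> q _; rewrite fineK.
rewrite fsumEFin/=; last exact: finite_setIl.
rewrite fsbig_mkcondr; apply: eq_fsbigr => q _.
rewrite /patch; case: ifPn; case: ifPn => //.
  by rewrite inE /= => /eqP.
by move=> /eqP fq /negP; rewrite inE.
Qed.

(** Gives the integrals of several functions of one [p] a common index set, the values of [p]. The
    proof regroups the sum along the fibres of [f]. *)
Lemma simple_integral_comp {V : lmodType R} {T : choiceType} (p : R -> T) (f : T -> V) (D : set R) :
  measurable D -> (mu D < +oo)%E -> fin_valued p ->
  simple_integral D (f \o p) =
  \sum_(q \in range p) fine (mu (D `&` p @^-1` [set q])) *: f q.
Proof.
move=> mD fD fp; rewrite /simple_integral.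
have ffp := (fin_valued_comp f fp).1.
under eq_fsbigr do rewrite (measure_fin_valued_comp _ _ mD fD fp).
transitivity (\sum_(v \in range (f \o p)) \sum_(q \in range p)
   (if f q == v then fine (mu (D `&` p @^-1` [set q])) *: f q else 0)).
  apply: eq_fsbigr => v _.
  rewrite !fsbig_finite//=; try exact: fp.1.
  rewrite scaler_suml; apply: eq_bigr => q _.
  by case: eqP => [->|]; rewrite ?scale0r.
rewrite exchange_fsbig//; last exact: fp.1.
apply: eq_fsbigr => q; rewrite inE => -[t _ <-].
rewrite (fsbigD1 (f (p t)))//=; last by exists t.
rewrite eqxx fsbig1 ?addr0// => v [_ /= /eqP].
by rewrite eq_sym => /negbTE ->.
Qed.

Lemma measurable_fin_valued (f : R -> R) (D : set R) : measurable D ->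
  fin_valued f -> measurable_fun D f.
Proof.
move=> mD [ff mf]; move=> _ Y mY.
rewrite (_ : f @^-1` Y = \bigcup_(v in range f `&` Y) f @^-1` [set v]).
  apply: measurableI => //; apply: fin_bigcup_measurable => //; exact: finite_setIl.
apply/seteqP; split => [x Yx|x [v [_ Yv]] /= ->//].
by exists (f x) => //; split => //; exists x.
Qed.

Lemma integral_fin_valued {T : choiceType} (p : R -> T) (f : T -> R) (D : set R) :
  measurable D -> (mu D < +oo)%E -> fin_valued p -> (forall q, 0 <= f q) ->
  (\int[mu]_(x in D) (f (p x))%:E)%E =
  (\sum_(q \in range p) fine (mu (D `&` p @^-1` [set q])) * f q)%:E.
Proof.
move=> mD fD fp f0.
have fin q : mu (D `&` p @^-1` [set q]) \is a fin_num.
  rewrite ge0_fin_numE//; apply: le_lt_trans fD; apply: le_measure => //; rewrite ?inE//.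
  apply: measurableI => //; exact: fp.2.
under eq_integral => x _.
  rewrite (fin_valued_sum f x fp) -fsumEFin; last exact: fp.1.
  over.
rewrite ge0_integral_fsum//; first last.
- exact: fp.1.
- by move=> q x _; case: ifP; rewrite lee_fin.
- move=> q; apply/measurable_EFinP.
  apply: measurable_fin_valued => //.
  have := fin_valued_comp (fun r => if r == q then f q else 0) fp; exact.
rewrite -fsumEFin; last exact: fp.1.
apply: eq_fsbigr => q _.
have -> : (\int[mu]_(x in D) ((if p x == q then f q else 0)%:E) =
  \int[mu]_(x in D) ((f q)%:E * (\1_(p @^-1` [set q]) x)%:E))%E.
  apply: eq_integral => x _; rewrite indicE.
  case: eqP => [pq|pq]; first by rewrite mem_set// mule1.
  by rewrite memNset// mule0.
rewrite ge0_integralZl//; last 2 first.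
- by apply/measurable_EFinP; apply: measurable_indic; exact: fp.2.
- by rewrite lee_fin.
rewrite integral_indic//; last exact: fp.2.
by rewrite setIC EFinM fineK// muleC.
Qed.

End FinValued.

Lemma cvg_of_dist {R : realType} {T : Type} {F : set_system T} {FF : Filter F}
    (a b : T -> R) (l : R) :
  (\forall t \near F, `|a t - l| <= b t) -> b @ F --> 0 -> a @ F --> l.
Proof.
move=> ab b0; apply/cvgrPdist_le => e e0.
move/cvgrPdist_le : b0 => /(_ e e0) b0; near=> t.
rewrite distrC; apply: (@le_trans _ _ (b t)); first by near: t.
have : `|0 - b t| <= e by near: t.
by rewrite sub0r normrN; apply: le_trans; exact: ler_norm.
Unshelve. all: by end_near. Qed.

(** * Existence and comparison of Bochner integrals *)

Section Bochner.
Context {R : realType} {V : lmodType R} (X : set V) (N : V -> R).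
Hypothesis sn : seminormed X N.
Notation mu := (@lebesgue_measure R).

Lemma simple_into_fin_valued (s : R -> V) : simple_into X s -> fin_valued s.
Proof. by case. Qed.

Lemma fin_valued_simple_into (s : R -> V) : fin_valued s -> (forall t, X (s t)) ->
  simple_into X s.
Proof. by move=> [fs ms] Xs; split => // _ [t _ <-]. Qed.

Lemma simple_into_X (s : R -> V) t : simple_into X s -> X (s t).
Proof. by move=> [_ sX _]; apply: sX; exists t. Qed.

(** The function is the pointwise limit of [N (s n t - r n t)], real functions with finitely many
    values; the reverse triangle inequality gives the convergence. *)
Lemma measurable_snB (D : set R) f g : measurable D ->
  strongly_measurable X N D f -> strongly_measurable X N D g ->
  measurable_fun D (fun t => N (f t - g t)).
Proof.
move=> mD [Xf [s [ss sf]]] [Xg [r [rs rg]]].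
apply: (@measurable_fun_cvg _ _ _ _ (fun n t => N (s n t - r n t))) => //.
  move=> n; apply: measurable_fin_valued => //.
  have := fin_valued_comp (fun p => N (p.1 - p.2)) (fin_valued_pair
    (simple_into_fin_valued (ss n)) (simple_into_fin_valued (rs n))); exact.
move=> t Dt; apply: (@cvg_of_dist _ _ _ _ _ (fun n => N (s n t - f t) + N (r n t - g t))); last first.
  by rewrite -(addr0 (0 : R)); apply: cvgD; [exact: sf|exact: rg].
have Xs n : X (s n t) by exact: simple_into_X.
have Xr n : X (r n t) by exact: simple_into_X.
apply: nearW => n.
have H1 := snXB sn (Xs n) (Xr n); have H2 := snXB sn (Xf _ Dt) (Xg _ Dt).
apply: le_trans (sn_dist_dist sn H1 H2) _.
have -> : s n t - r n t - (f t - g t) = (s n t - f t) - (r n t - g t).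
  by rewrite [in LHS]opprD [in RHS]opprD addrACA.
by apply: (snB sn); apply: (snXB sn) => //; [exact: Xf|exact: Xg].
Qed.

Lemma strongly_measurable_simple (D : set R) s : simple_into X s ->
  strongly_measurable X N D s.
Proof.
move=> ss; split => [t _|]; first exact: simple_into_X.
exists (fun=> s); split => // t _; under eq_cvg do rewrite subrr (sn_norm0 sn).
exact: cvg_cst.
Qed.

Section FiniteMeasure.
Variable D : set R.
Hypotheses (mD : measurable D) (fD : (mu D < +oo)%E).

Lemma simple_intoI s : simple_into X s -> simple_integrable X D s.
Proof.
move=> ss; split => // v _; apply: le_lt_trans fD; apply: le_measure; rewrite ?inE//.
by case: ss => _ _ ms; apply: measurableI => //; exact: ms.
Qed.

Lemma simple_integral_X s : simple_into X s -> X (simple_integral D s).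
Proof.
move=> ss; rewrite /simple_integral fsbig_finite//=; last by case: ss.
rewrite big_seq; apply: (sn_sum sn _ _).1 => v.
rewrite in_fset_set; last by case: ss.
rewrite inE => -[t _ <-]; apply: (snXZ sn); exact: simple_into_X.
Qed.

(** On the level sets of the pair [(s, r)] both integrals are sums with the same coefficients, and
    what remains is the triangle inequality for a finite sum. *)
Lemma simple_integral_dist s r : simple_into X s -> simple_into X r ->
  ((N (simple_integral D s - simple_integral D r))%:E <=
   \int[mu]_(t in D) (N (s t - r t))%:E)%E.
Proof.
move=> ss rs.
have fp := fin_valued_pair (simple_into_fin_valued ss) (simple_into_fin_valued rs).
set p := fun x => (s x, r x).
have -> : simple_integral D s = simple_integral D (fst \o p) by [].
have -> : simple_integral D r = simple_integral D (snd \o p) by [].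
rewrite !simple_integral_comp//.
(* [N] is known to be nonnegative only on [X]; the absolute value makes [f] nonnegative on every
   pair. *)
pose f q := `|N (q.1 - q.2)|.
have -> : (\int[mu]_(t in D) (N (s t - r t))%:E =
    \int[mu]_(t in D) (f (p t))%:E)%E.
  apply: eq_integral => t _; rewrite /f /p/= ger0_norm//.
  by apply: (sn_ge0 sn); apply: (snXB sn); exact: simple_into_X.
rewrite integral_fin_valued//; last by move=> q; rewrite /f.
rewrite lee_fin !fsbig_finite//=; try exact: fp.1.
rewrite -sumrB big_seq_cond [leRHS]big_seq_cond.
apply: le_trans (sn_sum sn _ _).2 _.
  move=> q; rewrite andbT in_fset_set; last exact: fp.1.
  rewrite inE => -[t _ <-]/=; apply: (snXB sn); apply: (snXZ sn); exact: simple_into_X.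
apply: ler_sum => q; rewrite andbT in_fset_set; last exact: fp.1.
rewrite inE => -[t _ <-]/=; rewrite -scalerBr (snZ sn); last first.
  by apply: (snXB sn); exact: simple_into_X.
by rewrite ger0_norm ?fine_ge0// ler_wpM2l ?fine_ge0// ler_norm.
Qed.

(** Every later estimate of a Bochner integral goes through this one. It reduces to simple functions
    by [N (s n - r n) <= N (f - s n) + phi + N (g - r n)], whose outer terms vanish in mean. *)
Lemma bochner_dist f g x y (phi : R -> R) :
  bochner_integral X N D f x -> bochner_integral X N D g y ->
  mu.-integrable D (EFin \o phi) -> (forall t, D t -> N (f t - g t) <= phi t) ->
  N (x - y) <= \int[mu]_(t in D) phi t.
Proof.
move=> [mf Xx [s [ss sf sx]]] [mg Xy [r [rs rg ry]]] iphi fgphi.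
have Xf t : D t -> X (f t) by exact: mf.1.
have Xg t : D t -> X (g t) by exact: mg.1.
have ms n := strongly_measurable_simple D (ss n).1.
have mr n := strongly_measurable_simple D (rs n).1.
have key n : ((N (simple_integral D (s n) - simple_integral D (r n)))%:E <=
   \int[mu]_(t in D) (N (f t - s n t))%:E + \int[mu]_(t in D) (phi t)%:E
   + \int[mu]_(t in D) (N (g t - r n t))%:E)%E.
  apply: le_trans (simple_integral_dist (ss n).1 (rs n).1) _.
  have phi0 t : D t -> 0 <= phi t.
    by move=> Dt; apply: le_trans (fgphi _ Dt); apply: (sn_ge0 sn); apply: (snXB sn); [exact: Xf|exact: Xg].
  have mphi : measurable_fun D phi.
    by apply/measurable_EFinP; exact: measurable_int iphi.
  have Nge0 (h : R -> V) (u : R -> V) t : X (h t) -> X (u t) -> (0 <= (N (h t - u t))%:E)%E.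
    by move=> ? ?; rewrite lee_fin; apply: (sn_ge0 sn); exact: (snXB sn).
  rewrite -ge0_integralD//; first last.
  - exact/measurable_EFinP.
  - by apply/measurable_EFinP; exact: measurable_snB.
  - by move=> t Dt; apply: Nge0; [exact: Xf|exact: simple_into_X (ss n).1].
  rewrite -ge0_integralD//; first last.
  - by apply/measurable_EFinP; exact: measurable_snB.
  - by move=> t Dt; apply: Nge0; [exact: Xg|exact: simple_into_X (rs n).1].
  - apply: emeasurable_funD; apply/measurable_EFinP => //.
    exact: measurable_snB.
  - move=> t Dt; apply: adde_ge0; last by rewrite lee_fin phi0.
    by apply: Nge0; [exact: Xf|exact: simple_into_X (ss n).1].
  apply: ge0_le_integral => //.
  - by move=> t Dt; apply: Nge0; [exact: simple_into_X (ss n).1|exact: simple_into_X (rs n).1].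
  - by apply/measurable_EFinP; exact: measurable_snB.
  - apply: emeasurable_funD; last by apply/measurable_EFinP; exact: measurable_snB.
    by apply: emeasurable_funD; apply/measurable_EFinP => //; exact: measurable_snB.
  move=> t Dt; rewrite -!EFinD lee_fin.
  have Xs := simple_into_X t (ss n).1; have Xr := simple_into_X t (rs n).1.
  apply: le_trans (sn_tri sn (y := f t) Xs (Xf _ Dt) Xr) _.
  rewrite (sn_distC sn Xs (Xf _ Dt)) -addrA lerD2l.
  apply: le_trans (sn_tri sn (y := g t) (Xf _ Dt) (Xg _ Dt) Xr) _.
  by rewrite lerD2r fgphi.
have fphi : (\int[mu]_(t in D) (phi t)%:E)%E = (\int[mu]_(t in D) phi t)%:E.
  by rewrite fineK//; exact: integrable_fin_num.
apply/ler_addgt0Pr => e e0.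
(* Four errors share [e]: the mean distances of [f] and [g] to their approximants, and the distances
   of the two approximating integrals to [x] and [y]. *)
have e4 : 0 < e / 4 by lra.
move/fine_cvgP : sf => [sfin /cvgrPdist_lt/(_ _ e4) sf].
move/fine_cvgP : rg => [rfin /cvgrPdist_lt/(_ _ e4) rg].
move/cvgrPdist_lt : sx => /(_ _ e4) sx; move/cvgrPdist_lt : ry => /(_ _ e4) ry.
near \oo => n.
have /(_ n) := key; rewrite fphi.
have n1 : (\int[mu]_(t in D) (N (f t - s n t))%:E)%E \is a fin_num by near: n.
have n2 : (\int[mu]_(t in D) (N (g t - r n t))%:E)%E \is a fin_num by near: n.
rewrite -(fineK n1) -(fineK n2) -!EFinD lee_fin => K.
have k1 : `|0 - fine (\int[mu]_(t in D) (N (f t - s n t))%:E)%E| < e / 4 by near: n.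
have k2 : `|0 - fine (\int[mu]_(t in D) (N (g t - r n t))%:E)%E| < e / 4 by near: n.
have k3 : `|0 - N (simple_integral D (s n) - x)| < e / 4 by near: n.
have k4 : `|0 - N (simple_integral D (r n) - y)| < e / 4 by near: n.
have Is := simple_integral_X (ss n).1; have Ir := simple_integral_X (rs n).1.
have t1 := sn_tri sn Xx Is Xy; have t2 := sn_tri sn Is Ir Xy.
rewrite (sn_distC sn Xx Is) in t1.
move: k1 k2 k3 k4 K t1 t2; rewrite !sub0r !normrN !ltr_norml.
set a := fine _; set b := fine _; set c := Rintegral _ _ _.
by clearbody a b c; clear key fphi n1 n2; lra.
Unshelve. all: by end_near. Qed.

(** A criterion for integrability that can be checked by exhibiting approximants: they converge only
    pointwise, and [phi] makes dominated convergence applicable. *)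
Definition dominated_approximable (f : R -> V) : Prop :=
  (forall t, D t -> X (f t)) /\
  exists (s : nat -> R -> V) (phi : R -> R),
    [/\ forall n, simple_into X (s n),
        forall t, D t -> N (s n t - f t) @[n --> \oo] --> (0 : R),
        mu.-integrable D (EFin \o phi) &
        forall n t, D t -> N (s n t - f t) <= phi t].

(** Dominated convergence turns the pointwise approximation into convergence in mean. The integrals
    of the approximants are then Cauchy by [simple_integral_dist], and completeness supplies the
    value. *)
Lemma bochner_exists (X_complete : seq_complete X N) f :
  dominated_approximable f -> exists x, bochner_integral X N D f x.
Proof.
move=> [Xf [s [phi [ss sf iphi sphi]]]].
have mf : strongly_measurable X N D f by split => //; exists s.
have ms n := strongly_measurable_simple D (ss n).
have Xs n t : X (s n t) by exact: simple_into_X.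
have mfs n : measurable_fun D (fun t => (N (f t - s n t))%:E).
  by apply/measurable_EFinP; exact: measurable_snB.
have cvgI : (\int[mu]_(t in D) (N (f t - s n t))%:E)%E @[n --> \oo] --> (0%:E : \bar R).
  have [] := @dominated_convergence _ _ _ mu D mD (fun n t => (N (f t - s n t))%:E)
    (cst 0%E) (EFin \o phi) mfs.
  - exact: measurable_cst.
  - apply: aeW => t Dt; apply: cvg_EFin; first by apply: nearW.
    rewrite (_ : _ \o _ = (fun n => N (s n t - f t))); first exact: sf.
    by apply/funext => n /=; rewrite (sn_distC sn (Xs n t) (Xf _ Dt)).
  - exact: iphi.
  - apply: aeW => t n Dt; rewrite abse_EFin lee_fin ger0_norm.
      by rewrite (sn_distC sn (Xf _ Dt) (Xs n t)); exact: sphi.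
    by apply: (sn_ge0 sn); apply: (snXB sn); [exact: Xf|exact: Xs].
  by move=> _ _; rewrite integral0.
have dist m n : ((N (simple_integral D (s m) - simple_integral D (s n)))%:E <=
   \int[mu]_(t in D) (N (f t - s m t))%:E + \int[mu]_(t in D) (N (f t - s n t))%:E)%E.
  apply: le_trans (simple_integral_dist (ss m) (ss n)) _.
  have Nge0 k t : D t -> (0 <= (N (f t - s k t))%:E)%E.
    by move=> Dt; rewrite lee_fin; apply: (sn_ge0 sn); apply: (snXB sn); [exact: Xf|exact: Xs].
  rewrite -ge0_integralD//; try (by move=> t; exact: Nge0); try exact: mfs.
  apply: ge0_le_integral => //.
  - by move=> t Dt; rewrite lee_fin; apply: (sn_ge0 sn); exact: (snXB sn).
  - by apply/measurable_EFinP; exact: measurable_snB.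
  - by apply: emeasurable_funD; exact: mfs.
  move=> t Dt; rewrite -EFinD lee_fin (sn_distC sn (Xf _ Dt) (Xs m t)).
  by apply: (sn_tri sn) => //; exact: Xf.
have [|e e0|x Xx sx] := X_complete (fun n => simple_integral D (s n)).
- by move=> n; exact: simple_integral_X.
- have e2 : 0 < e / 2 by lra.
  move/fine_cvgP : cvgI => [fin /cvgrPdist_lt/(_ _ e2) cvgI].
  have [n0 _ Hn] := filterI fin cvgI.
  exists n0 => m n n0m n0n.
  have [f1 d1] := Hn m n0m; have [f2 d2] := Hn n n0n.
  have := dist m n; rewrite -(fineK f1) -(fineK f2) -EFinD lee_fin => K.
  move: d1 d2 K; rewrite !sub0r !normrN !ltr_norml.
  rewrite /comp; set a := fine _; set b := fine _.
  by clearbody a b; clear cvgI fin Hn f1 f2 dist; lra.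
exists x; split => //; exists s; split => // n; exact: simple_intoI.
Qed.

End FiniteMeasure.
End Bochner.

(** * Approximation of real measurable functions *)

Section RealApprox.
Context {R : realType}.
Notation mu := (@lebesgue_measure R).
Import HBNNSimple.

(** The approximation is from below and nonnegative; applied to the identity of [[0, T]], it yields
    sample points that do not leave the segment. *)
Lemma fin_valued_approx_ge0 (D : set R) (f : R -> R) : measurable D ->
  measurable_fun D f -> (forall t, D t -> 0 <= f t) ->
  exists p : nat -> R -> R, [/\ forall n, fin_valued (p n),
    forall n t, 0 <= p n t,
    forall n t, D t -> p n t <= f t &
    forall t, D t -> p n t @[n --> \oo] --> f t].
Proof.
move=> mD mf f0.
have mf' : measurable_fun D (EFin \o f) by exact/measurable_EFinP.
pose g := nnsfun_approx mD mf'.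
have gf t : D t -> g n t @[n --> \oo] --> f t.
  move=> Dt.
  have /fine_cvgP[_] : (EFin \o g^~ t) n @[n --> \oo] --> (EFin \o f) t.
    by apply: (cvg_nnsfun_approx mD mf') => // x Dx; rewrite lee_fin f0.
  by [].
exists (fun n => g n); split => //.
- move=> n t Dt.
  have nd : nondecreasing_seq (fun n => g n t).
    by move=> m m' mm'; have /lefP := nd_nnsfun_approx mD mf' mm'; exact.
  have := nondecreasing_cvgn_le nd (cvgP _ (gf t Dt)) n.
  by rewrite (cvg_lim _ (gf t Dt)).
Qed.

(** Positive and negative parts are approximated separately from below. At each point one of the two
    approximants is zero, whence the bound by [|f t|]. *)
Lemma fin_valued_approx (D : set R) (f : R -> R) : measurable D ->
  measurable_fun D f ->
  exists p : nat -> R -> R, [/\ forall n, fin_valued (p n),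
    forall n t, D t -> `|p n t| <= `|f t| &
    forall t, D t -> p n t @[n --> \oo] --> f t].
Proof.
move=> mD mf.
have mp : measurable_fun D (fun t => Num.max (f t) 0).
  by apply: measurable_maxr => //; exact: measurable_cst.
have mn : measurable_fun D (fun t => Num.max (- f t) 0).
  by apply: measurable_maxr; [exact: measurableT_comp|exact: measurable_cst].
have [|p [fp p0 pf cp]] := fin_valued_approx_ge0 mD mp.
  by move=> t _; rewrite le_max lexx orbT.
have [|q [fq q0 qf cq]] := fin_valued_approx_ge0 mD mn.
  by move=> t _; rewrite le_max lexx orbT.
exists (fun n t => p n t - q n t); split.
- move=> n; have := fin_valued_comp (fun u => u.1 - u.2) (fin_valued_pair (fp n) (fq n)); exact.
- move=> n t Dt; have := pf n t Dt; have := qf n t Dt.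
  have := p0 n t; have := q0 n t.
  have [ft|ft] := lerP 0 (f t).
    rewrite max_r ?oppr_le0// => *.
    by rewrite (ger0_norm ft) ler_norml; lra.
  rewrite max_l => [*|]; last by rewrite oppr_ge0 ltW.
  by rewrite (ltr0_norm ft) ler_norml; lra.
- move=> t Dt.
  suff <- : Num.max (f t) 0 - Num.max (- f t) 0 = f t by apply: cvgB; [exact: cp|exact: cq].
  have [ft|ft] := lerP 0 (f t).
    by rewrite max_r ?oppr_le0// subr0.
  by rewrite max_l ?oppr_ge0 ?ltW// sub0r opprK.
Qed.

End RealApprox.

Lemma lebesgue_measure_segment_lty {R : realType} (a b : R) :
  (@lebesgue_measure R `[a, b]%classic < +oo)%E.
Proof. by rewrite lebesgue_measure_itv/=; case: ifP => _; rewrite ?ltry// -EFinB ltry. Qed.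

Lemma integrable_segment_cst {R : realType} (a b c : R) :
  (@lebesgue_measure R).-integrable `[a, b] (EFin \o cst c).
Proof.
apply: measurable_bounded_integrable.
- exact: measurable_itv.
- exact: lebesgue_measure_segment_lty.
- exact: measurable_cst.
- by exists `|c|; split; rewrite ?num_real// => M cM x _; exact: ltW.
Qed.

(** * Continuous paths and the integrability of Duhamel integrands *)

Section Integrand.
Context {R : realType} {V : lmodType R} (X : set V) (N : V -> R).
Hypothesis sn : seminormed X N.
Notation mu := (@lebesgue_measure R).

Lemma continuous_intoP (D : set R) (f : R -> V) :
  continuous_into X N D f <-> (forall t, D t -> X (f t)) /\
    forall t, D t -> forall e, 0 < e -> \forall s \near t, D s -> N (f s - f t) < e.
Proof.
split=> -[Xf cf]; split=> // t Dt.
  move=> e e0; have /cvgrPdist_lt/(_ e e0) := cf t Dt.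
  rewrite near_withinE; apply: filterS => s + Ds => /(_ Ds).
  by rewrite sub0r normrN; apply: le_lt_trans; exact: ler_norm.
apply/cvgrPdist_lt => e e0; rewrite near_withinE.
apply: filterS (cf t Dt e e0) => s + Ds => /(_ Ds).
rewrite sub0r normrN ger0_norm//; apply: (sn_ge0 sn).
by apply: (snXB sn); exact: Xf.
Qed.

Lemma continuous_into_norm (D : set R) f : continuous_into X N D f ->
  {within D, continuous (N \o f)}.
Proof.
move=> [Xf cf]; apply/subspace_continuousP => t Dt.
apply: cvg_of_dist (cf t Dt); rewrite near_withinE; apply: nearW => s Ds.
by apply: (sn_dist_dist sn); exact: Xf.
Qed.

Lemma continuous_into_subset (D E : set R) f : D `<=` E ->
  continuous_into X N E f -> continuous_into X N D f.
Proof.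
move=> DE /continuous_intoP[Xf cf]; apply/continuous_intoP.
split => [t Dt|t Dt e e0]; first exact/Xf/DE.
by apply: filterS (cf t (DE _ Dt) e e0) => s + Ds; apply; exact: DE.
Qed.

Lemma continuous_into_bounded (a b : R) f : continuous_into X N `[a, b] f ->
  exists2 C, 0 <= C & forall s, `[a, b]%classic s -> N (f s) <= C.
Proof.
move=> cf; have [ab|ba] := leP a b; last first.
  by exists 0 => // s /=; rewrite in_itv/= => /andP[? ?]; lra.
have [c cab cmax] := EVT_max ab (continuous_into_norm cf).
exists (N (f c)); last by move=> s; exact: cmax.
by apply: (sn_ge0 sn); apply: cf.1.
Qed.

(** The approximants are [p n t *: b (q' n t) + d (q' n t)], where [p n] approximates [k] and [q' n]
    the identity. The relation between [f] and [k s *: b s + d s] is only up to null vectors because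
    the intended [f] contains [S (t - s)], which is linear only in that sense. *)
Lemma integrand_approximable (T : R) (k : R -> R) (b d f : R -> V) : 0 <= T ->
  continuous_into X N `[0, T] b -> continuous_into X N `[0, T] d ->
  mu.-integrable `[0, T] (EFin \o k) ->
  (forall s, `[0, T]%classic s -> X (f s)) ->
  (forall s, `[0, T]%classic s -> N (f s - (k s *: b s + d s)) = 0) ->
  dominated_approximable X N `[0, T] f.
Proof.
move=> T0 cb cd ik Xf fbd; split => //.
have mD : measurable `[0, T]%classic by exact: measurable_itv.
have [Cb Cb0 bC] := continuous_into_bounded cb.
have [Cd Cd0 dC] := continuous_into_bounded cd.
have mk : measurable_fun `[0, T] k.
  by apply/measurable_EFinP; exact: measurable_int ik.
have [p [fp pk cp]] := fin_valued_approx mD mk.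
have mid : measurable_fun `[0, T] (@id R) by exact: measurable_id.
have [|q [fq q0 qid cq]] := fin_valued_approx_ge0 mD mid.
  by move=> t /=; rewrite in_itv/= => /andP[].
(* [q n] is controlled on [[0, T]] only, whereas a simple function must have values in [X] at every
   real point; truncation keeps the arguments of [b] and [d] in [[0, T]] everywhere. *)
pose q' n s := Num.min (q n s) T.
have q'D n s : `[0, T]%classic (q' n s).
  by rewrite /= in_itv/= le_min q0 T0 ge_min lexx orbT.
have q'E n s : `[0, T]%classic s -> q' n s = q n s.
  move=> Ds; rewrite /q' min_l// (le_trans (qid n s Ds))//.
  by move: Ds; rewrite /= in_itv/= => /andP[].
have fq' n : fin_valued (q' n).
  by have := fin_valued_comp (fun x => Num.min x T) (fq n); exact.
pose s_ n t := p n t *: b (q' n t) + d (q' n t).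
have Xb t : `[0, T]%classic t -> X (b t) by exact: cb.1.
have Xd t : `[0, T]%classic t -> X (d t) by exact: cd.1.
have Xs n t : X (s_ n t) by apply: (sn_lin sn); [exact: Xb|exact: Xd].
have dist n t : `[0, T]%classic t -> N (s_ n t - f t) <= N (s_ n t - (k t *: b t + d t)).
  move=> Dt; have H : X (k t *: b t + d t) by apply: (sn_lin sn); [exact: Xb|exact: Xd].
  apply: le_trans (sn_tri sn (Xs n t) H (Xf _ Dt)) _.
  by rewrite (sn_distC sn H (Xf _ Dt)) fbd// addr0.
(* Since [|p n| <= |k|], the approximant and the limit are each bounded by [Cb * |k t| + Cd]. *)
exists s_, (fun t => (2 * Cb) * `|k t| + (2 * Cd)); split => //.
- move=> n; apply: fin_valued_simple_into => //.
  have := fin_valued_comp (fun u => u.1 *: b u.2 + d u.2) (fin_valued_pair (fp n) (fq' n)); exact.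
- move=> t Dt.
  have cq' : q' n t @[n --> \oo] --> within `[0, T] (nbhs t).
    have cqt : q' n t @[n --> \oo] --> t.
      by under eq_cvg do rewrite q'E//; exact: cq.
    move=> Y hY; suff H : \forall n \near \oo, Y (q' n t) by exact: H.
    near=> n; have : `[0, T]%classic (q' n t) -> Y (q' n t) by near: n; exact: cqt hY.
    by apply; exact: q'D.
  apply: (@cvg_of_dist _ _ _ _ _ (fun n => `|p n t - k t| * Cb
     + (`|k t| * N (b (q' n t) - b t) + N (d (q' n t) - d t)))); last first.
    rewrite -(addr0 (0 : R)); apply: cvgD.
      rewrite -(mul0r Cb); apply: cvgMl; rewrite -(@normr0 _ R) -(subrr (k t)).
      by apply: cvg_norm; apply: cvgB; [exact: cp|exact: cvg_cst].
    rewrite -(addr0 (0 : R)); apply: cvgD.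
      rewrite -(mulr0 `|k t|); apply: cvgMr.
      exact: (cvg_comp _ _ cq' (cb.2 t Dt)).
    exact: (cvg_comp _ _ cq' (cd.2 t Dt)).
  apply: nearW => n; rewrite subr0 ger0_norm; last first.
    by apply: (sn_ge0 sn); apply: (snXB sn) => //; exact: Xf.
  apply: le_trans (dist n t Dt) _.
  have -> : s_ n t - (k t *: b t + d t) = (p n t - k t) *: b (q' n t)
      + (k t *: (b (q' n t) - b t) + (d (q' n t) - d t)).
    rewrite scalerBl scalerBr /s_ opprD -!addrA; congr (_ + _).
    rewrite [RHS]addrA [in RHS]addrA addNr add0r.
    by rewrite addrCA.
  have X1 : X (b (q' n t)) by exact: Xb.
  have X2 : X (b (q' n t) - b t) by apply: (snXB sn) => //; exact: Xb.
  have X3 : X (d (q' n t) - d t) by apply: (snXB sn); exact: Xd.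
  apply: le_trans (snD sn (snXZ sn _ X1) (snXD sn (snXZ sn _ X2) X3)) _.
  apply: lerD; first by rewrite (snZ sn)// ler_wpM2l// bC.
  by apply: le_trans (snD sn (snXZ sn _ X2) X3) _; rewrite (snZ sn).
- rewrite (_ : EFin \o _ = (fun t => (2 * Cb)%:E * (`|k t|)%:E + (cst (2 * Cd) t)%:E)%E)//.
  apply: integrableD => //.
    by apply: integrableZl => //; exact: integrable_norm.
  exact: integrable_segment_cst.
move=> n t Dt; apply: le_trans (dist n t Dt) _.
have X1 : X (b (q' n t)) by exact: Xb.
have X1' : X (d (q' n t)) by exact: Xd.
apply: le_trans (snB sn (Xs n t) (sn_lin sn (k t) (Xb _ Dt) (Xd _ Dt))) _.
have h1 := snD sn (snXZ sn (p n t) X1) X1'.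
have h2 := snD sn (snXZ sn (k t) (Xb _ Dt)) (Xd _ Dt).
rewrite !(snZ sn)// in h1 h2; try exact: Xb.
have := bC _ (q'D n t); have := dC _ (q'D n t); have := bC _ Dt; have := dC _ Dt.
have g1 := ler_wpM2l (normr_ge0 (p n t)) (bC _ (q'D n t)).
have g2 := ler_wpM2l (normr_ge0 (k t)) (bC _ Dt).
have g3 := ler_wpM2r Cb0 (pk n t Dt).
by rewrite /s_; lra.
Unshelve. all: by end_near. Qed.

Lemma bochner_eq0 (D : set R) f x y : X y -> N (x - y) = 0 ->
  bochner_integral X N D f x -> bochner_integral X N D f y.
Proof.
move=> Xy xy [mf Xx [s [ss sf sx]]]; split => //; exists s; split => //.
suff : (fun n => N (simple_integral D (s n) - y)) = (fun n => N (simple_integral D (s n) - x)).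
  by move=> ->.
have Xs n : X (simple_integral D (s n)).
  rewrite /simple_integral fsbig_finite//=; last by case: (ss n).1.
  rewrite big_seq; apply: (sn_sum sn _ _).1 => v.
  rewrite in_fset_set; last by case: (ss n).1.
  rewrite inE => -[t _ <-]; apply: (snXZ sn); exact: simple_into_X (ss n).1.
apply/funext => n; apply/eqP; rewrite eq_le; apply/andP; split.
  by have := sn_tri sn (Xs n) Xx Xy; rewrite xy addr0.
by have := sn_tri sn (Xs n) Xy Xx; rewrite (sn_distC sn Xy Xx) xy addr0.
Qed.

(** [bochner_dist] compares integrals over one domain; extension by zero allows it to compare the
    integrals over [[0, t]] and [[0, t']]. *)
Lemma bochner_extend (D E : set R) f x : measurable D -> measurable E ->
  (mu E < +oo)%E -> D `<=` E ->
  bochner_integral X N D f x ->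
  bochner_integral X N E (fun t => if t \in D then f t else 0) x.
Proof.
move=> mD mE fE DE [[Xf [r [rs rf]]] Xx [s [ss sf sx]]].
have fD : (mu D < +oo)%E by apply: le_lt_trans fE; apply: le_measure; rewrite ?inE.
have find : fin_valued (fun t : R => t \in D).
  split; first exact: (sub_finite_set (@subsetT _ _)).
  case; first by rewrite (_ : _ @^-1` _ = D)//; apply/seteqP; split => t /=; [move=> /set_mem|move=> /mem_set].
  rewrite (_ : _ @^-1` _ = ~` D); first exact: measurableC.
  apply/seteqP; split => t /=; first by move=> /negbT; rewrite notin_setE.
  by move=> h; apply/negbTE; rewrite notin_setE.
pose cut (u : R -> V) t := if t \in D then u t else 0.
have cut_simple u : simple_into X u -> simple_into X (cut u).
  move=> su; apply: fin_valued_simple_into => [|t].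
    have := fin_valued_comp (fun p => if p.2 then p.1 else 0)
      (fin_valued_pair (simple_into_fin_valued su) find); exact.
  by rewrite /cut; case: ifP => _; [exact: simple_into_X su|exact: sn0 sn].
have Xcut t : E t -> X (cut f t).
  by move=> Et; rewrite /cut; case: ifPn => [|_]; [rewrite inE; exact: Xf|exact: sn0 sn].
split => //.
  split => //; exists (fun n => cut (r n)); split => [n|t Et]; first exact: cut_simple.
  have [Dt|Dt] := boolP (t \in D).
    by rewrite /cut Dt; apply: rf; rewrite inE in Dt.
  rewrite /cut (negbTE Dt) subrr (sn_norm0 sn); exact: cvg_cst.
exists (fun n => cut (s n)); split.
- move=> n; apply: (simple_intoI mE fE); apply: cut_simple; exact: (ss n).1.
- suff -> : (fun n => (\int[mu]_(t in E) (N (cut f t - cut (s n) t))%:E)%E) =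
      (fun n => (\int[mu]_(t in D) (N (f t - s n t))%:E)%E) by [].
  apply/funext => n; rewrite -[in RHS](setIidr DE) integral_mkcondr.
  apply: eq_integral => t _; rewrite /patch /cut; case: ifP => // _.
  by rewrite subrr (sn_norm0 sn).
- suff E' n : simple_integral E (cut (s n)) = simple_integral D (s n).
    by under eq_fun do rewrite E'.
  have fp := fin_valued_pair (simple_into_fin_valued (ss n).1) find.
  have -> : cut (s n) = (fun p => if p.2 then p.1 else 0) \o (fun t => (s n t, t \in D)) by [].
  have -> : s n = fst \o (fun t => (s n t, t \in D)) by [].
  rewrite !simple_integral_comp//; apply: eq_fsbigr => -[v [|]] _ /=.
    congr (fine (mu _) *: _); apply/seteqP; split => t /= [Dt [<- h]].
      by rewrite h; split => //; exact: set_mem.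
    by rewrite h; split => //; exact: DE.
  rewrite (_ : D `&` _ = set0) ?measure0 ?scale0r ?scaler0//.
  by apply/seteqP; split => t //= -[Dt [_ /negbT]]; rewrite notin_setE.
Qed.

End Integrand.

(** * Gronwall weights *)

Lemma lebesgue_measure_itvoc_lt {R : realType} (s t d : R) : 0 < d -> t - s < d ->
  (@lebesgue_measure R `]s, t]%classic < d%:E)%E.
Proof.
move=> d0 tsd; rewrite lebesgue_measure_itv/=.
by case: ifP => _; rewrite -?EFinB lte_fin.
Qed.

(** A one-step substitute for the differential of [expR]: evaluating at the right end of a step of
    size at most [e] overestimates the increment by a factor of at most [expR e]. *)
Lemma expR_increment {R : realType} (p q e : R) : p <= q -> q - p <= e ->
  expR q * (q - p) <= expR e * (expR q - expR p).
Proof.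
move=> pq qpe; have h : expR q = expR (q - p) * expR p by rewrite -expRD subrK.
have qp0 : 0 <= q - p by rewrite subr_ge0.
have step : expR p * (q - p) <= expR q - expR p.
  have -> : expR q - expR p = expR p * (expR (q - p) - 1).
    by rewrite mulrBr mulr1 mulrC -h.
  by rewrite ler_wpM2l ?expR_ge0// lerBrDl expR_ge1Dx.
apply: (@le_trans _ _ (expR e * expR p * (q - p))).
  by rewrite ler_wpM2r// h ler_wpM2r ?expR_ge0// ler_expR.
by rewrite -mulrA ler_wpM2l ?expR_ge0.
Qed.

Section ExponentialWeight.
Context {R : realType}.
Notation mu := (@lebesgue_measure R).
Variable a : R -> R.
Hypothesis a_ge0 : forall t, 0 <= t -> 0 <= a t.
Hypothesis a_int : forall T, mu.-integrable `[0, T] (EFin \o a).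

Definition primitive (t : R) : R := \int[mu]_(s in `[0, t]) a s.

Lemma primitive_le0 t : t <= 0 -> primitive t = 0.
Proof.
move=> t0; rewrite /primitive; have [->|tn0] := eqVneq t 0.
  by rewrite set_itv1 Rintegral_set1.
by rewrite set_itv_ge ?Rintegral_set0// bnd_simp -ltNge lt_neqAle tn0.
Qed.

Lemma primitiveB s t : 0 <= s -> s <= t ->
  primitive t - primitive s = \int[mu]_(x in `]s, t]) a x.
Proof. by move=> s0 st; rewrite /primitive Rintegral_itvB// ?bnd_simp. Qed.

Lemma primitive_le s t : s <= t -> primitive s <= primitive t.
Proof.
move=> st; have [s0|s0] := leP s 0.
  rewrite primitive_le0//; apply: Rintegral_ge0 => x /=.
  by rewrite in_itv/= => /andP[? _]; exact: a_ge0.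
rewrite -subr_ge0 primitiveB//; last exact: ltW.
apply: Rintegral_ge0 => x /=.
by rewrite in_itv/= => /andP[? _]; apply: a_ge0; lra.
Qed.

Lemma primitive_ge0 t : 0 <= primitive t.
Proof.
have [t0|t0] := leP t 0; first by rewrite primitive_le0.
by rewrite -(primitive_le0 (lexx 0)); apply: primitive_le; exact: ltW.
Qed.

Lemma primitive_continuous T : 0 <= T -> {within `[0, T], continuous primitive}.
Proof. by move=> T0; exact: parameterized_integral_continuous. Qed.

(** Absolute continuity of the integral of [a] over [[0, T]] gives one modulus for all [s] and [t].
    It serves as the mesh of a partition here and as the modulus of continuity of convolutions
    later. *)
Lemma primitive_uniform (T e : R) : 0 < e -> exists2 d : R, 0 < d &
  forall s t, 0 <= s -> s <= t -> t <= T -> t - s < d -> primitive t - primitive s < e.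
Proof.
move=> e0.
have ia : mu.-integrable setT (EFin \o (a \_ `[0, T])).
  rewrite -restrict_EFin; apply/integrable_restrict => //=.
  by rewrite setTI; exact: a_int.
have [d [d0 Hd]] := integral_normr_continuous ia e0.
exists d => // s t s0 st tT tsd.
rewrite primitiveB//; apply: le_lt_trans (Hd `]s, t]%classic _ _) => //.
- rewrite [leRHS](_ : _ = \int[mu]_(x in `]s, t]) a x)//.
  apply: eq_Rintegral => x; rewrite inE/= in_itv/= => /andP[sx xt].
  rewrite /patch mem_set/=; last by rewrite in_itv/=; apply/andP; split; lra.
  by rewrite ger0_norm// a_ge0//; lra.
- exact: lebesgue_measure_itvoc_lt.
Qed.

Lemma measurable_exp_primitive (T : R) : measurable_fun `[0, T] (fun s => expR (primitive s)).
Proof.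
have [T0|T0] := leP 0 T; last first.
  rewrite set_itv_ge; first exact: measurable_fun_set0.
  by rewrite bnd_simp -ltNge.
apply: (measurableT_comp (@measurable_expR R)).
by apply: subspace_continuous_measurable_fun => //; exact: primitive_continuous.
Qed.

Lemma integrable_exp_primitive (T : R) :
  mu.-integrable `[0, T] (EFin \o (fun s => a s * expR (primitive s))).
Proof.
have -> : EFin \o (fun s => a s * expR (primitive s)) =
  ((EFin \o a) \* (EFin \o (fun s => expR (primitive s))))%E by apply/funext.
apply: integrableMl => //; first exact: measurable_exp_primitive.
exists (expR (primitive T)); split; rewrite ?num_real// => M TM s /=.
rewrite in_itv/= => /andP[s0 sT]; rewrite ger0_norm; last exact: expR_ge0.
by apply: le_trans (ltW TM); rewrite ler_expR primitive_le.
Qed.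

(* Splitting [0, t] into pieces on which the primitive grows by at most e
   replaces the chain rule, which is not available for a merely integrable a. *)
Lemma integral_exp_primitive_approx (e T : R) : 0 < e -> forall t, 0 <= t <= T ->
  \int[mu]_(s in `[0, t]) (a s * expR (primitive s)) <=
  expR e * (expR (primitive t) - 1).
Proof.
move=> e0; have [d d0 Hd] := primitive_uniform T e0.
pose J t := \int[mu]_(s in `[0, t]) (a s * expR (primitive s)).
(* Induction on the number of steps of length [d / 2]; half of the modulus [d] leaves the strict
   inequality [t - s < d] that it requires. *)
suff main (n : nat) : forall t, 0 <= t <= T -> t <= (d / 2) *+ n ->
    J t <= expR e * (expR (primitive t) - 1).
  move=> t tT; apply: (main (Num.truncn (t / (d / 2))).+1) => //.
  have d2 : 0 < d / 2 by lra.
  rewrite -mulr_natr -ler_pdivrMl// mulrC; apply: ltW; exact: truncnS_gt.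
have J0 t : t <= 0 -> 0 <= t -> J t <= expR e * (expR (primitive t) - 1).
  move=> t0 t0'; have -> : t = 0 by lra.
  by rewrite /J set_itv1 Rintegral_set1 primitive_le0// expR0 subrr mulr0.
elim: n => [|n IH] t /andP[t0 tT] tn.
  by apply: J0 => //; rewrite mulr0n in tn.
have [td|td] := leP t (d / 2 *+ n); first by apply: IH => //; rewrite t0.
pose s := Num.max 0 (t - d / 2).
have s0 : 0 <= s by rewrite /s le_max lexx.
have sd : t - s <= d / 2.
  have : t - d / 2 <= s by rewrite /s le_max lexx orbT.
  by lra.
have st : s <= t by rewrite /s ge_max t0/=; lra.
have Js : J s <= expR e * (expR (primitive s) - 1).
  apply: IH; first by rewrite s0; lra.
  rewrite /s ge_max; apply/andP; split; first by apply: mulrn_wge0; lra.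
  by rewrite mulrSr in tn; lra.
have key : J t - J s <= expR (primitive t) * (primitive t - primitive s).
  have iJ := integrable_exp_primitive t.
  rewrite /J Rintegral_itvB// ?bnd_simp// primitiveB//.
  have isub : `]s, t]%classic `<=` `[0, t]%classic by apply: subset_itvr; rewrite bnd_simp.
  have ia : mu.-integrable `]s, t] (EFin \o a) by apply: integrableS (a_int t).
  rewrite -RintegralZl//; apply: le_Rintegral => //.
  - by apply: integrableS iJ.
  - rewrite (_ : EFin \o _ = (fun x => (expR (primitive t))%:E * (EFin \o a) x)%E)//.
    exact: integrableZl.
  - move=> x /=; rewrite in_itv/= => /andP[sx xt].
    rewrite mulrC; apply: ler_wpM2r; first exact: a_ge0 (le_trans s0 (ltW sx)).
    by rewrite ler_expR; exact: primitive_le.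
have st_e : primitive t - primitive s < e.
  by apply: Hd => //; apply: le_lt_trans sd _; rewrite ltr_pdivrMr// mulr_natr mulr2n ltrDl.
have inc := expR_increment (primitive_le st) (ltW st_e).
rewrite -(subrK (J s) (J t)); apply: le_trans (lerD (le_trans key inc) Js) _.
by rewrite -mulrDr addrA subrK lexx.
Qed.

Lemma integral_exp_primitive t : 0 <= t ->
  \int[mu]_(s in `[0, t]) (a s * expR (primitive s)) <= expR (primitive t) - 1.
Proof.
move=> t0; set C := expR _ - 1.
have C0 : 0 <= C.
  by rewrite subr_ge0 -expR0 ler_expR primitive_ge0.
apply/ler_addgt0Pr => h h0.
(* The step size [ln (1 + h / (C + 1))] makes the factor [expR e] equal to [1 + h / (C + 1)], so the
   excess over [C] is [C * h / (C + 1) <= h]. The added 1 covers [C = 0]. *)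
have h1 : 0 < h / (C + 1) by apply: divr_gt0 => //; lra.
have e0 : 0 < ln (1 + h / (C + 1)) by apply: ln_gt0; lra.
have := integral_exp_primitive_approx e0 (T := t) (t := t).
rewrite t0 lexx lnK ?posrE; last by lra.
move=> /(_ isT) H; apply: le_trans H _; rewrite mulrDl mul1r lerD2l -/C.
by rewrite mulrAC ler_pdivrMr; [nra|lra].
Qed.

End ExponentialWeight.

(** * Semigroup convolutions *)

Lemma mulr_lt_half {R : realFieldType} (m x e : R) : 0 < m -> x < e / (2 * m) ->
  m * x < e / 2.
Proof. by move=> m0; rewrite !ltr_pdivlMr ?mulr_gt0//; lra. Qed.

Lemma mulr_budget_lt_half {R : realFieldType} (x e : R) : 0 <= x -> 0 < e ->
  x * (e / (2 * (x + 1))) < e / 2.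
Proof.
move=> x0 e0; rewrite mulrA ltr_pdivrMr; last by lra.
by rewrite mulrA divfK ?pnatr_eq0//; lra.
Qed.

Section BoundedSemigroup.
Context {R : realType} {V : lmodType R} (X : set V) (N : V -> R).
Hypothesis sn : seminormed X N.
Hypothesis X_complete : seq_complete X N.
Notation mu := (@lebesgue_measure R).
Variable S : R -> V -> V.
Hypothesis S_C0 : C0_semigroup X N S.
Variables (M omega : R).
Hypotheses (M_gt0 : 0 < M) (omega_gt0 : 0 < omega).
Hypothesis S_decay : forall t x, 0 <= t -> X x -> N (S t x) <= M * expR (- omega * t) * N x.

Lemma SX t x : 0 <= t -> X x -> X (S t x).
Proof. exact: (C0_stable S_C0). Qed.

Lemma S_bounded t x : 0 <= t -> X x -> N (S t x) <= M * N x.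
Proof.
move=> t0 Xx; apply: le_trans (S_decay t0 Xx) _.
apply: ler_wpM2r; first exact: (sn_ge0 sn).
rewrite -[leRHS]mulr1 ler_wpM2l//; first exact: ltW.
by rewrite -expR0 ler_expR mulNr oppr_le0 mulr_ge0// ltW.
Qed.

Lemma SB t x y : 0 <= t -> X x -> X y -> N (S t x - S t y) = N (S t (x - y)).
Proof.
move=> t0 Xx Xy.
have Xxy := snXB sn Xx Xy.
have h := C0_linear S_C0 (-1) t0 Xy Xx.
rewrite !scaleN1r !(addrC (- _)) in h.
have [X1 X2] : X (S t (x - y)) /\ X (S t x - S t y).
  by split; [exact: SX|apply: (snXB sn); exact: SX].
apply/eqP; rewrite eq_le; apply/andP; split.
  have := sn_le_add sn X2 X1; rewrite (sn_distC sn X2 X1) h; first by rewrite addr0.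
by have := sn_le_add sn X1 X2; rewrite h addr0.
Qed.

Lemma S_lipschitz t x y : 0 <= t -> X x -> X y -> N (S t x - S t y) <= M * N (x - y).
Proof. by move=> t0 Xx Xy; rewrite SB//; apply: S_bounded => //; exact: (snXB sn). Qed.

Lemma S_orbit x e : X x -> 0 < e -> exists2 d : R, 0 < d &
  forall h, 0 <= h -> h < d -> N (S h x - x) < e.
Proof.
move=> Xx e0; have /cvgrPdist_lt/(_ e e0) := C0_continuous S_C0 Xx.
rewrite near_withinE => -[d /= d0 H]; exists d => // h h0 hd.
have [->|hn0] := eqVneq h 0; first by rewrite (C0_zero S_C0).
have hp : 0 < h by rewrite lt_neqAle eq_sym hn0.
have := H h; rewrite /ball_/= !sub0r !normrN (ger0_norm h0) => /(_ hd hp).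
by apply: le_lt_trans; exact: ler_norm.
Qed.

(** Factoring out the smaller time, [S t = S s] after [S (t - s)], reduces continuity at any time,
    from the left as well as from the right, to right continuity at 0. *)
Lemma S_orbit_dist s t x : 0 <= s -> s <= t -> X x ->
  N (S t x - S s x) <= M * N (S (t - s) x - x).
Proof.
move=> s0 st Xx; have ts0 : 0 <= t - s by rewrite subr_ge0.
have := C0_add S_C0 s0 ts0 Xx; rewrite subrKC => h.
have Xt : X (S t x) by apply: SX => //; exact: le_trans st.
have Xts := SX ts0 Xx.
apply: le_trans (sn_tri sn (y := S s (S (t - s) x)) Xt (SX s0 Xts) (SX s0 Xx)) _.
by rewrite h add0r; exact: S_lipschitz.
Qed.

(** Strong continuity becomes uniform along a continuous path over a compact segment: near [s],
    replacing [b s'] by [b s] costs at most [(M + 1) * N (b s' - b s)] for every [h], and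
    compactness collects the neighbourhoods. *)
Lemma S_equicontinuous (T : R) b e : continuous_into X N `[0, T] b -> 0 < e ->
  exists2 d : R, 0 < d & forall h s, 0 <= h -> h < d -> `[0, T]%classic s ->
    N (S h (b s) - b s) < e.
Proof.
move=> /(continuous_intoP sn)[Xb cb] e0.
have K : near_covering_within `[0, T]%classic.
  by apply/near_covering_withinP/compact_near_coveringP; exact: segment_compact.
have [|] := K R (0^'+) (fun h s => N (S h (b s) - b s) < e) _; last first.
  move=> d /= d0 H; exists d => // h s h0 hd Ts.
  have [->|hn0] := eqVneq h 0; first by rewrite (C0_zero S_C0) //; exact: Xb.
  have hp : 0 < h by rewrite lt_neqAle eq_sym hn0.
  have := H h; rewrite /ball_/= sub0r normrN (ger0_norm h0) => /(_ hd hp); exact.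
move=> s Ts; have e3 : 0 < e / (M + 1) / 2.
  by rewrite !divr_gt0// ltr_wpDl// ltW.
have [d d0 Hd] := S_orbit (Xb s Ts) (divr_gt0 e0 (ltr0n R 2)).
near=> s' h.
have bs0 : `[0, T]%classic s' -> N (b s' - b s) < e / (M + 1) / 2 by near: s'; apply: cb.
move=> /= Ts'; have hp : 0 < h by near: h; exact: nbhs_right_gt.
have h0 := ltW hp.
have hd : h < d by near: h; exact: nbhs_right_lt.
have bs := bs0 Ts'.
have Xs := Xb _ Ts; have Xs' := Xb _ Ts'.
apply: le_lt_trans (sn_tri sn (y := S h (b s)) (SX h0 Xs') (SX h0 Xs) Xs') _.
apply: le_lt_trans (lerD (S_lipschitz h0 Xs' Xs) (sn_tri sn (y := b s) (SX h0 Xs) Xs Xs')) _.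
have := Hd h h0 hd; rewrite (sn_distC sn Xs Xs').
have : (M + 1) * N (b s' - b s) < e / 2.
  by rewrite -ltr_pdivlMl 1?mulrC ?ltr_wpDl// 1?ltW// mulrAC.
by rewrite mulrDl mul1r; lra.
Unshelve. all: by end_near. Qed.

(** The vector and the operator both move. The change of the vector is absorbed by the uniform bound
    [M]; for the operator, the order of [s] and [s'] decides which time can be factored out. *)
Lemma S_path_continuous (T : R) b : continuous_into X N `[0, T] b ->
  continuous_into X N `[0, T] (fun s => S (T - s) (b s)).
Proof.
move=> /(continuous_intoP sn)[Xb cb]; apply/(continuous_intoP sn).
have T_s s : `[0, T]%classic s -> 0 <= T - s.
  by rewrite /= in_itv/= subr_ge0 => /andP[].
split => [s Ts|s Ts e e0]; first by apply: SX; [exact: T_s|exact: Xb].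
have Xs := Xb _ Ts.
have e2 : 0 < e / (2 * M) by rewrite divr_gt0// mulr_gt0.
have [d d0 Hd] := S_orbit Xs e2.
near=> s' => Ts'.
have bs : N (b s' - b s) < e / (2 * M).
  by move: Ts'; near: s'; exact: cb.
have sd : `|s - s'| < d by near: s'; exact: cvgr_dist_lt.
have Xs' := Xb _ Ts'.
apply: le_lt_trans (sn_tri sn (y := S (T - s') (b s)) (SX (T_s _ Ts') Xs') (SX (T_s _ Ts') Xs) (SX (T_s _ Ts) Xs)) _.
have h1 : N (S (T - s') (b s') - S (T - s') (b s)) < e / 2.
  apply: le_lt_trans (S_lipschitz (T_s _ Ts') Xs' Xs) _.
  exact: mulr_lt_half.
suff h2 : N (S (T - s') (b s) - S (T - s) (b s)) < e / 2 by lra.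
have conc h : 0 <= h -> h < d -> M * N (S h (b s) - b s) < e / 2.
  move=> h0 hd; have := Hd h h0 hd.
  exact: mulr_lt_half.
have [ss|ss] := leP s' s.
  apply: le_lt_trans (S_orbit_dist (T_s _ Ts) _ Xs) _; first by lra.
  have -> : T - s' - (T - s) = s - s' by ring.
  apply: conc; first by rewrite subr_ge0.
  exact: le_lt_trans (ler_norm _) sd.
rewrite (sn_distC sn (SX (T_s _ Ts') Xs) (SX (T_s _ Ts) Xs)).
apply: le_lt_trans (S_orbit_dist (T_s _ Ts') _ Xs) _; first by lra.
have -> : T - s - (T - s') = s' - s by ring.
apply: conc; first by rewrite subr_ge0 ltW.
by apply: le_lt_trans (ler_norm _) _; rewrite distrC.
Unshelve. all: by end_near. Qed.

Section Convolution.
Variables (k : R -> R) (b d : R -> V).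
Hypothesis k_int : forall T, mu.-integrable `[0, T] (EFin \o k).
Hypotheses (cb : continuous_into X N `[0, +oo[ b) (cd : continuous_into X N `[0, +oo[ d).

Let sub (T : R) : `[0, T]%classic `<=` `[0, +oo[%classic.
Proof. by apply: subset_itvl. Qed.

Let Xb s : 0 <= s -> X (b s).
Proof. by move=> s0; apply: cb.1; rewrite /= in_itv/= s0. Qed.

Let Xd s : 0 <= s -> X (d s).
Proof. by move=> s0; apply: cd.1; rewrite /= in_itv/= s0. Qed.

Let f s := k s *: b s + d s.

Let Xf s : 0 <= s -> X (f s).
Proof. by move=> s0; apply: (sn_lin sn); [exact: Xb|exact: Xd]. Qed.

Lemma convolution_exists t : 0 <= t ->
  exists x, bochner_integral X N `[0, t] (fun s => S (t - s) (k s *: b s + d s)) x.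
Proof.
move=> t0; apply: (bochner_exists sn) => //.
- exact: lebesgue_measure_segment_lty.
apply: (@integrand_approximable _ _ _ _ sn t k (fun s => S (t - s) (b s)) (fun s => S (t - s) (d s))) => //.
- by apply: S_path_continuous; exact: (continuous_into_subset sn (@sub t)).
- by apply: S_path_continuous; exact: (continuous_into_subset sn (@sub t)).
- move=> s /=; rewrite in_itv/= => /andP[s0 st]; apply: SX; first by rewrite subr_ge0.
  exact: Xf.
- move=> s /=; rewrite in_itv/= => /andP[s0 st].
  by rewrite (C0_linear S_C0)// ?subr_ge0//; [exact: Xb|exact: Xd].
Qed.

(** A common rate for both terms of the integrand: [|k s|] multiplies [b] and 1 multiplies [d]. *)
Let a s := `|k s| + 1.

Let a_ge0 t : 0 <= t -> 0 <= a t.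
Proof. by rewrite /a addr_ge0. Qed.

Let a_int T : mu.-integrable `[0, T] (EFin \o a).
Proof.
rewrite (_ : EFin \o _ = (fun s => (`|k s|)%:E + (cst 1 s)%:E)%E)//.
by apply: integrableD => //; [exact: integrable_norm|exact: integrable_segment_cst].
Qed.

Variable v : R -> V.
Hypothesis vE : forall t, 0 <= t ->
  bochner_integral X N `[0, t] (fun s => S (t - s) (k s *: b s + d s)) (v t).

(* On [0, t] one has S(t' - s) = S(t - s) S(t' - t), so the increment is
   controlled by the equicontinuity of S along b and d. *)
Lemma convolution_increment (T C e t t' : R) : 0 <= t -> t <= t' -> t' <= T -> 0 <= e ->
  (forall s, 0 <= s <= T -> N (b s) <= C /\ N (d s) <= C) ->
  (forall s, 0 <= s <= T -> N (S (t' - t) (b s) - b s) <= e /\ N (S (t' - t) (d s) - d s) <= e) ->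
  N (v t' - v t) <= M * e * primitive a T + M * C * (primitive a t' - primitive a t).
Proof.
move=> t0 tt' t'T e0 HC He.
have t'0 : 0 <= t' by exact: le_trans tt'.
have M0 := ltW M_gt0.
have C0 : 0 <= C.
  by apply: le_trans (HC 0 _).1; [apply: (sn_ge0 sn); exact: Xb|rewrite lexx/= (le_trans t'0)].
have sub' : `[0, t]%classic `<=` `[0, t']%classic by apply: subset_itvl; rewrite bnd_simp.
have ext := bochner_extend sn (measurable_itv _) (measurable_itv _)
  (lebesgue_measure_segment_lty 0 t') sub' (vE t0).
(* On [[0, t]] the two integrands differ by the small amount allowed by [e]. On the rest, where the
   extended integrand is zero, only the crude bound by [C] is available, but there the primitive of
   [a] grows little. *)
pose phi s := M * e * a s + (M * C) * (a \_ `]t, t']) s.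
have ia' : mu.-integrable `[0, t'] (EFin \o (a \_ `]t, t'])).
  rewrite -restrict_EFin; apply/integrable_restrict => //=.
  by apply: integrableS (a_int t') => //; exact: measurableI.
have iphi1 : mu.-integrable `[0, t'] (EFin \o (fun s => M * e * a s)).
  rewrite (_ : EFin \o _ = (fun x => (M * e)%:E * (EFin \o a) x)%E)//.
  exact: integrableZl.
have iphi2 : mu.-integrable `[0, t'] (EFin \o (fun s => M * C * (a \_ `]t, t']) s)).
  rewrite (_ : EFin \o _ = (fun x => (M * C)%:E * (EFin \o (a \_ `]t, t'])) x)%E)//.
  exact: integrableZl.
have iphi : mu.-integrable `[0, t'] (EFin \o phi).
  rewrite (_ : EFin \o phi = (fun s => (M * e * a s)%:E + (M * C * (a \_ `]t, t']) s)%:E)%E)//.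
  exact: integrableD.
have Nf s : 0 <= s <= T -> N (f s) <= C * a s.
  move=> sT; have s0 : 0 <= s by case/andP: sT.
  apply: le_trans (snD sn (snXZ sn (k s) (Xb s0)) (Xd s0)) _.
  rewrite (snZ sn) ?mulrDr ?mulr1; last exact: Xb.
  have [h1 h2] := HC s sT; apply: lerD => //.
  by rewrite mulrC; exact: ler_wpM2r.
apply: le_trans (bochner_dist sn (measurable_itv _) (lebesgue_measure_segment_lty 0 t') (vE t'0) ext iphi _) _.
- move=> s /=; rewrite in_itv/= => /andP[s0 st'].
  have sT : 0 <= s <= T by rewrite s0 (le_trans st').
  have as0 := a_ge0 s0; have st'0 : 0 <= t' - s by rewrite subr_ge0.
  rewrite /phi; case: ifPn => [|/negP]; rewrite inE/= in_itv/= s0/=.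
    move=> st; have st0 : 0 <= t - s by rewrite subr_ge0.
    rewrite /patch memNset/=; last by rewrite in_itv/= ltNge st.
    rewrite mulr0 addr0.
    have -> : t' - s = (t - s) + (t' - t) by ring.
    have tt0 : 0 <= t' - t by rewrite subr_ge0.
    have Xtf := SX tt0 (Xf s0).
    apply: le_trans (sn_tri sn (y := S (t - s) (S (t' - t) (f s))) (SX _ (Xf s0)) (SX st0 Xtf) (SX st0 (Xf s0))) _.
      by rewrite addr_ge0.
    rewrite (C0_add S_C0)// ?add0r; last exact: Xf.
    apply: le_trans (S_lipschitz st0 Xtf (Xf s0)) _.
    rewrite -mulrA ler_wpM2l//.
    have X1 := SX tt0 (Xb s0); have X2 := SX tt0 (Xd s0).
    have X3 := sn_lin sn (k s) X1 X2.
    apply: le_trans (sn_tri sn (y := k s *: S (t' - t) (b s) + S (t' - t) (d s)) Xtf X3 (Xf s0)) _.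
    rewrite (C0_linear S_C0)// ?add0r; [|exact: Xb|exact: Xd].
    rewrite /f opprD addrACA -scalerBr.
    apply: le_trans (snD sn (snXZ sn (k s) (snXB sn X1 (Xb s0))) (snXB sn X2 (Xd s0))) _.
    rewrite (snZ sn); last by apply: (snXB sn) => //; exact: Xb.
    have [h1 h2] := He s sT; rewrite /a mulrDr mulr1; apply: lerD => //.
    by rewrite mulrC ler_wpM2r.
  move=> st; rewrite subr0 /patch mem_set/=; last first.
    by rewrite in_itv/= st' andbT ltNge; apply/negP.
  apply: le_trans (S_bounded st'0 (Xf s0)) _.
  apply: le_trans (ler_wpM2l M0 (Nf s sT)) _.
  rewrite mulrA lerDr; apply: mulr_ge0 => //; exact: mulr_ge0.
rewrite /phi RintegralD//; apply: lerD.
  rewrite RintegralZl//; apply: ler_wpM2l; first exact: mulr_ge0.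
  exact: (primitive_le a_ge0 a_int).
rewrite RintegralZl// -Rintegral_mkcondr setIidr.
  by rewrite (primitiveB a_int)// lexx.
by apply: subset_itvr; rewrite bnd_simp.
Qed.

Lemma convolution_continuous : continuous_into X N `[0, +oo[ v.
Proof.
have Xv t : 0 <= t -> X (v t) by move=> /vE[].
apply/(continuous_intoP sn); split => [t /=|t0 /=].
  by rewrite in_itv/= andbT; exact: Xv.
rewrite in_itv/= andbT => t00 e e0.
pose T := t0 + 1.
have cbT := continuous_into_subset sn (@sub T) cb.
have cdT := continuous_into_subset sn (@sub T) cd.
have [C1 C10 bC] := continuous_into_bounded sn cbT.
have [C2 C20 dC] := continuous_into_bounded sn cdT.
pose C := C1 + C2.
have C0 : 0 <= C by rewrite addr_ge0.
pose P := primitive a T.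
have P0 : 0 <= P by exact: (primitive_ge0 a_ge0 a_int).
(* Each of the two terms of [convolution_increment] receives at most [e / 2]; the added 1 keeps the
   denominators positive when [P] or [C] is zero. *)
pose e1 := e / (2 * (M * P + 1)).
pose e2 := e / (2 * (M * C + 1)).
have MP : 0 < 2 * (M * P + 1) by rewrite mulr_gt0// ltr_wpDl// mulr_ge0// ltW.
have MC : 0 < 2 * (M * C + 1) by rewrite mulr_gt0// ltr_wpDl// mulr_ge0// ltW.
have e10 : 0 < e1 by exact: divr_gt0.
have e20 : 0 < e2 by exact: divr_gt0.
have [d1 d10 H1] := S_equicontinuous cbT e10.
have [d2 d20 H2] := S_equicontinuous cdT e10.
have [d3 d30 H3] := primitive_uniform a_ge0 a_int T e20.
have main t t' : 0 <= t -> t <= t' -> t' <= T -> t' - t < d1 -> t' - t < d2 ->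
    t' - t < d3 -> N (v t' - v t) < e.
  move=> tp tt' t'T h1 h2 h3.
  have tt0 : 0 <= t' - t by rewrite subr_ge0.
  apply: le_lt_trans (convolution_increment (C := C) (e := e1) tp tt' t'T (ltW e10) _ _) _.
  - move=> s sT; split.
      by apply: le_trans (bC s _) _; rewrite ?/C ?lerDl//= in_itv/=.
    by apply: le_trans (dC s _) _; rewrite ?/C ?lerDr//= in_itv/=.
  - by move=> s sT; split; apply: ltW; [apply: H1|apply: H2] => //=; rewrite in_itv/=.
  have q3 := H3 t t' tp tt' t'T h3.
  have k1 : M * e1 * P <= e / 2.
    by rewrite mulrAC; apply: ltW; apply: mulr_budget_lt_half => //; rewrite mulr_ge0// ltW.
  suff k2 : M * C * (primitive a t' - primitive a t) < e / 2.
    by rewrite [e]splitr; exact: ler_ltD.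
  apply: (@le_lt_trans _ _ (M * C * e2)).
    by apply: ler_wpM2l; [rewrite mulr_ge0// ltW|exact: ltW].
  by apply: mulr_budget_lt_half => //; rewrite mulr_ge0// ltW.
have near1 : \forall t \near t0, `|t0 - t| < Num.min (Num.min d1 d2) (Num.min d3 1).
  have m0 : 0 < Num.min (Num.min d1 d2) (Num.min d3 1) by rewrite !lt_min d10 d20 d30 ltr01.
  by near=> t; near: t; exact: cvgr_dist_lt.
apply: filterS near1 => t; rewrite !lt_min => /andP[/andP[m1 m2] /andP[m3 m4]].
rewrite /= in_itv/= andbT => tp.
have [tt|tt] := leP t t0.
  rewrite (sn_distC sn (Xv _ tp) (Xv _ t00)).
  have E : `|t0 - t| = t0 - t by rewrite ger0_norm// subr_ge0.
  by rewrite E in m1 m2 m3 m4; apply: main => //; rewrite /T; lra.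
have E : `|t0 - t| = t - t0 by rewrite distrC gtr0_norm// subr_gt0.
by rewrite E in m1 m2 m3 m4; apply: main => //; rewrite /T; lra.
Unshelve. all: by end_near. Qed.

End Convolution.
End BoundedSemigroup.

(** * Mild solutions *)

(** Carries estimates from the Picard iterates to their limit, whose distance to the iterates
    decreases geometrically. *)
Lemma le_of_le_geometric {R : realType} (x b c : R) :
  (forall n, x <= b + c * (2^-1) ^+ n) -> x <= b.
Proof.
move=> H.
have h : (fun n => b + c * (2^-1) ^+ n) @ \oo --> b + c * 0.
  apply: cvgD; first exact: cvg_cst.
  by apply: cvgMr; apply: cvg_expr; rewrite ger0_norm ?invr_ge0// invf_lt1 ?ltr1n.
rewrite mulr0 addr0 in h.
by apply: (cvgr_to_ge h); exact: nearW.
Qed.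

Section Bochner0.
Context {R : realType} {V : lmodType R} (X : set V) (N : V -> R).
Hypothesis sn : seminormed X N.
Notation mu := (@lebesgue_measure R).

Lemma bochner0 (D : set R) : measurable D -> (mu D < +oo)%E ->
  bochner_integral X N D (fun=> 0) 0.
Proof.
move=> mD fD; have s0 : simple_into X (fun=> 0).
  apply: fin_valued_simple_into => [|_]; last exact: sn0 sn.
  split; first exact: finite_image_cst.
  by move=> q; rewrite preimage_cst; case: ifP => _.
split; [exact: strongly_measurable_simple|exact: sn0 sn|].
exists (fun=> fun=> 0); split.
- by move=> _; exact: simple_intoI.
- rewrite subrr (sn_norm0 sn) integral0; exact: cvg_cst.
rewrite /simple_integral fsbig1 ?subrr ?(sn_norm0 sn); first exact: cvg_cst.
by move=> _ [t _ <-]; rewrite scaler0.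
Qed.

Lemma bochner_norm (D : set R) f x (phi : R -> R) : measurable D -> (mu D < +oo)%E ->
  bochner_integral X N D f x ->
  mu.-integrable D (EFin \o phi) -> (forall t, D t -> N (f t) <= phi t) ->
  N x <= \int[mu]_(t in D) phi t.
Proof.
move=> mD fD fx iphi H; rewrite -(subr0 x).
apply: (bochner_dist sn mD fD fx (bochner0 mD fD) iphi) => t Dt.
by rewrite subr0; exact: H.
Qed.

End Bochner0.

Section MildSolutions.
Context {R : realType} {V : lmodType R} (X : set V) (N : V -> R).
Hypothesis sn : seminormed X N.
Hypothesis X_complete : seq_complete X N.
Notation mu := (@lebesgue_measure R).
Variable S : R -> V -> V.
Hypothesis S_C0 : C0_semigroup X N S.
Variables (M omega : R).
Hypotheses (M_gt0 : 0 < M) (omega_gt0 : 0 < omega).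
Hypothesis S_decay : forall t x, 0 <= t -> X x -> N (S t x) <= M * expR (- omega * t) * N x.

Variables (taubar : R) (tau k : R -> R).
Hypothesis taubar_gt0 : 0 < taubar.
Hypothesis tau_continuous : {within `[0, +oo[, continuous tau}.
Hypothesis tau_bounds : forall t, 0 <= t -> 0 <= tau t <= taubar.
Hypothesis k_int : forall T, mu.-integrable `[0, T] (EFin \o k).

Variables (Bop Fop : V -> V) (bB : R).
Hypothesis bB_ge0 : 0 <= bB.
Hypothesis XB : forall x, X x -> X (Bop x).
Hypothesis B_norm : forall x, X x -> N (Bop x) <= bB * N x.
Hypothesis B_lip : forall x y, X x -> X y -> N (Bop x - Bop y) <= bB * N (x - y).
Hypothesis XF : forall x, X x -> X (Fop x).
Hypothesis F_lip : forall r, 0 < r -> exists2 L, 0 < L & forall x y, X x -> X y ->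
  N x <= r -> N y <= r -> N (Fop x - Fop y) <= L * N (x - y).

Variable ini : R -> V.
Hypothesis ini_continuous : continuous_into X N `[- taubar, 0] ini.

Let integrand (U : R -> V) (t s : R) :=
  S (t - s) (- k s *: Bop (U (s - tau s)) + Fop (U s)).

(* [W] is the image of [U] under the Picard map. *)
Definition duhamel (U W : R -> V) := forall t, 0 <= t ->
  bochner_integral X N `[0, t] (integrand U t) (W t - S t (ini 0)).

Let dom := `[- taubar, +oo[%classic.

Let Xini t : - taubar <= t <= 0 -> X (ini t).
Proof. by move=> ht; apply: ini_continuous.1; rewrite /= in_itv/=. Qed.

Let Xini0 : X (ini 0).
Proof. by apply: Xini; rewrite lexx andbT oppr_le0 ltW. Qed.

Let delay_dom s : 0 <= s -> - taubar <= s - tau s /\ s - tau s <= s.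
Proof. by move=> s0; have := tau_bounds s0; move=> /andP[? ?]; split; lra. Qed.

Lemma delayed_continuous U : continuous_into X N dom U ->
  continuous_into X N `[0, +oo[ (fun s => Bop (U (s - tau s))).
Proof.
move=> /(continuous_intoP sn)[XU cU]; apply/(continuous_intoP sn).
have domd s : `[0, +oo[%classic s -> dom (s - tau s).
  rewrite /dom /= !in_itv/= !andbT => s0; exact: (delay_dom s0).1.
split => [s Ds|s Ds e e0]; first by apply: XB; apply: XU; exact: domd.
have eb : 0 < e / (bB + 1) by rewrite divr_gt0// ltr_wpDl.
have ct : (fun s => s - tau s) @ within `[0, +oo[ (nbhs s) --> s - tau s.
  apply: cvgB; first by apply: cvg_within.
  by move/subspace_continuousP : tau_continuous; exact.
have {}ct : \forall s' \near s, `[0, +oo[%classic s' -> dom (s' - tau s') ->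
    N (U (s' - tau s') - U (s - tau s)) < e / (bB + 1) := ct _ (cU _ (domd _ Ds) _ eb).
apply: filterS ct => s' H Ds'.
have {}H := H Ds' (domd _ Ds').
have X1 := XU _ (domd _ Ds'); have X2 := XU _ (domd _ Ds).
apply: le_lt_trans (B_lip X1 X2) _.
apply: (@le_lt_trans _ _ ((bB + 1) * N (U (s' - tau s') - U (s - tau s)))).
  by rewrite ler_wpM2r ?lerDl//; apply: (sn_ge0 sn); exact: (snXB sn).
by rewrite mulrC -ltr_pdivlMr// ltr_wpDl.
Qed.

Lemma nonlinear_continuous U : continuous_into X N dom U ->
  continuous_into X N `[0, +oo[ (fun s => Fop (U s)).
Proof.
move=> /(continuous_intoP sn)[XU cU]; apply/(continuous_intoP sn).
have domd s : `[0, +oo[%classic s -> dom s.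
  by rewrite /dom /= !in_itv/= !andbT => s0; apply: le_trans s0; rewrite oppr_le0 ltW.
split => [s Ds|s Ds e e0]; first by apply: XF; apply: XU; exact: domd.
have X2 := XU _ (domd _ Ds).
have r0 : 0 < N (U s) + 1 by have := sn_ge0 sn X2; lra.
have [L L0 HL] := F_lip r0.
have eL : 0 < e / L by apply: divr_gt0.
near=> s' => Ds'.
have h1 : `[- taubar, +oo[%classic s' -> N (U s' - U s) < e / L.
  by near: s'; exact: cU (domd _ Ds) _ eL.
have h2 : `[- taubar, +oo[%classic s' -> N (U s' - U s) < 1.
  by near: s'; exact: cU (domd _ Ds) _ ltr01.
have {}h1 := h1 (domd _ Ds'); have {}h2 := h2 (domd _ Ds').
have X1 := XU _ (domd _ Ds').
have le1 : N (U s') <= N (U s) + 1.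
  by apply: le_trans (sn_le_add sn X1 X2) _; rewrite lerD2l ltW.
have le2 : N (U s) <= N (U s) + 1 by rewrite lerDl.
apply: le_lt_trans (HL _ _ X1 X2 le1 le2) _.
by rewrite mulrC -ltr_pdivlMr.
Unshelve. all: by end_near. Qed.

Lemma S_orbit_continuous x : X x -> continuous_into X N `[0, +oo[ (fun t => S t x).
Proof.
move=> Xx; apply/(continuous_intoP sn); split => [t|t].
  by rewrite /= in_itv/= andbT => t0; exact: (SX S_C0).
rewrite /= in_itv/= andbT => t0 e e0.
have eM : 0 < e / M by apply: divr_gt0.
have [d d0 Hd] := S_orbit S_C0 Xx eM.
near=> s; rewrite /= in_itv/= andbT => s0.
have sd : `|t - s| < d by near: s; exact: cvgr_dist_lt.
have conc h : 0 <= h -> h < d -> M * N (S h x - x) < e.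
  by move=> h0 hd; rewrite mulrC -ltr_pdivlMr//; exact: Hd.
have [ss|ss] := leP s t.
  rewrite (sn_distC sn (SX S_C0 s0 Xx) (SX S_C0 t0 Xx)).
  apply: le_lt_trans (S_orbit_dist sn S_C0 M_gt0 omega_gt0 S_decay s0 ss Xx) _.
  by apply: conc; [rewrite subr_ge0|exact: le_lt_trans (ler_norm _) sd].
apply: le_lt_trans (S_orbit_dist sn S_C0 M_gt0 omega_gt0 S_decay t0 (ltW ss) Xx) _.
apply: conc; first by rewrite subr_ge0 ltW.
by apply: le_lt_trans (ler_norm _) _; rewrite distrC.
Unshelve. all: by end_near. Qed.

Lemma glue_continuous c : continuous_into X N `[0, +oo[ c -> N (c 0 - ini 0) = 0 ->
  continuous_into X N dom (fun t => if t <= 0 then ini t else c t).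
Proof.
move=> /(continuous_intoP sn)[Xc cc] c0; apply/(continuous_intoP sn).
have /(continuous_intoP sn)[Xi ci] := ini_continuous.
have D0 : `[- taubar, 0]%classic (0 : R) by rewrite /= in_itv/= lexx andbT oppr_le0 ltW.
have E0 : `[0, +oo[%classic (0 : R) by rewrite /= in_itv/= lexx.
split => [t|t]; rewrite /dom /= in_itv/= andbT => tt.
  by case: ifPn => [t0|]; [apply: Xi; rewrite /= in_itv/= tt|rewrite -ltNge => /ltW t0; apply: Xc; rewrite /= in_itv/= t0].
move=> e e0; have [t0|t0|->] := ltgtP t 0.
- have Dt : `[- taubar, 0]%classic t by rewrite /= in_itv/= tt ltW.
  near=> s; rewrite in_itv/= andbT => ts.
  have s0 : s <= 0 by near: s; exact: lt_le_nbhsl.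
  have := @id (`[- taubar, 0]%classic s -> N (ini s - ini t) < e).
  rewrite s0 => H; apply: H; last by rewrite /= in_itv/= ts.
  by near: s; exact: ci.
- have Et : `[0, +oo[%classic t by rewrite /= in_itv/= ltW.
  near=> s; rewrite in_itv/= andbT => _.
  have s0 : 0 < s by near: s; exact: lt_nbhsr.
  rewrite leNgt s0/=.
  have H : `[0, +oo[%classic s -> N (c s - c t) < e by near: s; exact: cc.
  by apply: H; rewrite /= in_itv/= ltW.
- near=> s; rewrite in_itv/= andbT => ts.
  case: ifPn => [s0|].
    have H : `[- taubar, 0]%classic s -> N (ini s - ini 0) < e by near: s; exact: ci.
    by apply: H; rewrite /= in_itv/= ts.
  rewrite -ltNge => s0.
  have Es : `[0, +oo[%classic s by rewrite /= in_itv/= ltW.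
  have H : `[0, +oo[%classic s -> N (c s - c 0) < e by near: s; exact: cc.
  apply: le_lt_trans (sn_tri sn (y := c 0) (Xc _ Es) (Xc _ E0) (Xi _ D0)) _.
  by rewrite c0 addr0; exact: H.
Unshelve. all: by end_near. Qed.

(** On [t <= 0] the image equals [ini] literally, not merely up to null vectors, so differences of
    iterates vanish there by rewriting. *)
Lemma picard_exists U : continuous_into X N dom U -> exists W,
  [/\ continuous_into X N dom W, forall t, t <= 0 -> W t = ini t & duhamel U W].
Proof.
move=> cU.
have cb := delayed_continuous cU; have cd := nonlinear_continuous cU.
have kN_int T : mu.-integrable `[0, T] (EFin \o (fun s => - k s)).
  rewrite (_ : EFin \o _ = (-%E \o (EFin \o k))%E)//; exact: integrableN.
have ex t : exists x, 0 <= t -> bochner_integral X N `[0, t] (integrand U t) x.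
  have [t0|t0] := leP 0 t; last by exists 0 => t0'; lra.
  have [x xP] := convolution_exists sn X_complete S_C0 M_gt0 omega_gt0 S_decay kN_int cb cd t0.
  by exists x => _.
have [v vP] := choice ex.
have cv := convolution_continuous sn S_C0 M_gt0 omega_gt0 S_decay kN_int cb cd vP.
have cS := S_orbit_continuous Xini0.
pose c t := S t (ini 0) + v t.
have Xv t : 0 <= t -> X (v t) by move=> /vP[].
have cc : continuous_into X N `[0, +oo[ c.
  move/(continuous_intoP sn) : cv => [_ cv]; move/(continuous_intoP sn) : cS => [_ cS].
  apply/(continuous_intoP sn); split => [t /=|t Dt e e0].
    by rewrite in_itv/= andbT => t0; apply: (snXD sn); [exact: (SX S_C0)|exact: Xv].
  have e2 : 0 < e / 2 by rewrite divr_gt0.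
  near=> s => Ds.
  have h1 : `[0, +oo[%classic s -> N (v s - v t) < e / 2 by near: s; exact: cv.
  have h2 : `[0, +oo[%classic s -> N (S s (ini 0) - S t (ini 0)) < e / 2 by near: s; exact: cS.
  have {}h1 := h1 Ds; have {}h2 := h2 Ds.
  have s0 : 0 <= s by move: Ds; rewrite /= in_itv/= andbT.
  have t0 : 0 <= t by move: (Dt); rewrite /= in_itv/= andbT.
  rewrite /c opprD addrACA [e]splitr.
  have X1 := SX S_C0 s0 Xini0; have X2 := SX S_C0 t0 Xini0.
  apply: le_lt_trans (snD sn (snXB sn X1 X2) (snXB sn (Xv _ s0) (Xv _ t0))) _.
  exact: ltrD.
(* The value of an integral over [[0, 0]] is any null vector, so [v 0] need not be 0. The path is
   therefore glued at 0 only up to a null vector. *)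
have v0 : N (v 0) = 0.
  apply/eqP; rewrite eq_le (sn_ge0 sn); last exact: Xv.
  rewrite andbT.
  have := bochner_norm sn (measurable_itv _) (lebesgue_measure_segment_lty 0 0) (vP 0 (lexx 0))
    (integrable_segment_cst 0 0 (N (integrand U 0 0))).
  rewrite {2}set_itv1 Rintegral_set1; apply => t /=; rewrite in_itv/= => /andP[t0 t0'].
  by have -> : t = 0 by lra.
have c0 : N (c 0 - ini 0) = 0.
  apply/eqP; rewrite eq_le (sn_ge0 sn); last first.
    by apply: (snXB sn) => //; apply: (snXD sn); [exact: (SX S_C0)|exact: Xv].
  rewrite andbT /c addrAC.
  have X1 := snXB sn (SX S_C0 (lexx 0) Xini0) Xini0.
  apply: le_trans (snD sn X1 (Xv _ (lexx 0))) _.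
  by rewrite v0 addr0 (C0_zero S_C0).
exists (fun t => if t <= 0 then ini t else c t); split.
- exact: glue_continuous.
- by move=> t ->.
move=> t t0; case: ifPn => [t0'|_]; last first.
  by rewrite /c [S t _ + _]addrC addrK; exact: vP.
have -> : t = 0 by lra.
apply: (bochner_eq0 sn _ _ (vP 0 (lexx 0))).
  by apply: (snXB sn) => //; exact: (SX S_C0).
rewrite opprB addrA (addrC (v 0)) -/(c 0) (c0 : N (c 0 - ini 0) = 0)//.
Unshelve. all: by end_near. Qed.


(** [C1] belongs to the delay term and [C2] to the nonlinearity. The pair is
    [M * (bB * expR (omega * taubar))], [M * delta] for invariance and [2 * M * bB], [2 * M * L] for
    contraction. *)
Definition rate (C1 C2 s : R) := C1 * `|k s| + C2.

Lemma rate_ge0 C1 C2 s : 0 <= C1 -> 0 <= C2 -> 0 <= rate C1 C2 s.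
Proof. by move=> ? ?; rewrite /rate addr_ge0// mulr_ge0. Qed.

Lemma rate_int C1 C2 T : mu.-integrable `[0, T] (EFin \o rate C1 C2).
Proof.
rewrite (_ : EFin \o _ = (fun s => (C1%:E * (`|k s|)%:E) + (cst C2 s)%:E)%E)//.
apply: integrableD => //; last exact: integrable_segment_cst.
by apply: integrableZl => //; exact: integrable_norm.
Qed.

(** Equal to 1 for [t <= 0], where the primitive is an integral over an empty or one-point set;
    bounds with this weight thus cover the history interval too. *)
Definition weight (C1 C2 t : R) := expR (primitive (rate C1 C2) t).

Lemma weight_le C1 C2 s t : 0 <= C1 -> 0 <= C2 -> s <= t -> weight C1 C2 s <= weight C1 C2 t.
Proof.
move=> h1 h2 st; rewrite ler_expR; apply: primitive_le => //.
  by move=> x _; exact: rate_ge0.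
exact: rate_int.
Qed.

Lemma weight_ge1 C1 C2 t : 0 <= C1 -> 0 <= C2 -> 1 <= weight C1 C2 t.
Proof.
move=> h1 h2; rewrite -expR0 ler_expR; apply: primitive_ge0.
  by move=> x _; exact: rate_ge0.
exact: rate_int.
Qed.

Lemma rate_weight_int C1 C2 c T : 0 <= C1 -> 0 <= C2 ->
  mu.-integrable `[0, T] (EFin \o (fun s => c * (rate C1 C2 s * weight C1 C2 s))).
Proof.
move=> h1 h2; rewrite (_ : EFin \o _ =
  (fun s => c%:E * (EFin \o (fun s => (rate C1 C2 s * weight C1 C2 s)%R)) s)%E)//.
apply: integrableZl => //; apply: integrable_exp_primitive.
  by move=> x _; exact: rate_ge0.
exact: rate_int.
Qed.

Lemma rate_weight_integral C1 C2 c t : 0 <= C1 -> 0 <= C2 -> 0 <= c -> 0 <= t ->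
  \int[mu]_(s in `[0, t]) (c * (rate C1 C2 s * weight C1 C2 s)) <=
  c * (weight C1 C2 t - 1).
Proof.
move=> h1 h2 c0 t0.
have ra x : 0 <= x -> 0 <= rate C1 C2 x by move=> _; exact: rate_ge0.
rewrite RintegralZl//; last first.
  by apply: integrable_exp_primitive => //; exact: rate_int.
apply: ler_wpM2l => //; apply: integral_exp_primitive => //; exact: rate_int.
Qed.

(* The rates carry a factor 2 too much, which yields the contraction factor. *)
Lemma duhamel_dist U1 U2 W1 W2 (T c L : R) : 0 <= c -> 0 <= L ->
  continuous_into X N dom U1 -> continuous_into X N dom U2 ->
  duhamel U1 W1 -> duhamel U2 W2 ->
  (forall s, 0 <= s <= T -> N (Fop (U1 s) - Fop (U2 s)) <= L * N (U1 s - U2 s)) ->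
  (forall s, - taubar <= s <= T ->
     N (U1 s - U2 s) <= c * weight (2 * M * bB) (2 * M * L) s) ->
  forall t, 0 <= t <= T ->
    N (W1 t - W2 t) <= c / 2 * weight (2 * M * bB) (2 * M * L) t.
Proof.
move=> c0 L0 [XU1 _] [XU2 _] D1 D2 FL H t /andP[t0 tT].
have M0 := ltW M_gt0.
set C1 := 2 * M * bB; set C2 := 2 * M * L.
have C10 : 0 <= C1 by rewrite /C1 !mulr_ge0.
have C20 : 0 <= C2 by rewrite /C2 !mulr_ge0.
have E : W1 t - W2 t = (W1 t - S t (ini 0)) - (W2 t - S t (ini 0)).
  by rewrite opprB addrA subrK.
have c20 : 0 <= c / 2 by rewrite divr_ge0.
rewrite E; apply: le_trans (bochner_dist sn (measurable_itv _) (lebesgue_measure_segment_lty 0 t)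
  (D1 t t0) (D2 t t0) (rate_weight_int (c / 2) t C10 C20) _) _; last first.
  apply: le_trans (rate_weight_integral C10 C20 c20 t0) _.
  by rewrite ler_wpM2l// lerBlDr lerDl.
move=> s /=; rewrite in_itv/= => /andP[s0 st].
have [sd1 sd2] := delay_dom s0.
have dm u : - taubar <= u -> dom u by move=> ?; rewrite /dom /= in_itv/= andbT.
have s0' : - taubar <= s by exact: le_trans sd2.
have Xs1 := XU1 _ (dm _ s0'); have Xs2 := XU2 _ (dm _ s0').
have Xd1 := XU1 _ (dm _ sd1); have Xd2 := XU2 _ (dm _ sd1).
have ts0 : 0 <= t - s by rewrite subr_ge0.
have XI U (Xd : X (U (s - tau s))) (Xs : X (U s)) :
  X (- k s *: Bop (U (s - tau s)) + Fop (U s)).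
  by apply: (sn_lin sn); [exact: XB|exact: XF].
apply: le_trans (S_lipschitz sn S_C0 M_gt0 omega_gt0 S_decay ts0 (XI _ Xd1 Xs1) (XI _ Xd2 Xs2)) _.
rewrite opprD addrACA -scalerBr.
have XBB := snXB sn (XB Xd1) (XB Xd2); have XFF := snXB sn (XF Xs1) (XF Xs2).
have h1 := H (s - tau s) _; have h2 := H s _.
(* Monotonicity of the weight moves the bound at the delayed time [s - tau s] to time [s]. *)
have {}h1 : N (U1 (s - tau s) - U2 (s - tau s)) <= c * weight C1 C2 s.
  apply: le_trans (h1 _) _; first by rewrite sd1 (le_trans sd2)// (le_trans st).
  by apply: ler_wpM2l => //; exact: weight_le.
have {}h2 : N (U1 s - U2 s) <= c * weight C1 C2 s.
  by apply: h2; rewrite s0' (le_trans st).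
have b1 : `|k s| * N (Bop (U1 (s - tau s)) - Bop (U2 (s - tau s))) <=
    `|k s| * (bB * (c * weight C1 C2 s)).
  by apply: ler_wpM2l => //; apply: le_trans (B_lip Xd1 Xd2) _; exact: ler_wpM2l.
have b2 : N (Fop (U1 s) - Fop (U2 s)) <= L * (c * weight C1 C2 s).
  by apply: le_trans (FL s _) _; [rewrite s0 (le_trans st)|exact: ler_wpM2l].
apply: (@le_trans _ _ (M * (`|k s| * (bB * (c * weight C1 C2 s)) + L * (c * weight C1 C2 s)))).
  apply: ler_wpM2l => //.
  apply: le_trans (snD sn (snXZ sn _ XBB) XFF) _.
  by rewrite (snZ sn)// normrN; exact: lerD.
have -> : M * (`|k s| * (bB * (c * weight C1 C2 s)) + L * (c * weight C1 C2 s)) =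
  c / 2 * (rate C1 C2 s * weight C1 C2 s) by rewrite /rate /C1 /C2; field.
exact: lexx.
Qed.

(** The delay is the source of [expR (omega * taubar)]: the value at [s - tau s] decays like
    [expR (- omega * (s - tau s))], which exceeds [expR (- omega * s)] by at most this factor. The
    decay of [S (t - s)] then completes [expR (- omega * s)] to [expR (- omega * t)]. *)
Lemma duhamel_bound U W (C0 delta : R) : 0 <= C0 -> 0 <= delta ->
  continuous_into X N dom U -> duhamel U W -> M * N (ini 0) <= C0 ->
  (forall s, 0 <= s -> N (Fop (U s)) <= delta * N (U s)) ->
  let w := weight (M * (bB * expR (omega * taubar))) (M * delta) in
  (forall s, - taubar <= s -> N (U s) <= C0 * expR (- omega * s) * w s) ->
  forall t, 0 <= t -> N (W t) <= C0 * expR (- omega * t) * w t.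
Proof.
move=> C00 d0 [XU _] D hC0 FU w H t t0.
have M0 := ltW M_gt0.
set C1 := M * (bB * expR (omega * taubar)) in w H *; set C2 := M * delta in w H *.
have C10 : 0 <= C1 by rewrite /C1 !mulr_ge0// expR_ge0.
have C20 : 0 <= C2 by rewrite /C2 !mulr_ge0.
have XS := SX S_C0 t0 Xini0.
have [_ XWS _] := D t t0.
have XW : X (W t) by rewrite -(subrK (S t (ini 0)) (W t)); exact: (snXD sn).
have cc0 : 0 <= C0 * expR (- omega * t) by exact: mulr_ge0.
apply: le_trans (sn_le_add sn XW XS) _.
have h1 : N (S t (ini 0)) <= C0 * expR (- omega * t).
  apply: le_trans (S_decay t0 Xini0) _.
  by rewrite mulrAC; exact: ler_wpM2r.
suff h2 : N (W t - S t (ini 0)) <= C0 * expR (- omega * t) * (w t - 1).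
  by apply: le_trans (lerD h1 h2) _; rewrite mulrBr mulr1 addrC subrK lexx.
apply: le_trans (bochner_norm sn (measurable_itv _) (lebesgue_measure_segment_lty 0 t)
  (D t t0) (rate_weight_int (C0 * expR (- omega * t)) t C10 C20) _) _; last first.
  exact: rate_weight_integral.
move=> s /=; rewrite in_itv/= => /andP[s0 st].
have [sd1 sd2] := delay_dom s0.
have dm u : - taubar <= u -> dom u by move=> ?; rewrite /dom /= in_itv/= andbT.
have s0' : - taubar <= s by exact: le_trans sd2.
have Xs := XU _ (dm _ s0'); have Xd := XU _ (dm _ sd1).
have ts0 : 0 <= t - s by rewrite subr_ge0.
have XI : X (- k s *: Bop (U (s - tau s)) + Fop (U s)).
  by apply: (sn_lin sn); [exact: XB|exact: XF].
apply: le_trans (S_decay ts0 XI) _.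
have b1 : N (Bop (U (s - tau s))) <=
   bB * (C0 * (expR (omega * taubar) * expR (- omega * s)) * w s).
  apply: le_trans (B_norm Xd) _; apply: ler_wpM2l => //.
  apply: le_trans (H _ sd1) _; apply: ler_pM.
  - by rewrite mulr_ge0// expR_ge0.
  - exact: expR_ge0.
  - apply: ler_wpM2l => //; rewrite -expRD ler_expR.
    have /andP[_ tb] := tau_bounds s0.
    have -> : - omega * (s - tau s) = omega * tau s + - omega * s by ring.
    by rewrite lerD2r; apply: ler_wpM2l => //; exact: ltW.
  - exact: weight_le.
have b2 : N (Fop (U s)) <= delta * (C0 * expR (- omega * s) * w s).
  by apply: le_trans (FU s s0) _; apply: ler_wpM2l => //; exact: H.
have b3 : N (- k s *: Bop (U (s - tau s)) + Fop (U s)) <=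
   `|k s| * (bB * (C0 * (expR (omega * taubar) * expR (- omega * s)) * w s)) +
   delta * (C0 * expR (- omega * s) * w s).
  apply: le_trans (snD sn (snXZ sn _ (XB Xd)) (XF Xs)) _.
  rewrite (snZ sn) ?normrN; last exact: XB.
  by apply: lerD => //; exact: ler_wpM2l.
apply: le_trans (ler_wpM2l _ b3) _.
  by rewrite mulr_ge0// expR_ge0.
have -> : - omega * t = - omega * (t - s) + - omega * s by ring.
rewrite expRD /rate /C1 /C2 -/(w s).
set x := expR (- omega * (t - s)); set y := expR (- omega * s).
set z := expR (omega * taubar); set ww := w s; set kk := `|k s|.
have -> : M * x * (kk * (bB * (C0 * (z * y) * ww)) + delta * (C0 * y * ww)) =
   C0 * (x * y) * ((M * (bB * z) * kk + M * delta) * ww) by ring.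
exact: lexx.
Qed.


Let domE t : dom t = (- taubar <= t) :> Prop.
Proof. by rewrite /dom /= in_itv/= andbT. Qed.

(** No smallness enters: on a bounded interval both solutions are bounded, [L] is taken for a ball
    containing them, and each application of [duhamel_dist] to the same pair halves their weighted
    distance. *)
Lemma mild_unique U V' :
  continuous_into X N dom U -> (forall t, - taubar <= t <= 0 -> N (U t - ini t) = 0) ->
  duhamel U U ->
  continuous_into X N dom V' -> (forall t, - taubar <= t <= 0 -> N (V' t - ini t) = 0) ->
  duhamel V' V' ->
  forall t, - taubar <= t -> N (V' t - U t) = 0.
Proof.
move=> cU iU DU cV iV DV t tt.
have M0 := ltW M_gt0.
have XU s : - taubar <= s -> X (U s) by move=> ss; apply: cU.1; rewrite domE.
have XV s : - taubar <= s -> X (V' s) by move=> ss; apply: cV.1; rewrite domE.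
pose T := Num.max t 0.
have tT : t <= T by rewrite /T le_max lexx.
have sub : `[- taubar, T]%classic `<=` dom by apply: subset_itvl.
have [CU CU0 bU] := continuous_into_bounded sn (continuous_into_subset sn sub cU).
have [CV CV0 bV] := continuous_into_bounded sn (continuous_into_subset sn sub cV).
have r0 : 0 < CU + CV + 1 by rewrite ltr_wpDl// addr_ge0.
have [L L0 HL] := F_lip r0.
have inT s : - taubar <= s <= T -> `[- taubar, T]%classic s by move=> ?; rewrite /= in_itv/=.
have rT s : 0 <= s <= T -> - taubar <= s <= T.
  by move=> /andP[s0 sT]; rewrite sT andbT (le_trans _ s0)// oppr_le0 ltW.
have C10 : 0 <= 2 * M * bB by rewrite !mulr_ge0.
have C20 : 0 <= 2 * M * L by rewrite !mulr_ge0// ltW.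
have c0 : 0 <= CU + CV by exact: addr_ge0.
have main n : forall s, - taubar <= s <= T ->
    N (V' s - U s) <= ((CU + CV) * 2^-1 ^+ n) * weight (2 * M * bB) (2 * M * L) s.
  elim: n => [|n IH] s sT.
    have s1 : - taubar <= s by case/andP: sT.
    rewrite expr0 mulr1 -[leLHS]mulr1; apply: ler_pM => //.
    - by apply: (sn_ge0 sn); apply: (snXB sn); [exact: XV|exact: XU].
    - apply: le_trans (snB sn (XV _ s1) (XU _ s1)) _.
      by rewrite addrC; apply: lerD; [apply: bU|apply: bV]; exact: inT.
    - exact: weight_ge1.
  have [s0|s0] := leP s 0.
    have s1 : - taubar <= s <= 0 by case/andP: sT => -> _.
    have s1' : - taubar <= s by case/andP: sT.
    have Xi := Xini s1.
    apply: le_trans (sn_tri sn (XV _ s1') Xi (XU _ s1')) _.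
    rewrite iV// (sn_distC sn Xi (XU _ s1')) iU// addr0.
    by rewrite mulr_ge0 ?expR_ge0// mulr_ge0// exprn_ge0// invr_ge0.
  rewrite exprSr mulrA; apply: (duhamel_dist (T := T) _ (ltW L0) cV cU DV DU _ IH).
  - by rewrite mulr_ge0// exprn_ge0// invr_ge0.
  - move=> x xT; have /andP[x1 _] := rT _ xT; apply: HL; [exact: XV|exact: XU| |].
      by apply: le_trans (bV _ (inT _ (rT _ xT))) _; rewrite -addrA addrCA lerDl addr_ge0.
    by apply: le_trans (bU _ (inT _ (rT _ xT))) _; rewrite -addrA lerDl addr_ge0.
  - by rewrite (ltW s0); case/andP: sT.
apply/eqP; rewrite eq_le; apply/andP; split; last first.
  by apply: (sn_ge0 sn); apply: (snXB sn); [exact: XV|exact: XU].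
apply: (@le_of_le_geometric _ _ _ ((CU + CV) * weight (2 * M * bB) (2 * M * L) t)) => n.
by rewrite add0r mulrAC; apply: main; rewrite tt.
Qed.

(** The single bound [B] is both the decay estimate and the confinement to the ball of radius [r0]
    on which [F] is small and Lipschitz. The factor [M + 1] dominates [M], for the free evolution,
    and 1, for the history; only [0 < M] is assumed. *)
Theorem mild_exists (r0 delta c0 : R) : 0 < r0 -> 0 <= delta -> 0 <= c0 ->
  (forall x, X x -> N x <= r0 -> N (Fop x) <= delta * N x) ->
  (forall t, - taubar <= t <= 0 -> N (ini t) <= c0) ->
  let B t := (M + 1) * c0 * expR (- omega * t) *
    weight (M * (bB * expR (omega * taubar))) (M * delta) t in
  (forall t, 0 <= t -> B t <= r0) ->
  exists U, [/\ continuous_into X N dom U,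
    forall t, - taubar <= t <= 0 -> N (U t - ini t) = 0, duhamel U U &
    forall t, - taubar <= t -> N (U t) <= B t].
Proof.
move=> r00 d0 c00 Fsmall hini B Br.
have M0 := ltW M_gt0.
set w := weight _ _ in B Br *.
have W10 : 0 <= M * (bB * expR (omega * taubar)) by rewrite !mulr_ge0// expR_ge0.
have W20 : 0 <= M * delta by rewrite !mulr_ge0.
have w1 t : 1 <= w t by exact: weight_ge1.
have K0 : 0 <= (M + 1) * c0 by rewrite mulr_ge0// addr_ge0.
have Bini t : - taubar <= t <= 0 -> N (ini t) <= B t.
  move=> tt; apply: le_trans (hini t tt) _; rewrite -[leLHS]mulr1.
  apply: ler_pM => //; rewrite -[leLHS]mulr1; apply: ler_pM => //.
    by rewrite mulrDl mul1r lerDr mulr_ge0.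
  rewrite -expR0 ler_expR mulNr oppr_ge0; apply: mulr_ge0_le0; first exact: ltW.
  by case/andP: tt.
have ini0_dom : - taubar <= 0 <= (0 : R) by rewrite lexx andbT oppr_le0 ltW.
have MiniK : M * N (ini 0) <= (M + 1) * c0.
  by apply: ler_pM => //; [exact: (sn_ge0 sn)|rewrite lerDl|exact: hini].
(* The set of paths that the Picard map leaves invariant. *)
pose good U := [/\ continuous_into X N dom U, forall t, t <= 0 -> U t = ini t &
  forall t, - taubar <= t -> N (U t) <= B t].
have goodX U t : good U -> - taubar <= t -> X (U t).
  by move=> [[XU _] _ _] tt; apply: XU; rewrite domE.
(* Stated as an implication inside the existential so that [choice] yields a total map [P]; its
   value outside [good] is arbitrary. *)
have step U : exists W, good U -> good W /\ duhamel U W.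
  have [gU|] := pselect (good U); last by exists U.
  have [cU iU bU] := gU; have [W [cW iW DW]] := picard_exists cU.
  exists W => _; split => //; split => // t tt.
  have [t0|/ltW t0] := leP t 0; first by rewrite iW//; apply: Bini; rewrite tt.
  apply: (duhamel_bound K0 d0 cU DW MiniK) => // s s0.
  have ss : - taubar <= s by apply: le_trans s0; rewrite oppr_le0 ltW.
  apply: Fsmall; first exact: goodX ss.
  by apply: le_trans (bU s ss) _; exact: Br.
have [P HP] := choice step.
pose U0 t := if t <= 0 then ini t else S t (ini 0).
have gU0 : good U0.
  split.
  - apply: glue_continuous; first exact: S_orbit_continuous.
    exact: (C0_zero S_C0).
  - by move=> t t0; rewrite /U0 t0.
  move=> t tt; rewrite /U0; case: ifPn => [t0|]; first by apply: Bini; rewrite tt.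
  rewrite -ltNge => /ltW t0; apply: le_trans (S_decay t0 Xini0) _.
  rewrite -[leLHS]mulr1; apply: ler_pM => //.
    by rewrite mulr_ge0 ?(sn_ge0 sn)// mulr_ge0// expR_ge0.
  by rewrite mulrAC; apply: ler_wpM2r => //; exact: expR_ge0.
pose U_ n := iter n P U0.
have gU n : good (U_ n) by elim: n => //= n IH; case: (HP _ IH).
have DU n : duhamel (U_ n) (U_ n.+1) by case: (HP _ (gU n)).
have XU n t : - taubar <= t -> X (U_ n t) by exact: goodX.
have [L L0 HL] := F_lip r00.
have C10 : 0 <= 2 * M * bB by rewrite !mulr_ge0.
have C20 : 0 <= 2 * M * L by rewrite !mulr_ge0// ltW.
set psi := weight (2 * M * bB) (2 * M * L).
have psi1 t : 1 <= psi t by exact: weight_ge1.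
have psi0 t : 0 <= psi t by exact: expR_ge0.
have h0 n : 0 <= 2^-1 ^+ n :> R by rewrite exprn_ge0// invr_ge0.
have Lip U W : good U -> good W -> forall s, 0 <= s ->
    N (Fop (U s) - Fop (W s)) <= L * N (U s - W s).
  move=> g1 g2 s s0; have ss : - taubar <= s by apply: le_trans s0; rewrite oppr_le0 ltW.
  have [_ _ b1] := g1; have [_ _ b2] := g2.
  by apply: HL; try exact: goodX; [apply: le_trans (b1 _ ss) _|apply: le_trans (b2 _ ss) _]; exact: Br.
(* The first two iterates lie in the ball of radius [r0], hence the initial distance [2 * r0]; each
   further step contributes a factor 1/2. *)
have incr n : forall t, - taubar <= t -> N (U_ n.+1 t - U_ n t) <= 2 * r0 * 2^-1 ^+ n * psi t.
  elim: n => [|n IH] t tt.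
    have [t0|/ltW t0] := leP t 0.
      have [_ i1 _] := gU 1%N; have [_ i2 _] := gU 0%N.
      rewrite i1// i2// subrr (sn_norm0 sn); apply: mulr_ge0 => //; apply: mulr_ge0 => //.
      by rewrite mulr_ge0// ltW.
    rewrite expr0 mulr1 -[leLHS]mulr1; apply: ler_pM => //.
      by apply: (sn_ge0 sn); apply: (snXB sn); exact: XU.
    apply: le_trans (snB sn (XU _ _ tt) (XU _ _ tt)) _.
    have [_ _ b1] := gU 1%N; have [_ _ b2] := gU 0%N.
    rewrite [2 * r0]mulr_natl mulr2n; apply: lerD.
      by apply: le_trans (b1 _ tt) _; exact: Br.
    by apply: le_trans (b2 _ tt) _; exact: Br.
  have [t0|/ltW t0] := leP t 0.
    have [_ i1 _] := gU n.+2; have [_ i2 _] := gU n.+1.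
    rewrite i1// i2// subrr (sn_norm0 sn); apply: mulr_ge0 => //; apply: mulr_ge0 => //.
    by rewrite mulr_ge0// ltW.
  rewrite exprSr [2 * r0 * _]mulrA.
  have cc : 0 <= 2 * r0 * 2^-1 ^+ n by rewrite mulr_ge0// mulr_ge0// ltW.
  apply: (duhamel_dist (T := t) cc (ltW L0) _ _ (DU n.+1) (DU n)).
  - by case: (gU n.+1).
  - by case: (gU n).
  - by move=> s /andP[s0 _]; apply: Lip.
  - by move=> s /andP[s0 _]; exact: IH.
  - by rewrite t0 lexx.
have dist n m t : - taubar <= t -> N (U_ (n + m)%N t - U_ n t) <= 4 * r0 * psi t * 2^-1 ^+ n.
  move=> tt.
  (* The exact partial sum of the geometric series, with [4 * r0] as twice [2 * r0], is what makes
     the induction on [m] close. *)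
  suff : N (U_ (n + m)%N t - U_ n t) <= 4 * r0 * psi t * 2^-1 ^+ n * (1 - 2^-1 ^+ m).
    move/le_trans; apply; rewrite -[leRHS]mulr1; apply: ler_wpM2l.
      by apply: mulr_ge0 => //; apply: mulr_ge0 => //; rewrite mulr_ge0// ltW.
    by rewrite lerBlDr lerDl.
  elim: m => [|m IH].
    by rewrite addn0 subrr (sn_norm0 sn) expr0 subrr mulr0.
  rewrite addnS; apply: le_trans (sn_tri sn (XU _ _ tt) (XU (n + m)%N _ tt) (XU _ _ tt)) _.
  apply: le_trans (lerD (incr _ _ tt) IH) _.
  rewrite exprD exprSr; set x := 2^-1 ^+ n; set y := 2^-1 ^+ m; set p := psi t.
  have -> : 2 * r0 * (x * y) * p + 4 * r0 * p * x * (1 - y) =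
     4 * r0 * p * x * (1 - y * 2^-1) by field.
  exact: lexx.
have cauchy t : exists y, - taubar <= t -> X y /\ N (U_ n t - y) @[n --> \oo] --> (0 : R).
  have [tt|tt] := leP (- taubar) t; last by exists 0.
  have [|e e0|y Xy cy] := X_complete (x := fun n => U_ n t); first by move=> n; exact: XU.
    have g0 : (fun n => 4 * r0 * psi t * 2^-1 ^+ n) @ \oo --> 4 * r0 * psi t * 0.
      by apply: cvgMr; apply: cvg_expr; rewrite ger0_norm ?invr_ge0// invf_lt1 ?ltr1n.
    rewrite mulr0 in g0; have e2 : 0 < e / 2 by rewrite divr_gt0.
    move/cvgrPdist_lt : g0 => /(_ _ e2)[n0 _ Hn0].
    exists n0 => m n n0m n0n.
    have g : 4 * r0 * psi t * 2^-1 ^+ n0 < e / 2.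
      have := Hn0 n0 (leqnn n0); rewrite sub0r normrN; apply: le_lt_trans; exact: ler_norm.
    apply: le_lt_trans (sn_tri sn (XU _ _ tt) (XU n0 _ tt) (XU _ _ tt)) _.
    rewrite [e]splitr; apply: ltrD.
      by rewrite -(subnKC n0m); apply: le_lt_trans (dist _ _ _ tt) g.
    rewrite (sn_distC sn (XU _ _ tt) (XU _ _ tt)).
    by rewrite -(subnKC n0n); apply: le_lt_trans (dist _ _ _ tt) g.
  by exists y => _.
have [U HU] := choice cauchy.
have XUl t : - taubar <= t -> X (U t) by move=> /HU[].
have lim_le n t : - taubar <= t -> N (U_ n t - U t) <= 4 * r0 * psi t * 2^-1 ^+ n.
  move=> tt; have [_ cy] := HU t tt.
  apply/ler_addgt0Pr => e e0; move/cvgrPdist_lt : cy => /(_ _ e0)[m _ Hm].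
  have g : N (U_ (n + m)%N t - U t) < e.
    have := Hm (n + m)%N (leq_addl n m); rewrite sub0r normrN; apply: le_lt_trans; exact: ler_norm.
  apply: le_trans (sn_tri sn (XU _ _ tt) (XU (n + m)%N _ tt) (XUl _ tt)) _.
  apply: lerD; last exact: ltW.
  by rewrite (sn_distC sn (XU _ _ tt) (XU _ _ tt)); exact: dist.
have bU t : - taubar <= t -> N (U t) <= B t.
  move=> tt; apply: (@le_of_le_geometric _ _ _ (4 * r0 * psi t)) => n.
  apply: le_trans (sn_le_add sn (XUl _ tt) (XU n _ tt)) _.
  have [_ _ b] := gU n; apply: lerD; first exact: b.
  by rewrite (sn_distC sn (XUl _ tt) (XU _ _ tt)); exact: lim_le.
have cU : continuous_into X N dom U.
  apply/(continuous_intoP sn); split => [t|t]; rewrite domE => tt; first exact: XUl.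
  move=> e e0; have e3 : 0 < e / 3 by rewrite divr_gt0.
  (* The weight at [t + 1] bounds the weight at all times near [t], so one iterate is close to [U]
     on a whole neighbourhood. *)
  pose p := psi (t + 1).
  have [n Hn] : exists n, 4 * r0 * p * 2^-1 ^+ n < e / 3.
    apply: contrapT => /forallNP H.
    have : e / 3 <= 0; last by rewrite leNgt e3.
    apply: (@le_of_le_geometric _ _ _ (4 * r0 * p)) => n; rewrite add0r leNgt; exact/negP/H.
  have [/(continuous_intoP sn)[_ cn] _ _] := gU n.
  have Dt : dom t by rewrite domE.
  near=> s; rewrite domE => ss.
  have small x : - taubar <= x -> x <= t + 1 -> N (U_ n x - U x) < e / 3.
    move=> xt xt1; apply: le_lt_trans (lim_le n x xt) _; apply: le_lt_trans Hn.
    apply: ler_wpM2r; first exact: h0.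
    apply: ler_wpM2l; first by rewrite mulr_ge0// ltW.
    exact: weight_le.
  have h1 : dom s -> N (U_ n s - U_ n t) < e / 3 by near: s; exact: cn.
  have {}h1 := h1 _; rewrite domE in h1; have {}h1 := h1 ss.
  have st : s <= t + 1.
    have : `|t - s| < 1 by near: s; exact: cvgr_dist_lt.
    by rewrite ltr_norml => /andP[? _]; rewrite -lerBlDl ltW// ltrBlDl -ltrBlDr; lra.
  apply: le_lt_trans (sn_tri sn (XUl _ ss) (XU n _ ss) (XUl _ tt)) _.
  have -> : e = e / 3 + (e / 3 + e / 3) by field.
  apply: ltrD.
    by rewrite (sn_distC sn (XUl _ ss) (XU _ _ ss)); exact: small.
  apply: le_lt_trans (sn_tri sn (XU _ _ ss) (XU n _ tt) (XUl _ tt)) _.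
  by apply: ltrD => //; apply: small => //; rewrite lerDl.
exists U; split => //.
  move=> t /andP[tt t0]; apply/eqP; rewrite eq_le; apply/andP; split; last first.
    by apply: (sn_ge0 sn); apply: (snXB sn); [exact: XUl|apply: Xini; rewrite tt].
  apply: (@le_of_le_geometric _ _ _ (4 * r0 * psi t)) => n; rewrite add0r.
  have [_ i _] := gU n; have := lim_le n t tt; rewrite i//.
  by rewrite (sn_distC sn (Xini _) (XUl _ tt))// tt.
(* The fixed-point equation without a passage to the limit under the integral: [W] is the image of
   [U], and by contraction it is as close to the iterates as [U] is, so [W] and [U] differ by null
   vectors. *)
have [W [cW iW DW]] := picard_exists cU.
have WU t : 0 <= t -> N (W t - U t) = 0.
  move=> t0; have tt : - taubar <= t by apply: le_trans t0; rewrite oppr_le0 ltW.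
  have XW : X (W t) by apply: cW.1; rewrite domE.
  apply/eqP; rewrite eq_le; apply/andP; split; last by apply: (sn_ge0 sn); apply: (snXB sn) => //; exact: XUl.
  apply: (@le_of_le_geometric _ _ _ (4 * r0 * psi t)) => n; rewrite add0r.
  apply: le_trans (sn_tri sn XW (XU n.+1 _ tt) (XUl _ tt)) _.
  have cc : 0 <= 4 * r0 * 2^-1 ^+ n by rewrite mulr_ge0// mulr_ge0// ltW.
  have g : N (W t - U_ n.+1 t) <= 4 * r0 * 2^-1 ^+ n / 2 * psi t.
    apply: (duhamel_dist (T := t) cc (ltW L0) cU _ DW (DU n)).
    - by case: (gU n).
    - move=> s /andP[s0 _].
      have ss : - taubar <= s by apply: le_trans s0; rewrite oppr_le0 ltW.
      have [_ _ b2] := gU n.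
      apply: HL; [exact: XUl|exact: XU| |].
        by apply: le_trans (bU _ ss) _; exact: Br.
      by apply: le_trans (b2 _ ss) _; exact: Br.
    - move=> s /andP[ss _]; rewrite (sn_distC sn (XUl _ ss) (XU _ _ ss)) mulrAC.
      exact: lim_le.
    - by rewrite t0 lexx.
  apply: le_trans (lerD g (lim_le n.+1 t tt)) _; rewrite exprSr.
  set x := 2^-1 ^+ n; set q := psi t.
  have -> : 4 * r0 * x / 2 * q + 4 * r0 * q * (x * 2^-1) = 4 * r0 * q * x by field.
  exact: lexx.
move=> t t0; have tt : - taubar <= t by apply: le_trans t0; rewrite oppr_le0 ltW.
have XS := SX S_C0 t0 Xini0.
apply: (bochner_eq0 sn _ _ (DW t t0)).
  by apply: (snXB sn) => //; exact: XUl.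
by rewrite opprB addrA subrK; exact: WU.
Unshelve. all: by end_near. Qed.

End MildSolutions.

(** * The phase space *)

Section RealHilbert.
Context {R : realType} {H : completeNormedModType R}.
Variable ip : {dot H for idfun}.
Hypothesis ip_norm : hilbert_inner_product ip.

Lemma ipC x y : ip x y = ip y x.
Proof. by rewrite hermC expr0 mul1r. Qed.

Lemma ipDr x y z : ip x (y + z) = ip x y + ip x z.
Proof. exact: linearDr. Qed.

Lemma ipBr x y z : ip x (y - z) = ip x y - ip x z.
Proof. exact: linearBr. Qed.

Lemma ipZr (a : R) x y : ip x (a *: y) = a * ip x y.
Proof. by rewrite linearZ. Qed.

Lemma ipDl x y z : ip (x + y) z = ip x z + ip y z.
Proof. by rewrite ipC ipDr !(ipC z). Qed.

Lemma ipBl x y z : ip (x - y) z = ip x z - ip y z.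
Proof. by rewrite ipC ipBr !(ipC z). Qed.

Lemma ipZl (a : R) x y : ip (a *: x) y = a * ip x y.
Proof. by rewrite ipC ipZr ipC. Qed.

Lemma ip0r x : ip x 0 = 0.
Proof. by rewrite -(scale0r 0) ipZr mul0r. Qed.

Lemma ip_inj x y : (forall z, ip z x = ip z y) -> x = y.
Proof.
move=> xy; apply/eqP; rewrite -subr_eq0 -normr_eq0 -sqrf_eq0 -ip_norm.
by rewrite ipBr xy subrr.
Qed.

Lemma ip_le x y : `|ip x y| <= `|x| * `|y|.
Proof.
have [->|y0] := eqVneq y 0; first by rewrite ip0r !normr0 mulr0.
have ny : 0 < `|y| by rewrite normr_gt0.
rewrite -(ler_pXn2r (n := 2)) ?nnegrE ?mulr_ge0//.
rewrite real_normK ?num_real// exprMn.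
pose t := ip x y / `|y| ^+ 2.
have := sqr_ge0 `|x - t *: y|; rewrite -ip_norm ipBl !ipBr !ipZl !ipZr !ip_norm (ipC y x).
have tE : t * `|y| ^+ 2 = ip x y by rewrite /t divfK// expf_neq0// gt_eqF.
rewrite tE subrr subr0 => h.
have : 0 <= (`|x| ^+ 2 - t * ip x y) * `|y| ^+ 2 by apply: mulr_ge0 => //; exact: sqr_ge0.
by rewrite mulrBl (mulrAC t) tE -expr2 subr_ge0.
Qed.

Lemma parallelogram (x y : H) : `|x - y| ^+ 2 + `|x + y| ^+ 2 = 2 * (`|x| ^+ 2 + `|y| ^+ 2).
Proof. by rewrite -!ip_norm ipBl !ipBr ipDl !ipDr (ipC y x); ring. Qed.

(** Otherwise subtracting from [x] its projection onto [w] would lower the norm strictly. *)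
Lemma orthogonal_of_minimal (x w : H) : (forall t : R, `|x| <= `|x - t *: w|) -> ip w x = 0.
Proof.
move=> hmin; apply/eqP/negPn/negP => p0.
have w0 : 0 < `|w|.
  by rewrite normr_gt0; apply: contra_neq p0 => ->; rewrite ipC ip0r.
pose t := ip w x / `|w| ^+ 2.
have tE : t * `|w| ^+ 2 = ip w x by rewrite /t divfK// expf_neq0// gt_eqF.
have := hmin t; rewrite -(ler_pXn2r (n := 2)) ?nnegrE//.
rewrite -!ip_norm ipBl !ipBr !ipZl !ipZr (ip_norm w) (ipC x w) tE subrr subr0.
rewrite lerBrDr -lerBrDl subrr leNgt => /negP; apply.
have -> : t * ip w x = (ip w x) ^+ 2 / `|w| ^+ 2 by rewrite /t mulrAC expr2.
by apply: divr_gt0; [rewrite exprn_even_gt0|exact: exprn_gt0].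
Qed.

Section Adjoint.
Variables (B : {linear H -> H}) (Bs : H -> H).
Hypothesis B_bounded : continuous B.
Hypothesis Bs_adj : adjoint_operator ip B Bs.

Lemma operator_norm_le : 0 <= operator_norm B /\ forall x, `|B x| <= operator_norm B * `|x|.
Proof.
have /linear_boundedP/pinfty_ex_gt0[C C0 HC] : bounded_near B (nbhs (0 : H)).
  by apply: continuous_linear_bounded; exact: B_bounded.
have ub : has_sup [set `|B x| | x in [set x : H | `|x| <= 1]].
  split; first by exists `|B 0|, 0 => //=; rewrite normr0.
  exists C => _ [x /= x1 <-]; apply: le_trans (HC x) _.
  by rewrite ger_pMr.
have b0 : 0 <= operator_norm B.
  by apply: le_trans (normr_ge0 (B 0)) _; apply: sup_upper_bound => //; exists 0 => //=; rewrite normr0.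
split => // x; have [->|x0] := eqVneq x 0; first by rewrite raddf0 !normr0 mulr0.
have nx : 0 < `|x| by rewrite normr_gt0.
rewrite -ler_pdivrMr//.
have -> : `|B x| / `|x| = `|B (`|x|^-1 *: x)|.
  by rewrite linearZ normrZ normfV normr_id mulrC.
apply: sup_upper_bound => //; exists (`|x|^-1 *: x) => //=.
by rewrite normrZ normfV normr_id mulVf// gt_eqF.
Qed.

(** Additivity of [Bs] comes from the adjoint relation, since a vector is determined by its inner
    products. *)
Lemma adjointB x y : Bs (x - y) = Bs x - Bs y.
Proof. by apply: ip_inj => z; rewrite ipBr -!Bs_adj ipBr. Qed.

Lemma adjoint_le x : `|Bs x| <= operator_norm B * `|x|.
Proof.
have [b0 hb] := operator_norm_le.
have [->|n0] := eqVneq (Bs x) 0; first by rewrite normr0 mulr_ge0.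
have np : 0 < `|Bs x| by rewrite normr_gt0.
rewrite -(ler_pM2l np) -expr2 -ip_norm -Bs_adj.
apply: le_trans (ler_norm _) _; apply: le_trans (ip_le _ _) _.
by rewrite mulrA [_ * operator_norm B]mulrC ler_wpM2r.
Qed.

Lemma BBs_le x : `|B (Bs x)| <= operator_norm B ^+ 2 * `|x|.
Proof.
have [b0 hb] := operator_norm_le.
by apply: le_trans (hb _) _; rewrite expr2 -mulrA ler_wpM2l// adjoint_le.
Qed.

End Adjoint.

Lemma graph_seminormed (Dh : set H) (Ah : H -> H) : self_adjoint ip Dh Ah ->
  seminormed Dh (graph_norm Ah).
Proof.
move=> [[D0 lin] _ _].
have AD x y : Dh x -> Dh y -> Ah (x + y) = Ah x + Ah y.
  by move=> Dx Dy; have [_] := lin 1 x y Dx Dy; rewrite !scale1r.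
have A0 : Ah 0 = 0.
  by have := AD 0 0 D0 D0; rewrite addr0 => /eqP; rewrite -subr_eq0 opprD addNKr oppr_eq0 => /eqP.
split => //.
- by move=> a x y Dx Dy; case: (lin a x y Dx Dy).
- by move=> x y Dx Dy; rewrite /graph_norm AD// ler_normD.
- move=> a x Dx; rewrite /graph_norm; have [_] := lin a x 0 Dx D0.
  by rewrite !addr0 A0 addr0 => ->; rewrite normrZ.
Qed.

End RealHilbert.

(** The difference of the two sides is a square divided by [l * (1 - l)]. For positive [a] and [b]
    equality holds at [l = a / (a + b)], so optimising over [l] recovers the triangle inequality. *)
Lemma sqrD_le_weighted {R : realFieldType} (a b l : R) : 0 < l < 1 ->
  (a + b) ^+ 2 <= a ^+ 2 / l + b ^+ 2 / (1 - l).
Proof.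
move=> /andP[l0 l1]; rewrite -subr_ge0.
have l1' : 0 < 1 - l by rewrite subr_gt0.
have -> : a ^+ 2 / l + b ^+ 2 / (1 - l) - (a + b) ^+ 2 =
   (a * (1 - l) - b * l) ^+ 2 / (l * (1 - l)).
  by field; rewrite ?subr_eq0 !gt_eqF.
by apply: divr_ge0; [exact: sqr_ge0|apply: mulr_ge0; exact: ltW].
Qed.

(* Minkowski's inequality for [calH_norm] is obtained by optimising over [l],
   which avoids the integrability of cross terms. *)
Lemma triangle_of_weighted {R : realFieldType} (p q z : R) : 0 <= p -> 0 <= q -> 0 <= z ->
  (forall l, 0 < l < 1 -> z ^+ 2 <= p ^+ 2 / l + q ^+ 2 / (1 - l)) -> z <= p + q.
Proof.
move=> p0 q0 z0 Hz; apply/ler_addgt0Pr => e e0.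
(* The shift by [e / 2] keeps the optimal [l] strictly between 0 and 1 even if [p] or [q] is
   zero. *)
pose p' := p + e / 2; pose q' := q + e / 2.
have p'0 : 0 < p' by rewrite /p'; lra.
have q'0 : 0 < q' by rewrite /q'; lra.
have pq : 0 < p' + q' by rewrite addr_gt0.
pose l := p' / (p' + q').
have l01 : 0 < l < 1 by rewrite divr_gt0//= ltr_pdivrMr// mul1r ltrDl.
have l1 : 1 - l = q' / (p' + q') by rewrite /l; field; rewrite gt_eqF.
have -> : p + q + e = p' + q' by rewrite /p' /q'; field.
rewrite -(ler_pXn2r (n := 2)) ?nnegrE//; last exact: ltW.
apply: le_trans (Hz l l01) _.
have -> : (p' + q') ^+ 2 = p' ^+ 2 / l + q' ^+ 2 / (1 - l).
  by rewrite l1 /l; field; rewrite !gt_eqF.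
have /andP[l0 l1'] := l01.
apply: lerD; apply: ler_wpM2r.
- by rewrite invr_ge0 ltW.
- by rewrite ler_pXn2r ?nnegrE// ?(ltW p'0)// /p' lerDl divr_ge0// ltW.
- by rewrite invr_ge0 subr_ge0 ltW.
- by rewrite ler_pXn2r ?nnegrE// ?(ltW q'0)// /q' lerDl divr_ge0// ltW.
Qed.

(** * The norm of the phase space *)

Section PhaseSpaceNorm.
Context {R : realType} {H : completeNormedModType R}.
Variable ip : {dot H for idfun}.
Hypothesis ip_norm : hilbert_inner_product ip.
Variables (Dh : set H) (Ah : H -> H).
Hypothesis Ah_sa : self_adjoint ip Dh Ah.
Variable beta : R -> R.
Hypothesis beta_adm : memory_kernel beta.
Notation mu := (@lebesgue_measure R).
Notation X := (calH Dh Ah beta).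
Notation N := (calH_norm ip Ah beta).
Notation pos := (`]0, +oo[%classic : set R).

Let gsn := graph_seminormed Ah_sa.

Let beta_ge0 t : pos t -> 0 <= beta t.
Proof. by case: beta_adm => b0 _ _ _ _; rewrite /= in_itv/= andbT => /ltW; exact: b0. Qed.

Lemma kernel_mass_lt1 : 0 < 1 - kernel_mass beta.
Proof. by case: beta_adm => _ _ _ ? _; rewrite subr_gt0. Qed.

Lemma measurable_kernel : measurable_fun pos beta.
Proof.
case: beta_adm => _ _ ib _ _.
have mb : measurable_fun (`[0, +oo[%classic : set R) beta by apply/measurable_EFinP; exact: measurable_int ib.
by apply: (measurable_funS _ _ mb) => //; apply: subset_itvr; rewrite bnd_simp.
Qed.

Lemma DhD x y : Dh x -> Dh y -> Dh (x + y) /\ Ah (x + y) = Ah x + Ah y.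
Proof.
by move=> Dx Dy; case: Ah_sa => [[_ lin] _ _]; have := lin 1 x y Dx Dy; rewrite !scale1r.
Qed.

Lemma Dh0 : Dh 0 /\ Ah 0 = 0.
Proof.
have D0 : Dh 0 by case: Ah_sa => [[]].
split => //; have [_] := DhD D0 D0; rewrite addr0 => /eqP.
by rewrite -subr_eq0 opprD addNKr oppr_eq0 => /eqP.
Qed.

Lemma DhZ a x : Dh x -> Dh (a *: x) /\ Ah (a *: x) = a *: Ah x.
Proof.
move=> Dx; have [D0 A0] := Dh0; case: Ah_sa => [[_ lin] _ _].
by have := lin a x 0 Dx D0; rewrite !addr0 A0 addr0.
Qed.

Lemma strongly_measurable_lin (D : set R) (a : R) w w' :
  strongly_measurable Dh (graph_norm Ah) D w -> strongly_measurable Dh (graph_norm Ah) D w' ->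
  strongly_measurable Dh (graph_norm Ah) D (a *: w + w').
Proof.
move=> [Xw [s [ss sw]]] [Xw' [r [rs rw]]]; split.
  by move=> t Dt; apply: (sn_lin gsn); [exact: Xw|exact: Xw'].
exists (fun n t => a *: s n t + r n t); split => [n|t Dt].
  apply: fin_valued_simple_into => [|t].
    have := fin_valued_comp (fun p => a *: p.1 + p.2) (fin_valued_pair
      (simple_into_fin_valued (ss n)) (simple_into_fin_valued (rs n))); exact.
  by apply: (sn_lin gsn); [exact: simple_into_X (ss n)|exact: simple_into_X (rs n)].
apply: (@cvg_of_dist _ _ _ _ _ (fun n => `|a| * graph_norm Ah (s n t - w t) +
   graph_norm Ah (r n t - w' t))); last first.
  rewrite -(addr0 (0 : R)); apply: cvgD; last exact: rw.
  by rewrite -(mulr0 `|a|); apply: cvgMr; exact: sw.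
apply: nearW => n.
have X1 := snXB gsn (simple_into_X t (ss n)) (Xw _ Dt).
have X2 := snXB gsn (simple_into_X t (rs n)) (Xw' _ Dt).
rewrite subr0 ger0_norm ?normr_ge0//.
have -> : a *: s n t + r n t - (a *: w + w') t = a *: (s n t - w t) + (r n t - w' t).
  by rewrite /= opprD addrACA scalerBr.
apply: le_trans (snD gsn (snXZ gsn a X1) X2) _.
by rewrite (snZ gsn).
Qed.

Lemma strongly_measurable_cst (D : set R) x : Dh x ->
  strongly_measurable Dh (graph_norm Ah) D (cst x).
Proof.
move=> Dx; apply: (strongly_measurable_simple gsn); apply: fin_valued_simple_into => //.
split; first exact: finite_image_cst.
by move=> q; rewrite preimage_cst; case: ifP => _.
Qed.

Lemma measurable_beta_sqr w : strongly_measurable Dh (graph_norm Ah) pos w ->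
  measurable_fun pos (fun s => beta s * `|Ah (w s)| ^+ 2).
Proof.
move=> mw; apply: measurable_funM; first exact: measurable_kernel.
apply: measurable_funX.
rewrite [X in measurable_fun _ X](_ : _ = (fun t => graph_norm Ah (w t - cst 0 t))).
  have h := measurable_snB gsn (measurable_itv _) mw (strongly_measurable_cst pos Dh0.1); exact: h.
by apply/funext => t; rewrite /graph_norm /= subr0.
Qed.

Lemma L2beta_lin (a : R) w w' : L2beta Dh Ah beta w -> L2beta Dh Ah beta w' ->
  L2beta Dh Ah beta (a *: w + w').
Proof.
move=> [mw iw] [mw' iw']; have msum := strongly_measurable_lin a mw mw'; split => //.
have ib : mu.-integrable pos (fun s => ((2 * a ^+ 2)%:E * (beta s * `|Ah (w s)| ^+ 2)%:E
    + 2%:E * (beta s * `|Ah (w' s)| ^+ 2)%:E)%E).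
  by apply: integrableD => //; apply: integrableZl.
apply: le_integrable ib => //.
  by apply/measurable_EFinP; exact: measurable_beta_sqr.
move=> s ps; have b0 := beta_ge0 ps.
have Dw := mw.1 _ ps; have Dw' := mw'.1 _ ps.
rewrite -!EFinM -EFinD !abse_EFin lee_fin !ger0_norm; first last.
- by rewrite mulr_ge0// exprn_ge0.
- have a0 := sqr_ge0 a; have y0 := exprn_ge0 2 (normr_ge0 (Ah (w s))).
  by apply: addr_ge0; [apply: mulr_ge0; apply: mulr_ge0|apply: mulr_ge0 => //; exact: mulr_ge0].
have -> : Ah ((a *: w + w') s) = a *: Ah (w s) + Ah (w' s).
  by case: Ah_sa => [[_ lin] _ _]; case: (lin a _ _ Dw Dw').
have h1 : `|a *: Ah (w s) + Ah (w' s)| ^+ 2 <= (`|a| * `|Ah (w s)| + `|Ah (w' s)|) ^+ 2.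
  rewrite ler_pXn2r ?nnegrE ?addr_ge0 ?mulr_ge0//.
  by apply: le_trans (ler_normD _ _) _; rewrite normrZ.
have h4 : `|a *: Ah (w s) + Ah (w' s)| ^+ 2 <=
    a ^+ 2 * `|Ah (w s)| ^+ 2 / 2^-1 + `|Ah (w' s)| ^+ 2 / (1 - 2^-1).
  apply: le_trans h1 _; rewrite -[a ^+ 2]real_normK ?num_real// -exprMn.
  by apply: sqrD_le_weighted; apply/andP; split; lra.
apply: le_trans (ler_wpM2l b0 h4) _.
set y := `|Ah (w s)| ^+ 2; set y' := `|Ah (w' s)| ^+ 2; set bb := beta s.
have -> : bb * (a ^+ 2 * y / 2^-1 + y' / (1 - 2^-1)) = 2 * a ^+ 2 * (bb * y) + 2 * (bb * y').
  by field.
exact: lexx.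
Qed.

Definition sqr_part (w : R -> H) : R := \int[mu]_(s in pos) (beta s * `|Ah (w s)| ^+ 2).

Lemma sqr_part_ge0 w : 0 <= sqr_part w.
Proof. by apply: Rintegral_ge0 => s ps; rewrite mulr_ge0 ?exprn_ge0// beta_ge0. Qed.

Lemma calH_dotE (U : phase R H) : calH_dot ip Ah beta U U =
  (1 - kernel_mass beta) * `|Ah U.1.1| ^+ 2 + `|U.1.2| ^+ 2 + sqr_part U.2.
Proof.
rewrite /calH_dot !ip_norm; congr (_ + _).
by apply: eq_Rintegral => s _; rewrite ip_norm.
Qed.

Lemma calH_dot_ge0 (U : phase R H) : 0 <= calH_dot ip Ah beta U U.
Proof.
rewrite calH_dotE !addr_ge0 ?sqr_part_ge0 ?exprn_ge0// mulr_ge0 ?exprn_ge0//.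
exact: ltW kernel_mass_lt1.
Qed.

Lemma calH_normE (U : phase R H) : N U ^+ 2 =
  (1 - kernel_mass beta) * `|Ah U.1.1| ^+ 2 + `|U.1.2| ^+ 2 + sqr_part U.2.
Proof. by rewrite /calH_norm sqr_sqrtr ?calH_dot_ge0// calH_dotE. Qed.

Lemma calH_norm_ge0 (U : phase R H) : 0 <= N U.
Proof. exact: sqrtr_ge0. Qed.

Lemma calH_lin (a : R) (U W : phase R H) : X U -> X W -> X (a *: U + W).
Proof.
move=> [DU LU] [DW LW]; split; last exact: L2beta_lin.
by apply: (sn_lin gsn).
Qed.

Lemma calH_zero : X 0.
Proof.
split; first exact: Dh0.1.
split; first exact: (strongly_measurable_cst pos Dh0.1).
rewrite [X in mu.-integrable _ X](_ : _ = cst 0%E); first exact: integrable0.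
by apply/funext => s /=; rewrite Dh0.2 normr0 expr0n mulr0.
Qed.

Lemma sqr_part_weighted (w w' : R -> H) l : 0 < l < 1 -> L2beta Dh Ah beta w -> L2beta Dh Ah beta w' ->
  sqr_part (w + w') <= sqr_part w / l + sqr_part w' / (1 - l).
Proof.
move=> l01 Lw Lw'; have := L2beta_lin 1 Lw Lw'; rewrite scale1r => -[_ isum].
case: Lw => mw iw; case: Lw' => mw' iw'.
rewrite /sqr_part -!RintegralZr// -RintegralD//; last 2 first.
- rewrite (_ : EFin \o _ = (fun s => (l^-1)%:E * (beta s * `|Ah (w s)| ^+ 2)%:E)%E).
    exact: integrableZl.
  by apply/funext => s /=; rewrite -EFinM mulrC.
- rewrite (_ : EFin \o _ = (fun s => ((1 - l)^-1)%:E * (beta s * `|Ah (w' s)| ^+ 2)%:E)%E).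
    exact: integrableZl.
  by apply/funext => s /=; rewrite -EFinM mulrC.
apply: le_Rintegral => //.
- rewrite (_ : EFin \o _ = (fun s => (l^-1)%:E * (beta s * `|Ah (w s)| ^+ 2)%:E
     + ((1 - l)^-1)%:E * (beta s * `|Ah (w' s)| ^+ 2)%:E)%E).
    by apply: integrableD => //; exact: integrableZl.
  by apply/funext => s /=; rewrite -!EFinM -EFinD !(mulrC _^-1).
move=> s ps; have b0 := beta_ge0 ps.
have [_ ->] := DhD (mw.1 _ ps) (mw'.1 _ ps).
have -> : beta s * `|Ah (w s)| ^+ 2 / l + beta s * `|Ah (w' s)| ^+ 2 / (1 - l) =
    beta s * (`|Ah (w s)| ^+ 2 / l + `|Ah (w' s)| ^+ 2 / (1 - l)) by rewrite mulrDr !mulrA.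
apply: ler_wpM2l => //; apply: le_trans (sqrD_le_weighted _ _ l01).
by rewrite ler_pXn2r ?nnegrE ?addr_ge0// ler_normD.
Qed.

Lemma calH_triangle (U W : phase R H) : X U -> X W -> N (U + W) <= N U + N W.
Proof.
move=> [DU LU] [DW LW].
apply: triangle_of_weighted; rewrite ?calH_norm_ge0// => l l01.
have /andP[l0 l1] := l01.
have k0 := ltW kernel_mass_lt1.
rewrite !calH_normE.
have [_ e1] := DhD DU DW.
have -> : Ah (U + W).1.1 = Ah U.1.1 + Ah W.1.1 by [].
have h1 : `|Ah U.1.1 + Ah W.1.1| ^+ 2 <= `|Ah U.1.1| ^+ 2 / l + `|Ah W.1.1| ^+ 2 / (1 - l).
  apply: le_trans (sqrD_le_weighted _ _ l01).
  by rewrite ler_pXn2r ?nnegrE ?addr_ge0// ler_normD.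
have h2 : `|(U + W).1.2| ^+ 2 <= `|U.1.2| ^+ 2 / l + `|W.1.2| ^+ 2 / (1 - l).
  apply: le_trans (sqrD_le_weighted _ _ l01).
  by rewrite ler_pXn2r ?nnegrE ?addr_ge0// ler_normD.
have h3 : sqr_part (U + W).2 <= sqr_part U.2 / l + sqr_part W.2 / (1 - l).
  exact: sqr_part_weighted.
apply: le_trans (lerD (lerD (ler_wpM2l k0 h1) h2) h3) _.
rewrite le_eqVlt; apply/orP; left; apply/eqP.
move: (1 - kernel_mass beta) (`|Ah U.1.1| ^+ 2) (`|Ah W.1.1| ^+ 2) (`|U.1.2| ^+ 2) (`|W.1.2| ^+ 2)
  (sqr_part U.2) (sqr_part W.2) => *; by field; rewrite ?subr_eq0 !gt_eqF.
Qed.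

Lemma calH_homogeneous (a : R) (U : phase R H) : X U -> N (a *: U) = `|a| * N U.
Proof.
move=> [DU [mU iU]].
apply/eqP; rewrite -(eqrXn2 (n := 2)) ?calH_norm_ge0 ?mulr_ge0 ?calH_norm_ge0//.
rewrite exprMn real_normK ?num_real// !calH_normE.
have -> : Ah (a *: U).1.1 = a *: Ah U.1.1 by case: (DhZ a DU).
have -> : (a *: U).1.2 = a *: U.1.2 by [].
have -> : sqr_part (a *: U).2 = a ^+ 2 * sqr_part U.2.
  rewrite /sqr_part -RintegralZl//; apply: eq_Rintegral => s; rewrite inE => ps.
  have -> : Ah ((a *: U).2 s) = a *: Ah (U.2 s) by case: (DhZ a (mU.1 _ ps)).
  by rewrite normrZ exprMn real_normK ?num_real// mulrCA.
rewrite !normrZ !exprMn !real_normK ?num_real//; apply/eqP.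
by move: (`|Ah U.1.1| ^+ 2) (`|U.1.2| ^+ 2) (sqr_part _) => *; ring.
Qed.

Lemma calH_seminormed : seminormed X N.
Proof.
split; [exact: calH_zero|exact: calH_lin|exact: calH_triangle|exact: calH_homogeneous].
Qed.

(** Meant for values of [calB] and [calF] and their differences, which live in the velocity
    component alone. *)
Lemma calH_norm_mid (U : phase R H) : Ah U.1.1 = 0 -> (forall s, Ah (U.2 s) = 0) -> N U = `|U.1.2|.
Proof.
move=> h1 h2; apply/eqP; rewrite -(eqrXn2 (n := 2)) ?calH_norm_ge0//.
rewrite calH_normE h1 normr0 expr0n mulr0 add0r /sqr_part.
rewrite (@eq_Rintegral _ _ _ _ _ (cst 0)) ?Rintegral_cst ?mul0r ?addr0//.
by move=> s _; rewrite h2 normr0 expr0n mulr0.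
Qed.

Lemma calH_mid x : X (0, x, cst 0).
Proof.
split; first exact: Dh0.1.
split; first exact: (strongly_measurable_cst pos Dh0.1).
rewrite [X in mu.-integrable _ X](_ : _ = cst 0%E); first exact: integrable0.
by apply/funext => s /=; rewrite Dh0.2 normr0 expr0n mulr0.
Qed.

Lemma velocity_le (U : phase R H) : `|U.1.2| <= N U.
Proof.
rewrite -(ler_pXn2r (n := 2)) ?nnegrE ?calH_norm_ge0// calH_normE.
rewrite addrAC lerDr addr_ge0 ?sqr_part_ge0// mulr_ge0 ?exprn_ge0//.
exact: ltW kernel_mass_lt1.
Qed.

Lemma displacement_le (U : phase R H) :
  `|Ah U.1.1| <= (Num.sqrt (1 - kernel_mass beta))^-1 * N U.
Proof.
have k0 := kernel_mass_lt1.
have s0 : 0 < Num.sqrt (1 - kernel_mass beta) by rewrite sqrtr_gt0.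
rewrite mulrC ler_pdivlMr// mulrC -(ler_pXn2r (n := 2)) ?nnegrE ?mulr_ge0 ?calH_norm_ge0 ?sqrtr_ge0//.
rewrite exprMn sqr_sqrtr; last exact: ltW.
by rewrite calH_normE -addrA lerDl addr_ge0 ?sqr_part_ge0// exprn_ge0.
Qed.

End PhaseSpaceNorm.

(** * Coercivity and the energy *)

Section Coercivity.
Context {R : realType} {H : completeNormedModType R}.
Variable ip : {dot H for idfun}.
Hypothesis ip_norm : hilbert_inner_product ip.
Variables (D : set H) (A : H -> H) (Dh : set H) (Ah : H -> H).
Hypothesis A_pos : positive_operator ip D A.
Hypothesis Ah_sqrt : operator_sqrt ip D A Dh Ah.
Variable beta : R -> R.
Hypothesis beta_adm : memory_kernel beta.
Hypothesis calH_hilbert : seq_complete (calH Dh Ah beta) (calH_norm ip Ah beta).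

Let Ah_sa : self_adjoint ip Dh Ah. Proof. by case: Ah_sqrt. Qed.
Let gsn := graph_seminormed Ah_sa.

Lemma AhB x y : Dh x -> Dh y -> Ah (x - y) = Ah x - Ah y.
Proof.
move=> Dx Dy; have [Dy' e] := DhZ Ah_sa (-1) Dy; rewrite !scaleN1r in Dy' e.
by have [_ ->] := DhD Ah_sa Dx Dy'; rewrite e.
Qed.

Lemma Ah_symmetric x y : Dh x -> Dh y -> ip (Ah x) y = ip x (Ah y).
Proof. by move=> Dx Dy; case: Ah_sa => _ _ /(_ y (Ah y))[h _]; apply: h. Qed.

(** Self-adjointness puts such an [r] into the kernel of [Ah], hence into [D] with [A r = 0], which
    positivity of [A] allows only for [r = 0]. *)
Lemma orthogonal_range_eq0 r : (forall z, Dh z -> ip (Ah z) r = 0) -> r = 0.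
Proof.
move=> hr; have [Dr Ar] : Dh r /\ Ah r = 0.
  by case: Ah_sa => _ _ /(_ r 0)[_ h]; apply: h => z Dz; rewrite hr// (ip0r ip).
case: Ah_sqrt => _ _ DE AE; have [D0 A0] := Dh0 Ah_sa.
have Dr' : D r by apply/DE; rewrite Ar.
apply/eqP/negPn/negP => r0; have := A_pos Dr' r0.
by rewrite AE// Ar A0 ipC (ip0r ip) ltxx.
Qed.

(** The vectors [(x, 0, 0)] embed [Dh] into the complete phase space, scaling its norm by
    [Num.sqrt (1 - kernel_mass beta)]; the limit is recovered from the first component. *)
Lemma graph_complete : seq_complete Dh (graph_norm Ah).
Proof.
move=> x Dx cx; set c := Num.sqrt (1 - kernel_mass beta).
have k0 := kernel_mass_lt1 beta_adm.
have c0 : 0 < c by rewrite sqrtr_gt0.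
have A0 := (Dh0 Ah_sa).2.
pose U n : phase R H := (x n, 0, cst 0).
have XU n : calH Dh Ah beta (U n) by split; [exact: Dx|exact: (calH_mid Ah_sa beta 0).2].
have NU m n : calH_norm ip Ah beta (U m - U n) = c * graph_norm Ah (x m - x n).
  have gn : 0 <= graph_norm Ah (x m - x n) by exact: normr_ge0.
  apply/eqP; rewrite -(eqrXn2 (n := 2)) ?calH_norm_ge0 ?mulr_ge0// ?(ltW c0)//.
  rewrite (calH_normE ip_norm _ beta_adm) exprMn sqr_sqrtr ?(ltW k0)//.
  have -> : (U m - U n).1.2 = 0 by rewrite /= subrr.
  rewrite normr0 expr0n addr0 /sqr_part (@eq_Rintegral _ _ _ _ _ (cst 0)).
    by rewrite Rintegral_cst// mul0r addr0.
  by move=> s _; rewrite /= subrr A0 normr0 expr0n mulr0.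
have [|e e0|y Xy cy] := calH_hilbert (x := U); first exact: XU.
  have [n0 Hn] := cx (e / c) (divr_gt0 e0 c0); exists n0 => m n hm hn.
  by rewrite NU mulrC -ltr_pdivlMr//; exact: Hn.
exists y.1.1; first by case: Xy.
apply: (@cvg_of_dist _ _ _ _ _ (fun n => c^-1 * calH_norm ip Ah beta (U n - y))); last first.
  by rewrite -(mulr0 c^-1); apply: cvgMr.
apply: nearW => n; rewrite subr0 ger0_norm /graph_norm//.
exact: (displacement_le ip_norm _ beta_adm (U n - y)).
Qed.

(* Minimising |y - Ah u| over Dh: the residual of the minimiser is orthogonal
   to the range of Ah. *)
Lemma Ah_surjective y : exists2 u, Dh u & Ah u = y.
Proof.
pose E := [set `|y - Ah u| | u in Dh].
have D0 := (Dh0 Ah_sa).1.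
have hE : has_inf E.
  split; first by exists `|y - Ah 0|, 0.
  by exists 0 => _ [u _ <-].
pose d := inf E.
have d_le u : Dh u -> d <= `|y - Ah u| by move=> Du; apply: ge_inf; [case: hE|exists u].
have d0 : 0 <= d by apply: lb_le_inf; [case: hE|move=> _ [u _ <-]].
have ex n : exists u, Dh u /\ `|y - Ah u| < d + n.+1%:R^-1.
  have e0 : (0 : R) < n.+1%:R^-1 by rewrite invr_gt0.
  by have [_ [u Du <-] hu] := inf_adherent e0 hE; exists u.
have [u Hu] := choice ex.
have Du n : Dh (u n) by case: (Hu n).
(* Parallelogram law: the image of the midpoint of [u m] and [u n] is still at distance at least [d]
   from [y], so two almost minimal residuals are close to each other. *)
have para m n (e : R) : 0 <= e -> `|y - Ah (u m)| <= d + e -> `|y - Ah (u n)| <= d + e ->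
    `|Ah (u m - u n)| ^+ 2 <= 4 * (2 * d * e + e ^+ 2).
  move=> e0 hm hn.
  set a := y - Ah (u m) in hm *; set b := y - Ah (u n) in hn *.
  have ab : Ah (u m - u n) = b - a by rewrite AhB// /a /b opprB [RHS]addrC addrA subrK.
  have Dmid : Dh (2^-1 *: (u m + u n)).
    by have [] := DhZ Ah_sa 2^-1 (DhD Ah_sa (Du m) (Du n)).1.
  have Emid : a + b = 2 *: (y - Ah (2^-1 *: (u m + u n))).
    have [_ e1] := DhD Ah_sa (Du m) (Du n); have [_ ->] := DhZ Ah_sa 2^-1 (DhD Ah_sa (Du m) (Du n)).1.
    rewrite e1 scalerBr scalerA divff ?pnatr_eq0// scale1r /a /b.
    by rewrite addrACA -opprD (_ : (2 : R) = 1 + 1)// scalerDl !scale1r.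
  have hab : 4 * d ^+ 2 <= `|a + b| ^+ 2.
    rewrite Emid normrZ exprMn ger0_norm// -natrX ler_wpM2l//.
    by rewrite ler_pXn2r ?nnegrE//; exact: d_le.
  have pid : `|b - a| ^+ 2 = 2 * `|a| ^+ 2 + 2 * `|b| ^+ 2 - `|a + b| ^+ 2.
    by have := parallelogram ip_norm b a; rewrite (addrC b a) => ?; lra.
  have sa : `|a| ^+ 2 <= (d + e) ^+ 2 by rewrite ler_pXn2r ?nnegrE ?addr_ge0.
  have sb : `|b| ^+ 2 <= (d + e) ^+ 2 by rewrite ler_pXn2r ?nnegrE ?addr_ge0.
  rewrite ab pid; move: hab sa sb; rewrite sqrrD.
  by move: (`|a| ^+ 2) (`|b| ^+ 2) (`|a + b| ^+ 2) (d ^+ 2) => *; rewrite -mulr_natl; lra.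
have [|e e0|v Dv cv] := graph_complete (x := u); first exact: Du.
  (* For [x = Num.min 1 e1] one has [x ^+ 2 <= x], so the bound from [para] is at most
     [4 * (2 * d + 1) * x], which is less than [e ^+ 2]. *)
  pose e1 := e ^+ 2 / (4 * (2 * d + 1) + 1) .
  have q0 : 0 < 4 * (2 * d + 1) + 1 by lra.
  have e10 : 0 < Num.min 1 e1 by rewrite lt_min ltr01 divr_gt0// exprn_gt0.
  have [n0 Hn0] : exists n0 : nat, n0.+1%:R^-1 < Num.min 1 e1.
    exists (Num.truncn (Num.min 1 e1)^-1).
    by rewrite invf_plt ?posrE//; exact: truncnS_gt.
  exists n0 => m n hm hn.
  have small j : (n0 <= j)%N -> `|y - Ah (u j)| <= d + Num.min 1 e1.
    move=> hj; have [_ h] := Hu j; apply: ltW; apply: lt_trans h _; rewrite ltrD2l.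
    apply: le_lt_trans Hn0; rewrite lef_pV2 ?posrE// ler_nat//.
  have := para m n _ (ltW e10) (small m hm) (small n hn).
  rewrite /graph_norm => h; rewrite -(ltr_pXn2r (n := 2)) ?nnegrE// ?(ltW e0)//.
  apply: le_lt_trans h _; set x := Num.min 1 e1.
  have x1 : x <= 1 by rewrite /x ge_min lexx.
  have xe : x <= e1 by rewrite /x ge_min lexx orbT.
  apply: (@le_lt_trans _ _ (4 * (2 * d + 1) * x)).
    rewrite -[leRHS]mulrA; apply: ler_wpM2l => //; rewrite [leRHS]mulrDl lerD2l expr2.
    by apply: ler_wpM2r => //; exact: ltW.
  apply: (@lt_le_trans _ _ ((4 * (2 * d + 1) + 1) * x)).
    by rewrite ltr_pM2r// ltrDl.
  by rewrite mulrC -ler_pdivlMr.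
exists v => //; set r := y - Ah v.
suff : r = 0 by move/eqP; rewrite subr_eq0 => /eqP.
have rd : `|r| <= d.
  apply/ler_addgt0Pr => e e0; have e2 : 0 < e / 2 by rewrite divr_gt0.
  move/cvgrPdist_lt : cv => /(_ _ e2) [n1 _ H1].
  pose n := maxn n1 (Num.truncn (e / 2)^-1).
  have h1 : `|Ah (u n - v)| < e / 2.
    have := H1 n (leq_maxl _ _); rewrite sub0r normrN; apply: le_lt_trans; exact: ler_norm.
  have h2 : `|y - Ah (u n)| < d + e / 2.
    have [_ h] := Hu n; apply: lt_le_trans h _; rewrite lerD2l invf_ple ?posrE//.
    apply: le_trans (ltW (truncnS_gt _)) _.
    by rewrite ler_nat ltnS leq_maxr.
  have -> : r = (y - Ah (u n)) + Ah (u n - v) by rewrite AhB// addrA subrK.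
  apply: le_trans (ler_normD _ _) _; rewrite [e]splitr addrA.
  by apply: lerD; exact: ltW.
apply: orthogonal_range_eq0 => z Dz.
apply: (orthogonal_of_minimal ip_norm) => t.
have [Dtz Etz] := DhZ Ah_sa t Dz.
have [Dvt Evt] := DhD Ah_sa Dv Dtz.
by apply: le_trans rd _; have := d_le _ Dvt; rewrite Evt Etz opprD addrA.
Qed.

(* Uniform boundedness of the functionals <u, .> with |Ah u| <= 1: every x is
   some Ah z, and <u, Ah z> = <Ah u, z>. *)
Lemma coercive : exists2 C, 0 <= C & forall u, Dh u -> `|u| <= C * `|Ah u|.
Proof.
pose F : set (H -> R^o) := [set f | exists u, [/\ Dh u, `|Ah u| <= 1 & f = ip u]].
have bF f : F f -> bounded_fun_norm (f : H -> R^o) /\ linear (f : H -> R^o).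
  move=> [u [Du u1 ->]]; split.
    move=> r; exists (`|u| * r) => x xr; apply: le_trans (ip_le ip_norm _ _) _.
    exact: ler_wpM2l.
  by move=> a x y; rewrite (ipDr ip) (ipZr ip).
have pF : pointwise_bounded F.
  move=> x; have [z Dz <-] := Ah_surjective x.
  exists `|z| => _ [u [Du u1 ->]].
  rewrite -Ah_symmetric//; apply: le_trans (ip_le ip_norm _ _) _.
  by rewrite -[leRHS]mul1r; apply: ler_wpM2r.
have [C HC] := Banach_Steinhauss bF pF 1.
have unit u : Dh u -> `|Ah u| <= 1 -> `|u| <= C.
  move=> Du u1; have Fu : F (ip u) by exists u.
  have [->|u0] := eqVneq u 0.
    rewrite normr0; apply: le_trans (HC _ Fu 0 _); rewrite ?normr0//.
  have nu : 0 < `|u| by rewrite normr_gt0.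
  have := HC _ Fu (`|u|^-1 *: u); rewrite normrZ normfV normr_id mulVf ?gt_eqF// lexx.
  move=> /(_ isT); rewrite (ipZr ip) ip_norm expr2 mulrA mulVf ?gt_eqF// mul1r.
  by rewrite normr_id.
have C0 : 0 <= C.
  have [D0 A0] := Dh0 Ah_sa; have := unit 0 D0; rewrite A0 !normr0; exact.
exists C => // u Du; have [Au0|Au0] := eqVneq (Ah u) 0.
  have -> : u = 0.
    by apply: orthogonal_range_eq0 => z Dz; rewrite Ah_symmetric// Au0 (ip0r ip).
  by rewrite normr0 mulr_ge0.
have nA : 0 < `|Ah u| by rewrite normr_gt0.
have [Ds Es] := DhZ Ah_sa (`|Ah u|^-1) Du.
have := unit _ Ds; rewrite Es !normrZ normfV normr_id mulVf ?gt_eqF// lexx => /(_ isT).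
by rewrite mulrC ler_pdivrMr.
Qed.

End Coercivity.

(** Mean value theorem for [s |-> psi (s *: u)] on [[0, 1]], whose derivative is the Gateaux
    derivative of [psi] in direction [u]. The whole segment stays in the ball because [Ah] is
    linear. The factor [|u|] is left for coercivity to absorb. *)
Lemma psi_le {R : realType} {H : completeNormedModType R} (ip : {dot H for idfun})
    (ip_norm : hilbert_inner_product ip) (Dh : set H) (Ah : H -> H)
    (Ah_sa : self_adjoint ip Dh Ah) (psi : H -> R) (gradpsi : H -> H)
    (psi_adm : admissible_nonlinearity ip Dh Ah psi gradpsi) (r e : R) :
  (forall u, Dh u -> `|Ah u| <= r -> `|gradpsi u| <= e * `|Ah u|) ->
  forall u, Dh u -> `|Ah u| <= r -> 0 <= e -> `|psi u| <= e * `|Ah u| * `|u|.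
Proof.
move=> hg u Du ur e0.
pose phi (s : R) := psi (s *: u).
have Ds s : Dh (s *: u) by have [] := DhZ Ah_sa s Du.
have quot s : (fun h : R => h^-1 *: ((phi \o shift s) (h *: (1 : R)) - phi s)) =
    (fun h : R => h^-1 *: ((psi \o shift (s *: u)) (h *: u) - psi (s *: u))).
  by apply/funext => h; rewrite /phi /= scalerDl /= [h *: 1]mulr1.
have dphi s : derivable phi s 1.
  rewrite /derivable quot; exact: (psi_gateaux psi_adm (Ds s) Du).
have Dphi (s : R) : is_derive s (1 : R) phi (ip (gradpsi (s *: u)) u).
  apply: DeriveDef; first exact: dphi.
  by rewrite /derive quot (psi_gradient psi_adm (Ds s) Du).
have [c c01 cE] := MVT_segment (ler01) (fun x _ => Dphi x)
  (derivable_within_continuous (i := `[0, 1]) (fun x _ => dphi x)).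
move: cE c01; rewrite /phi scale1r scale0r (psi_zero psi_adm) !subr0 mulr1 => -> /=.
rewrite in_itv/= => /andP[c0 c1].
have [_ Ec] := DhZ Ah_sa c Du.
have nc : `|Ah (c *: u)| <= `|Ah u|.
  by rewrite Ec normrZ ger0_norm// ler_piMl.
apply: le_trans (ip_le ip_norm _ _) _; apply: ler_wpM2r => //.
apply: le_trans (hg _ (Ds c) (le_trans nc ur)) _; exact: ler_wpM2l.
Qed.

Lemma fine_lebesgue_segment0 {R : realType} (t : R) : 0 <= t ->
  fine (@lebesgue_measure R `[0, t]%classic) = t.
Proof.
move=> t0; rewrite lebesgue_measure_itv/= lte_fin; case: ifPn => [_|].
  by rewrite -EFinB subr0.
by rewrite -leNgt => t0' /=; apply/eqP; rewrite eq_le t0 t0'.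
Qed.

Lemma primitive_rate {R : realType} (k : R -> R) (C1 C2 t : R) :
  (forall T, (@lebesgue_measure R).-integrable `[0, T] (EFin \o k)) -> 0 <= t ->
  primitive (rate k C1 C2) t =
  C1 * (\int[@lebesgue_measure R]_(s in `[0, t]) `|k s|) + C2 * t.
Proof.
move=> ik t0; have ik' := integrable_norm (ik t).
rewrite /primitive /rate RintegralD//; first last.
- exact: integrable_segment_cst.
- by rewrite (_ : EFin \o _ = (fun s => C1%:E * (`|k s|)%:E)%E)//; apply: integrableZl.
rewrite RintegralZl//; congr (_ + _); rewrite Rintegral_cst//; congr (_ * _).
exact: fine_lebesgue_segment0.
Qed.

Lemma integrable_continuous_factor {R : realType} (k f : R -> R) (a b : R) :
  (@lebesgue_measure R).-integrable `[a, b] (EFin \o k) ->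
  {within `[a, b], continuous f} ->
  (@lebesgue_measure R).-integrable `[a, b] (EFin \o (fun s => `|k s| * f s)).
Proof.
move=> ik cf.
have -> : EFin \o (fun s => `|k s| * f s) =
  ((EFin \o (fun s => `|k s|%R)) \* (EFin \o f))%E by apply/funext.
apply: integrableMl => //; first exact: integrable_norm.
  by apply: subspace_continuous_measurable_fun.
have [ab|ba] := leP a b; last first.
  exists 0; split; rewrite ?num_real// => M _ s /=; rewrite in_itv/= => /andP[? ?]; lra.
have [c1 _ h1] := EVT_max ab cf.
have [c2 _ h2] := EVT_min ab cf.
exists (Num.max (f c1) (- f c2)); split; rewrite ?num_real// => M hM s sab.
rewrite /= ler_norml; move: hM; rewrite gt_max => /andP[hM1 hM2].
have := h1 s sab; have := h2 s sab; lra.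
Qed.

(** Linear arithmetic of the energy with its integrals abstracted: [n2] is the squared phase norm,
    [ps] is minus the potential and [de] the delay integral. *)
Lemma energy_split_le {R : realFieldType} (n2 v2 w2 sp ps de x m : R) :
  n2 = m * w2 + v2 + sp -> ps <= x ->
  2^-1 * v2 + m / 2 * w2 + ps + 2^-1 * sp + 2^-1 * de <= 2^-1 * n2 + x + 2^-1 * de.
Proof. by move=> -> h; lra. Qed.

Section ExponentialDecay.
Context {R : realType} {H : completeNormedModType R}.
Variable ip : {dot H for idfun}.
Hypothesis ip_norm : hilbert_inner_product ip.
Variables (Dh : set H) (Ah : H -> H).
Hypothesis Ah_sa : self_adjoint ip Dh Ah.
Variables (B : {linear H -> H}) (Bs : H -> H).
Hypothesis B_bounded : continuous B.
Hypothesis Bs_adj : adjoint_operator ip B Bs.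
Variables (taubar : R) (k beta : R -> R).
Hypothesis k_adm : admissible_coefficient taubar k.
Hypothesis beta_adm : memory_kernel beta.
Variables (psi : H -> R) (U : R -> phase R H).
Notation mu := (@lebesgue_measure R).
Notation X := (calH Dh Ah beta).
Notation N := (calH_norm ip Ah beta).
Hypothesis U_continuous : continuous_into X N `[- taubar, +oo[ U.

(** On the window [[t - taubar, t]] the exponential is at most [expR (m * taubar)] times its value
    at [t], while the integral of [|k|] stays below [K]. The window may reach into negative times,
    so decay is assumed from [- taubar] on. *)
Lemma delay_energy_le (G m : R) : 0 <= m -> 0 <= G ->
  (forall s, - taubar <= s -> N (U s) ^+ 2 <= G * expR (- m * s)) ->
  exists2 C, 0 <= C & forall t, 0 <= t ->
    \int[mu]_(s in `[t - taubar, t]) (`|k s| * `|Bs (U s).1.2| ^+ 2) <=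
    C * expR (- m * t).
Proof.
move=> m0 G0 HU; have [b0 _] := operator_norm_le B_bounded.
have [k_int [K K0 HK]] := k_adm.
set b := operator_norm B in b0 *.
exists (b ^+ 2 * G * expR (m * taubar) * K) => [|t t0].
  by rewrite !mulr_ge0 ?exprn_ge0 ?expR_ge0// ltW.
pose P := b ^+ 2 * G * expR (m * taubar) * expR (- m * t).
have P0 : 0 <= P by rewrite !mulr_ge0 ?exprn_ge0 ?expR_ge0.
have ik : mu.-integrable `[t - taubar, t] (EFin \o k).
  apply: integrableS (k_int t) => //; apply: subset_itvr.
  by rewrite bnd_simp lerBrDr addNr.
have dom s : `[t - taubar, t]%classic s -> `[- taubar, +oo[%classic s.
  by rewrite /= !in_itv/= andbT => /andP[h _]; apply: le_trans h; rewrite lerBrDr addNr.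
have cB : {within `[t - taubar, t], continuous (fun s => `|Bs (U s).1.2|)}.
  apply/subspace_continuousP => s Ds.
  have /(continuous_intoP (calH_seminormed ip_norm Ah_sa beta_adm))[XU cU] := U_continuous.
  have := (continuous_into_subset (calH_seminormed ip_norm Ah_sa beta_adm) dom U_continuous).2 s Ds.
  move=> cUs; apply: (@cvg_of_dist _ _ _ _ _ (fun s' => b * N (U s' - U s))); last first.
    by rewrite -(mulr0 b); apply: cvgMr.
  apply: nearW => s'; apply: le_trans (ler_dist_dist _ _) _.
  rewrite -(adjointB ip_norm Bs_adj); apply: le_trans (adjoint_le ip_norm B_bounded Bs_adj _) _.
  apply: ler_wpM2l => //.
  exact: (velocity_le ip_norm Ah beta_adm (U s' - U s)).
have ile : forall s, `[t - taubar, t]%classic s ->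
    `|k s| * `|Bs (U s).1.2| ^+ 2 <= P * `|k s|.
  move=> s Ds; rewrite mulrC; apply: ler_wpM2r => //.
  have sd : - taubar <= s by move: (dom s Ds); rewrite /= in_itv/= andbT.
  apply: (@le_trans _ _ (b ^+ 2 * N (U s) ^+ 2)).
    rewrite -exprMn ler_pXn2r ?nnegrE ?mulr_ge0 ?calH_norm_ge0//.
    apply: le_trans (adjoint_le ip_norm B_bounded Bs_adj _) _.
    apply: ler_wpM2l => //; exact: (velocity_le ip_norm Ah beta_adm (U s)).
  have -> : P = b ^+ 2 * (G * (expR (m * taubar) * expR (- m * t))) by rewrite /P !mulrA.
  apply: ler_wpM2l; first exact: exprn_ge0.
  apply: le_trans (HU s sd) _; apply: ler_wpM2l => //.
  rewrite -expRD ler_expR.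
  move: Ds; rewrite /= in_itv/= => /andP[ts _].
  have -> : m * taubar + - m * t = - m * (t - taubar) by ring.
  by rewrite !mulNr lerN2; exact: ler_wpM2l.
apply: (@le_trans _ _ (\int[mu]_(s in `[t - taubar, t]) (P * `|k s|))).
  apply: le_Rintegral => //.
  have c2 : {within `[t - taubar, t], continuous (fun s => `|Bs (U s).1.2| ^+ 2)}.
    move=> s; rewrite (_ : (fun s => _ ^+ 2) = (fun s => `|Bs (U s).1.2| * `|Bs (U s).1.2|)).
      by apply: cvgM; exact: cB.
    by apply/funext => x; rewrite expr2.
  exact: integrable_continuous_factor.
  rewrite (_ : EFin \o _ = (fun s => P%:E * (`|k s|)%:E)%E)//.
  by apply: integrableZl => //; exact: integrable_norm.
rewrite RintegralZl//; last exact: integrable_norm.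
have := HK t t0; move/ltW/(ler_wpM2l P0) => h; apply: le_trans h _.
by rewrite /P mulrAC lexx.
Qed.

End ExponentialDecay.

(** * Choice of the constants and the conclusion *)

Theorem theorem3p3 (R : realType) (H : completeNormedModType R)
  (ip : {dot H for idfun}) (ip_norm : hilbert_inner_product ip)
  (D : set H) (A : H -> H)
  (A_sa : self_adjoint ip D A) (A_pos : positive_operator ip D A)
  (Dh : set H) (Ah : H -> H) (Ah_sqrt : operator_sqrt ip D A Dh Ah)
  (B : {linear H -> H}) (B_bounded : continuous B)
  (Bs : H -> H) (Bs_adj : adjoint_operator ip B Bs)
  (taubar : R) (taubar_gt0 : 0 < taubar)
  (tau : R -> R) (tau_adm : admissible_delay taubar tau)
  (k : R -> R) (k_adm : admissible_coefficient taubar k)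
  (beta : R -> R) (beta_adm : memory_kernel beta)
  (psi : H -> R) (gradpsi : H -> H)
  (psi_adm : admissible_nonlinearity ip Dh Ah psi gradpsi)
  (calH_hilbert : seq_complete (calH Dh Ah beta) (calH_norm ip Ah beta))
  (S : R -> phase R H -> phase R H)
  (S_C0 : C0_semigroup (calH Dh Ah beta) (calH_norm ip Ah beta) S)
  (S_gen : generator (calH Dh Ah beta) (calH_norm ip Ah beta) S
             (calA ip D A Dh Ah beta))
  (M omega : R) (M_gt0 : 0 < M) (omega_gt0 : 0 < omega)
  (S_decay : forall (t : R) (U : phase R H), 0 <= t -> calH Dh Ah beta U ->
     calH_norm ip Ah beta (S t U) <=
     M * expR (- omega * t) * calH_norm ip Ah beta U)
  (omega' gamma : R) (omega'_bounds : 0 <= omega' < omega)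
  (k_growth : forall t : R, 0 <= t ->
     operator_norm B ^+ 2 * M * expR (omega * taubar) *
       (\int[@lebesgue_measure R]_(s in `[0, t]) `|k s|)
     <= gamma + omega' * t) :
  exists2 rho : R, 0 < rho &
    forall u0 g : R -> H,
      continuous_into (calH Dh Ah beta) (calH_norm ip Ah beta)
        `[- taubar, 0] (gtilde u0 g) ->
      `|g 0| ^+ 2 + (1 - kernel_mass beta) * `|Ah (u0 0)| ^+ 2
        + \int[@lebesgue_measure R]_(s in `[- taubar, 0])
            (`|k s| * `|Bs (g s)| ^+ 2)
        + \int[@lebesgue_measure R]_(s in `]0, +oo[)
            (beta s * `|Ah (eta0 u0 s)| ^+ 2) < rho ^+ 2 ->
      (forall s : R, - taubar <= s <= 0 -> `|g s| < rho) ->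
      exists U : R -> phase R H,
        [/\ mild_solution ip Dh Ah B Bs taubar tau k beta gradpsi S
              (gtilde u0 g) U,
            forall V : R -> phase R H,
              mild_solution ip Dh Ah B Bs taubar tau k beta gradpsi S
                (gtilde u0 g) V ->
              forall t : R, - taubar <= t ->
                calH_norm ip Ah beta (V t - U t) = 0 &
            exists C : R, forall t : R, 0 <= t ->
              energy Ah Bs taubar k beta psi U t
                <= C * expR (- (omega - omega') * t)].
Proof.
have Ah_sa : self_adjoint ip Dh Ah by case: Ah_sqrt.
have sn := calH_seminormed ip_norm Ah_sa beta_adm.
have [D0 A0] := Dh0 Ah_sa.
have [b0 _] := operator_norm_le B_bounded.
have k0 := kernel_mass_lt1 beta_adm.
set b := operator_norm B in b0 k_growth *.
set N := calH_norm ip Ah beta in sn calH_hilbert S_C0 S_decay *.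
set X := calH Dh Ah beta in sn calH_hilbert S_C0 S_decay *.
pose c := (Num.sqrt (1 - kernel_mass beta))^-1.
have c0 : 0 < c by rewrite invr_gt0 sqrtr_gt0.
have disp W : `|Ah W.1.1| <= c * N W by exact: (displacement_le ip_norm Ah beta_adm W).
have velo W : `|W.1.2| <= N W by exact: (velocity_le ip_norm Ah beta_adm W).
have bb0 : 0 <= b ^+ 2 by exact: exprn_ge0.
have XB W : X W -> X (calB B Bs W) by move=> _; exact: (calH_mid Ah_sa beta _).
have XF W : X W -> X (calF gradpsi W) by move=> _; exact: (calH_mid Ah_sa beta _).
have NB W : N (calB B Bs W) = `|B (Bs W.1.2)|.
  by apply: (calH_norm_mid ip_norm beta_adm).
have NBB W W' : N (calB B Bs W - calB B Bs W') = `|B (Bs W.1.2) - B (Bs W'.1.2)|.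
  by apply: (calH_norm_mid ip_norm beta_adm) => [|s]; rewrite /= subr0.
have NF W : N (calF gradpsi W) = `|gradpsi W.1.1|.
  by apply: (calH_norm_mid ip_norm beta_adm).
have NFF W W' : N (calF gradpsi W - calF gradpsi W') = `|gradpsi W.1.1 - gradpsi W'.1.1|.
  by apply: (calH_norm_mid ip_norm beta_adm) => [|s]; rewrite /= subr0.
have B_norm W : X W -> N (calB B Bs W) <= b ^+ 2 * N W.
  move=> _; rewrite NB; apply: le_trans (BBs_le ip_norm B_bounded Bs_adj _) _.
  exact: ler_wpM2l.
have B_lip W W' : X W -> X W' -> N (calB B Bs W - calB B Bs W') <= b ^+ 2 * N (W - W').
  move=> _ _; rewrite NBB -linearB -(adjointB ip_norm Bs_adj).
  apply: le_trans (BBs_le ip_norm B_bounded Bs_adj _) _.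
  by apply: ler_wpM2l => //; exact: velo (W - W').
have F_lip r : 0 < r -> exists2 L, 0 < L & forall W W', X W -> X W' ->
    N W <= r -> N W' <= r -> N (calF gradpsi W - calF gradpsi W') <= L * N (W - W').
  move=> r_gt0; have [L L0 HL] := psi_lipschitz psi_adm (mulr_gt0 c0 r_gt0).
  exists (L * c) => [|W W' [DW _] [DW' _] Wr W'r]; first exact: mulr_gt0.
  rewrite NFF; apply: le_trans (HL _ _ DW DW' _ _) _.
  - by apply: le_trans (disp W) _; rewrite ler_pM2l.
  - by apply: le_trans (disp W') _; rewrite ler_pM2l.
  by rewrite -mulrA ler_pM2l//; exact: disp (W - W').
have k_int T : (@lebesgue_measure R).-integrable `[0, T] (EFin \o k).
  case: k_adm => ik _; apply: integrableS (ik T) => //; apply: subset_itvr.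
  by rewrite bnd_simp oppr_le0 ltW.
have /andP[w'0 w'w] := omega'_bounds.
pose m := omega - omega'.
have m0 : 0 < m by rewrite subr_gt0.
pose delta := m / (2 * M).
have delta0 : 0 < delta by rewrite divr_gt0 ?mulr_gt0.
have [h [ch hmono h0 hg]] := psi_growth psi_adm.
(* Continuity of [h] at 0 together with [h 0 = 0]. The target is [delta / c] because [|Ah u|] is at
   most [c] times the phase norm, so that [F] is bounded by [delta] times that norm. *)
have [r1 r10 hr1] : exists2 r1, 0 < r1 & forall x, 0 <= x -> x <= r1 -> h x <= delta / c.
  move/subspace_continuousP : ch => /(_ 0); rewrite /= in_itv/= lexx => /(_ isT).
  move/cvgrPdist_lt => /(_ _ (divr_gt0 delta0 c0)); rewrite near_withinE => -[d /= d0 Hd].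
  exists (d / 2); first by rewrite divr_gt0.
  move=> x x0 xd; have H' : `|h 0 - h x| < delta / c.
    have := Hd x; rewrite /ball_/= sub0r normrN (ger0_norm x0); apply.
      by apply: le_lt_trans xd _; rewrite ltr_pdivrMr// mulr_natr mulr2n ltrDl.
    by rewrite in_itv/= x0.
  by move: H'; rewrite h0 sub0r normrN => /ltW; apply: le_trans; exact: ler_norm.
have grad_small u : Dh u -> `|Ah u| <= r1 -> `|gradpsi u| <= delta / c * `|Ah u|.
  by move=> Du ur; apply: le_trans (hg u Du) _; apply: ler_wpM2r => //; exact: hr1.
pose r0 := r1 / c.
have r00 : 0 < r0 by rewrite divr_gt0.
have cr0 : c * r0 = r1 by rewrite /r0 mulrC divfK// gt_eqF.
have F_small W : X W -> N W <= r0 -> N (calF gradpsi W) <= delta * N W.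
  move=> [DW _] Wr; rewrite NF; apply: le_trans (grad_small _ DW _) _.
    by apply: le_trans (disp W) _; rewrite -cr0 ler_pM2l.
  apply: le_trans (ler_wpM2l _ (disp W)) _; first by rewrite divr_ge0// ltW.
  by rewrite mulrA divfK ?gt_eqF.
(* Solves [(M + 1) * (2 * rho) * expR gamma = r0], with [2 * rho] the bound on the history and
   [expR gamma] the constant part of the growth of the weight. *)
pose rho := r0 / (2 * ((M + 1) * expR gamma)).
have M10 : 0 < M + 1 by rewrite addr_gt0.
have Mg0 : 0 < (M + 1) * expR gamma by rewrite mulr_gt0// expR_gt0.
have rho0 : 0 < rho by rewrite divr_gt0// mulr_gt0.
have rhoE : (M + 1) * (2 * rho) * expR gamma = r0.
  by rewrite /rho; field; rewrite !gt_eqF// expR_gt0.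
have K0 : 0 <= (M + 1) * (2 * rho).
  by apply: mulr_ge0; [|apply: mulr_ge0 => //]; exact: ltW.
exists rho => // u0 g cini Hini Hg.
(* The square of the norm is at most [2 * rho ^+ 2]: the velocity at time [t] is bounded by the
   condition on [g], the other two components by the integrated smallness condition. *)
have ini_le t : - taubar <= t <= 0 -> N (gtilde u0 g t) <= 2 * rho.
  move=> tt; rewrite -(ler_pXn2r (n := 2)) ?nnegrE ?calH_norm_ge0//; last first.
    by rewrite mulr_ge0// ltW.
  rewrite (calH_normE ip_norm Ah beta_adm) /=.
  have g1 : `|g t| ^+ 2 <= rho ^+ 2.
    by rewrite ler_pXn2r ?nnegrE// ?(ltW rho0)//; apply: ltW; exact: Hg.
  have g2 : 0 <= `|g 0| ^+ 2 by exact: exprn_ge0.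
  have g3 : 0 <= \int[@lebesgue_measure R]_(s in `[- taubar, 0]) (`|k s| * `|Bs (g s)| ^+ 2).
    by apply: Rintegral_ge0 => s _; rewrite mulr_ge0// exprn_ge0.
  have g4 : 0 <= rho ^+ 2 by exact: sqr_ge0.
  move: Hini; rewrite -/(sqr_part Ah beta (eta0 u0)) => Hini.
  rewrite exprMn; move: Hini g1 g2 g3 g4.
  by move: (Rintegral _ _ _) (sqr_part _ _ _) (`|g t| ^+ 2) (`|g 0| ^+ 2)
    (_ * `|Ah (u0 0)| ^+ 2) (rho ^+ 2) => *; lra.
pose w := weight k (M * (b ^+ 2 * expR (omega * taubar))) (M * delta).
(* The exponent is at most [- omega * t + gamma + omega' * t + M * delta * t], and
   [M * delta = m / 2]. The norm keeps half of the rate [m], and its square decays at the full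
   rate. *)
have B_le t : 0 <= t -> (M + 1) * (2 * rho) * expR (- omega * t) * w t <=
    r0 * expR (- (m / 2) * t).
  move=> t0; have Kp : 0 < (M + 1) * (2 * rho) by apply: mulr_gt0 => //; exact: mulr_gt0.
  rewrite -rhoE -[leLHS]mulrA -[leRHS]mulrA ler_pM2l// -!expRD ler_expR primitive_rate//.
  have kg := k_growth t t0.
  have -> : M * delta = m / 2 by rewrite /delta; field; rewrite gt_eqF.
  have -> : M * (b ^+ 2 * expR (omega * taubar)) = b ^+ 2 * M * expR (omega * taubar) by ring.
  by move: kg; rewrite /m; move: (_ * Rintegral _ _ _) => I kg; lra.
have B_r0 t : 0 <= t -> (M + 1) * (2 * rho) * expR (- omega * t) * w t <= r0.
  move=> t0; apply: le_trans (B_le t t0) _; rewrite -[leRHS]mulr1 ler_pM2l//.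
  rewrite -expR0 ler_expR mulNr oppr_le0; apply: mulr_ge0 => //.
  by apply: divr_ge0 => //; exact: ltW.
have [tau_c tau_b] := tau_adm.
have [U [cU iU DU bU]] := mild_exists sn calH_hilbert S_C0 M_gt0 omega_gt0 S_decay
  taubar_gt0 tau_c tau_b k_int bb0 XB B_norm B_lip XF F_lip cini
  r00 (ltW delta0) (mulr_ge0 (ler0n _ 2) (ltW rho0)) F_small ini_le B_r0.
exists U; split; first by split.
  move=> V [cV iV DV]; exact: (mild_unique sn S_C0 M_gt0 omega_gt0 S_decay
    taubar_gt0 tau_b k_int bb0 XB B_lip XF F_lip cini cU iU DU cV iV DV).
have N_decay t : 0 <= t -> N (U t) ^+ 2 <= r0 ^+ 2 * expR (- m * t).
  move=> t0; have tt : - taubar <= t by apply: le_trans t0; rewrite oppr_le0 ltW.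
  have -> : r0 ^+ 2 * expR (- m * t) = (r0 * expR (- (m / 2) * t)) ^+ 2.
    by rewrite [RHS]exprMn [expR (- (m / 2) * t) ^+ 2]expr2 -expRD; congr (_ * expR _); field.
  rewrite ler_pXn2r ?nnegrE ?calH_norm_ge0//; last first.
    by rewrite mulr_ge0 ?expR_ge0// ltW.
  exact: le_trans (bU t tt) (B_le t t0).
(* The decay bound is extended to the history interval, where the weight is 1 and
   [expR (- m * s) >= 1], so a constant bound suffices. *)
pose G1 := (M + 1) * (2 * rho) * expR (omega * taubar).
have N_all s : - taubar <= s -> N (U s) ^+ 2 <= (r0 ^+ 2 + G1 ^+ 2) * expR (- m * s).
  move=> ss; have [s0|s0] := leP 0 s.
    apply: le_trans (N_decay s s0) _; apply: ler_wpM2r; first exact: expR_ge0.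
    by rewrite lerDl sqr_ge0.
  have n1 : N (U s) <= G1.
    apply: le_trans (bU s ss) _.
    rewrite /w /weight primitive_le0 ?(ltW s0)// expR0 mulr1 /G1.
    apply: ler_wpM2l; first exact: K0.
    rewrite ler_expR mulNr -mulrN; apply: ler_wpM2l; first exact: ltW.
    by rewrite lerNl.
  have G10 : 0 <= G1 by exact: le_trans (calH_norm_ge0 _ _ _ _) n1.
  have e1 : 1 <= expR (- m * s).
    rewrite -expR0 ler_expR mulNr oppr_ge0; apply: mulr_ge0_le0; exact: ltW.
  apply: (@le_trans _ _ (r0 ^+ 2 + G1 ^+ 2)).
    apply: (@le_trans _ _ (G1 ^+ 2)); last by rewrite lerDr sqr_ge0.
    by rewrite ler_pXn2r ?nnegrE ?calH_norm_ge0.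
  by rewrite -[leLHS]mulr1; apply: ler_wpM2l => //; rewrite addr_ge0 ?sqr_ge0.
have G0 : 0 <= r0 ^+ 2 + G1 ^+ 2 by rewrite addr_ge0 ?sqr_ge0.
have [C2 C20 HC2] := delay_energy_le ip_norm Ah_sa B_bounded Bs_adj k_adm
  beta_adm cU (ltW m0) G0 N_all.
have [Cc Cc0 HCc] := coercive ip_norm A_pos Ah_sqrt beta_adm calH_hilbert.
(* The three terms come from the squared norm, from the potential through coercivity, and from the
   delay integral. *)
exists ((2^-1 + delta * Cc * c) * r0 ^+ 2 + 2^-1 * C2) => t t0.
have tt : - taubar <= t by apply: le_trans t0; rewrite oppr_le0 ltW.
have [DU' _] : X (U t) by apply: cU.1; rewrite /= in_itv/= andbT.
have Nt : N (U t) <= r0 by apply: le_trans (bU t tt) (B_r0 t t0).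
have At : `|Ah (U t).1.1| <= r1 by apply: le_trans (disp (U t)) _; rewrite -cr0 ler_pM2l.
have dc0 : 0 <= delta / c by rewrite divr_ge0// ltW.
have psi_t : - psi (U t).1.1 <= delta * Cc * c * N (U t) ^+ 2.
  apply: le_trans (ler_norm _) _; rewrite normrN.
  apply: le_trans (psi_le ip_norm Ah_sa psi_adm grad_small DU' At dc0) _.
  apply: le_trans (ler_wpM2l _ (HCc _ DU')) _; first by rewrite mulr_ge0.
  have -> : delta / c * `|Ah (U t).1.1| * (Cc * `|Ah (U t).1.1|) =
    delta / c * Cc * `|Ah (U t).1.1| ^+ 2 by ring.
  have -> : delta * Cc * c * N (U t) ^+ 2 = delta / c * Cc * (c * N (U t)) ^+ 2.
    by field; rewrite gt_eqF.
  apply: ler_wpM2l; first exact: mulr_ge0.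
  by rewrite ler_pXn2r ?nnegrE ?mulr_ge0 ?calH_norm_ge0// ltW.
have := HC2 t t0; set de := Rintegral _ _ _ => hde.
rewrite /energy -/de.
apply: le_trans (energy_split_le _ (calH_normE ip_norm Ah beta_adm (U t)) psi_t) _.
rewrite -/N mulrDl; apply: lerD; last by rewrite -mulrA ler_pM2l// invr_gt0.
rewrite -mulrDl -[leRHS]mulrA; apply: ler_wpM2l; last exact: N_decay.
apply: addr_ge0; first by rewrite invr_ge0.
by apply: mulr_ge0; [apply: mulr_ge0 => //|]; exact: ltW.
Qed.
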